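(* Over a field $k$, the categories of braiding operators, of Hopf skew-braces and of Yetter–Drinfeld braces are isomorphic.
   Context: All vector spaces, maps and tensor products are over $k$ (maps are linear); Sweedler notation is used; $\mu,\eta,\epsilon,S$ are the multiplication, unit, counit and antipode of a Hopf algebra $H$; $H$ inside a tensor product of maps denotes $\mathrm{id}_H$; $H^{\mathrm{cop}}$, $H^{\mathrm{op}}$ denote opposite coalgebra/algebra. Multiplication in $H$ binds tighter than $\cdot$, $\mathbin{:}$, $\times$. Braiding operators: pairs $(H,s)$ of a Hopf algebra $H$ and a coalgebra endomorphism $s$ of $H\otimes H$ such that $(s\otimes H)(H\otimes s)(s\otimes H)=(H\otimes s)(s\otimes H)(H\otimes s)$, $s(\mu\otimes H)=(H\otimes\mu)(s\otimes H)(H\otimes s)$, $s(H\otimes\mu)=(\mu\otimes H)(H\otimes s)(s\otimes H)$, $s(\eta\otimes H)=H\otimes\eta$, $s(H\otimes\eta)=\eta\otimes H$ and $\mu=\mu\circ s$. A morphism $(H,s)\to(K,s')$ is a Hopf algebra morphism $f$ with $(f\otimes f)s=s'(f\otimes f)$. Hopf skew-braces: triples $(H,\cdot,\mathbin{:})$, $H$ a Hopf algebra, with linear maps $\cdot,\mathbin{:}\colon H\otimes H\to H$ satisfying $\epsilon(x\cdot y)=\epsilon(x\mathbin{:}y)=\epsilon(x)\epsilon(y)$ such that: $H\otimes H^{\mathrm{cop}}\to H^{\mathrm{cop}}\otimes H$, $x\otimes y\mapsto y_{(1)}\mathbin{:}x_{(2)}\otimes x_{(1)}\cdot y_{(2)}$,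 is a coalgebra morphism; $x\otimes y\mapsto x\cdot y_{(1)}\otimes y_{(2)}$ is invertible; for all $x,y,z$: $(x\cdot y_{(1)})\cdot(z\mathbin{:}y_{(2)})=(x\cdot z_{(2)})\cdot(y\cdot z_{(1)})$, $(x\cdot y_{(1)})\mathbin{:}(z\cdot y_{(2)})=(x\mathbin{:}z_{(2)})\cdot(y\mathbin{:}z_{(1)})$, $(x\mathbin{:}y_{(1)})\mathbin{:}(z\mathbin{:}y_{(2)})=(x\mathbin{:}z_{(2)})\mathbin{:}(y\cdot z_{(1)})$; $H$ is a right $H^{\mathrm{op}}$-module via $\cdot$ and via $\mathbin{:}$; $hm\cdot l=(h\cdot(l_{(1)}\mathbin{:}m_{(2)}))(m_{(1)}\cdot l_{(2)})$ and $hm\mathbin{:}l=(h\mathbin{:}(l_{(1)}\cdot m_{(2)}))(m_{(1)}\mathbin{:}l_{(2)})$; and $(m\mathbin{:}h_{(2)})h_{(1)}=(h\cdot m_{(1)})m_{(2)}$, for all $h,m,l\in H$. Morphisms are Hopf algebra morphisms compatible with $\cdot$ and $\mathbin{:}$. Yetter–Drinfeld modules: a (left-left) Yetter–Drinfeld module on $H$ is a left $H$-module $X$ (action ${}^hx$) that is a left $H$-comodule via $\rho(x)=x_{(-1)}\otimes x_{(0)}$ with $\rho({}^hx)=h_{(1)}x_{(-1)}S(h_{(3)})\otimes{}^{h_{(2)}}x_{(0)}$; with module-and-comodule morphisms these form the usual braided tensor category ${}^H_H\mathcal{YD}$. Yetter–Drinfeld braces: triples $(H,\times,T)$ of a Hopf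 algebra $H$, an associative internal operation $\times$ of $H$ and a map $T\colon H\to H$ such that: (i) the underlying coalgebra of $H$, endowed with the multiplication $\times$, the same unit as $H$, the left action ${}^hl:=T(h_{(1)})\times h_{(2)}l$ and the coaction $\rho(h):=h_{(1)}S(h_{(3)})\otimes h_{(2)}$, is a Hopf algebra in ${}^H_H\mathcal{YD}$ with antipode $T$; (ii) with $h^l:=S({}^{h_{(1)}}l_{(1)})h_{(2)}l_{(2)}$, one has ${}^{h_{(1)}}l_{(1)}\otimes{h_{(2)}}^{l_{(2)}}={}^{h_{(2)}}l_{(2)}\otimes{h_{(1)}}^{l_{(1)}}$ for all $h,l\in H$; (iii) $h(m\times l)=h_{(1)}m\times T(h_{(2)})\times h_{(3)}l$ for all $h,m,l\in H$. A morphism $(H,\times,T)\to(K,\times,T)$ is a Hopf algebra morphism $f$ with $f(h\times l)=f(h)\times f(l)$ and $T\circ f=f\circ T$. *)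

(* Defs.v *)
From HB Require Import structures.
From mathcomp Require Import all_boot all_order all_algebra.
From mathcomp Require Import sesquilinear generic_quotient.
From mathcomp Require Import boolp.

Set Implicit Arguments.
Unset Strict Implicit.
Unset Printing Implicit Defensive.

Import GRing.Theory.
Local Open Scope ring_scope.
Local Open Scope quotient_scope.

Local Notation linear f := (GRing.linear_for *:%R f).
Local Notation scalar f := (GRing.linear_for *%R f).
Local Notation bilinear f := (bilinear_for *:%R *:%R f).

(* U (x) V is the quotient of the set of formal finite sums of pairs (u, v)
   by the congruence generated by the bilinearity relations.  The rule
   [tens_zero] is needed because formal sums only form a monoid. *)

Section TensorDef.
Variables (k : fieldType) (U V : lmodType k).

Inductive tens_rel : seq (U * V) -> seq (U * V) -> Prop :=
| tens_refl s : tens_rel s s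
| tens_sym s t : tens_rel s t -> tens_rel t s
| tens_trans s t r : tens_rel s t -> tens_rel t r -> tens_rel s r
| tens_cat s s' t t' :
    tens_rel s s' -> tens_rel t t' -> tens_rel (s ++ t) (s' ++ t')
| tens_comm s t : tens_rel (s ++ t) (t ++ s)
| tens_zero v : tens_rel [:: (0, v)] [::]
| tens_addl u u' v : tens_rel [:: (u + u', v)] [:: (u, v); (u', v)]
| tens_addr u v v' : tens_rel [:: (u, v + v')] [:: (u, v); (u, v')]
| tens_scale a u v : tens_rel [:: (a *: u, v)] [:: (u, a *: v)].

Definition tens_relb (s t : seq (U * V)) : bool := `[< tens_rel s t >].

Lemma tens_relb_refl : reflexive tens_relb.
Proof. by move=> s; apply/asboolP/tens_refl. Qed.

Lemma tens_relb_sym : symmetric tens_relb.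
Proof.
by move=> s t; apply/idP/idP => /asboolP H; apply/asboolP/tens_sym.
Qed.

Lemma tens_relb_trans : transitive tens_relb.
Proof.
move=> t s r /asboolP st /asboolP tr; apply/asboolP; exact: tens_trans tr.
Qed.

Canonical tens_equiv :=
  EquivRel tens_relb tens_relb_refl tens_relb_sym tens_relb_trans.

Definition tensor := {eq_quot tens_equiv}.

HB.instance Definition _ := Choice.on tensor.
HB.instance Definition _ := EqQuotient.on tensor.

Lemma tensP s t : tens_rel s t <-> \pi_tensor s = \pi_tensor t.
Proof. by split=> [H|/eqmodP/asboolP //]; apply/eqmodP/asboolP. Qed.

Lemma repr_rel s : tens_rel (repr (\pi_tensor s)) s.
Proof. by apply/tensP; rewrite reprK. Qed.

Lemma tensW (P : tensor -> Prop) :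
  (forall s, P (\pi_tensor s)) -> forall t, P t.
Proof. by move=> h t; rewrite -[t]reprK. Qed.

Definition scale_seq (a : k) (s : seq (U * V)) : seq (U * V) :=
  [seq (a *: p.1, p.2) | p <- s].

Lemma scale_seq_rel a s t : tens_rel s t ->
  tens_rel (scale_seq a s) (scale_seq a t).
Proof.
rewrite /scale_seq; elim=> {s t} /=.
- by move=> s; exact: tens_refl.
- by move=> s t _; exact: tens_sym.
- by move=> s t r _ st _; exact: tens_trans.
- by move=> s s' t t' _ h _ h'; rewrite !map_cat; exact: tens_cat.
- by move=> s t; rewrite !map_cat; exact: tens_comm.
- by move=> v; rewrite scaler0; exact: tens_zero.
- by move=> u u' v; rewrite scalerDr; exact: tens_addl.
- by move=> u v v'; exact: tens_addr.
- by move=> b u v; rewrite scalerA mulrC -scalerA; exact: tens_scale.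
Qed.

Definition tens0 : tensor := \pi_tensor [::].
Definition tens_add (t t' : tensor) : tensor := \pi_tensor (repr t ++ repr t').
Definition tens_scl (a : k) (t : tensor) : tensor := \pi_tensor (scale_seq a (repr t)).
Definition tens_opp (t : tensor) : tensor := tens_scl (- 1) t.

Lemma pi_cat s t :
  \pi_tensor (s ++ t) = tens_add (\pi_tensor s) (\pi_tensor t).
Proof. by apply/tensP/tens_cat; apply/tens_sym/repr_rel. Qed.

Lemma pi_scl a s : \pi_tensor (scale_seq a s) = tens_scl a (\pi_tensor s).
Proof. by apply/tensP/scale_seq_rel/tens_sym/repr_rel. Qed.

Lemma tens_addA : associative tens_add.
Proof.
elim/tensW=> x; elim/tensW=> y; elim/tensW=> z.
by rewrite -!pi_cat catA.
Qed.

Lemma tens_addC : commutative tens_add.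
Proof.
elim/tensW=> x; elim/tensW=> y; rewrite -!pi_cat.
exact/tensP/tens_comm.
Qed.

Lemma tens_add0 : left_id tens0 tens_add.
Proof. by elim/tensW=> x; rewrite -pi_cat. Qed.

Lemma tens_sclDl t : {morph tens_scl^~ t : a b / a + b >-> tens_add a b}.
Proof.
elim/tensW: t => t a b; rewrite -!pi_scl -pi_cat; apply/tensP.
elim: t => [|[u v] s IH] /=; first exact: tens_refl.
rewrite scalerDl.
have h := tens_cat (tens_addl (a *: u) (b *: u) v) IH.
apply: (tens_trans h) => /=.
pose x := [:: (a *: u, v)]; pose y := [:: (b *: u, v)].
rewrite -/(scale_seq a s) -/(scale_seq b s).
rewrite -[X in tens_rel X]/(x ++ (y ++ scale_seq a s ++ scale_seq b s)).
rewrite -[X in tens_rel _ X]/(x ++ (scale_seq a s ++ y ++ scale_seq b s)).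
apply: tens_cat; first exact: tens_refl.
rewrite !catA; apply: tens_cat; last exact: tens_refl.
exact: tens_comm.
Qed.

Lemma tens_scl0 t : tens_scl 0 t = tens0.
Proof.
elim/tensW: t => t; rewrite -pi_scl; apply/tensP.
elim: t => [|[u v] s IH] /=; first exact: tens_refl.
rewrite scale0r; exact: (tens_cat (tens_zero v) IH).
Qed.

Lemma tens_scl1 : left_id 1 tens_scl.
Proof.
elim/tensW=> t; rewrite -pi_scl; congr (\pi_tensor _).
by rewrite /scale_seq -[RHS]map_id; apply: eq_map => -[u v]; rewrite /= scale1r.
Qed.

Lemma tens_sclA a b t : tens_scl a (tens_scl b t) = tens_scl (a * b) t.
Proof.
elim/tensW: t => t; rewrite -!pi_scl; congr (\pi_tensor _); rewrite /scale_seq -map_comp.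
by apply: eq_map => -[u v]; rewrite /= scalerA.
Qed.

Lemma tens_sclDr : right_distributive tens_scl tens_add.
Proof.
move=> a; elim/tensW=> x; elim/tensW=> y.
by rewrite -pi_cat -!pi_scl -pi_cat /scale_seq map_cat.
Qed.

Lemma tens_addN : left_inverse tens0 tens_opp tens_add.
Proof.
by move=> t; rewrite -[X in tens_add _ X]tens_scl1 -tens_sclDl addNr tens_scl0.
Qed.

HB.instance Definition _ :=
  GRing.isZmodule.Build tensor tens_addA tens_addC tens_add0 tens_addN.
HB.instance Definition _ :=
  GRing.Zmodule_isLmodule.Build k tensor
    tens_sclA tens_scl1 tens_sclDr tens_sclDl.

Definition pure (u : U) (v : V) : tensor := \pi_tensor [:: (u, v)].

(* Sum of f u v along a chosen decomposition t = \sum u (x) v.  When f is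
   bilinear this is the value at t of the linear map induced by f, whatever
   the decomposition ([tsum_pure], [tsum_linear]); it is only used for such
   f, and it is what gives its meaning to Sweedler notation below. *)
Definition tsum (W : nmodType) (t : tensor) (f : U -> V -> W) : W :=
  \sum_(p <- repr t) f p.1 p.2.

Lemma pure_bilinear : bilinear pure.
Proof.
have addl u u' v : pure (u + u') v = pure u v + pure u' v.
  rewrite -[RHS]pi_cat; exact/tensP/tens_addl.
have addr u v v' : pure u (v + v') = pure u v + pure u v'.
  rewrite -[RHS]pi_cat; exact/tensP/tens_addr.
have scl a u v : pure (a *: u) v = a *: pure u v by rewrite -[RHS]pi_scl.
split=> [v a u u' | u a v v']; first by rewrite /= addl scl.
rewrite /= addr -scl; congr (_ + _).
exact/tensP/tens_sym/tens_scale.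
Qed.

Lemma tensor_sum_pure t : t = \sum_(p <- repr t) pure p.1 p.2.
Proof.
rewrite -[LHS]reprK; elim: (repr t) => [|[u v] s IH]; first by rewrite big_nil.
by rewrite big_cons -IH -[RHS]pi_cat.
Qed.

Lemma tsum_rel (W : lmodType k) (f : U -> V -> W) s t :
  bilinear f -> tens_rel s t ->
  \sum_(p <- s) f p.1 p.2 = \sum_(p <- t) f p.1 p.2.
Proof.
case=> fl fr; elim=> {s t} /=.
- by [].
- by move=> s t _ ->.
- by move=> s t r _ -> _ ->.
- by move=> s s' t t' _ h _ h'; rewrite !big_cat /= h h'.
- by move=> s t; rewrite !big_cat /= addrC.
- move=> v; rewrite big_seq1 big_nil /=.
  by have := fl v (-1) 0 0; rewrite /= scaler0 addr0 scaleN1r addNr.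
- move=> u u' v; rewrite big_seq1 big_cons big_seq1 /=.
  by have := fl v 1 u u'; rewrite /= !scale1r.
- move=> u v v'; rewrite big_seq1 big_cons big_seq1 /=.
  by have := fr u 1 v v'; rewrite /= !scale1r.
- move=> a u v; rewrite !big_seq1 /=.
  have fl0 : f 0 v = 0.
    by have := fl v (-1) 0 0; rewrite /= scaler0 addr0 scaleN1r addNr.
  have fr0 : f u 0 = 0.
    by have := fr u (-1) 0 0; rewrite /= scaler0 addr0 scaleN1r addNr.
  have := fl v a u 0; rewrite /= addr0 fl0 addr0 => ->.
  by have := fr u a v 0; rewrite /= addr0 fr0 addr0 => ->.
Qed.

Lemma tsum_pure (W : lmodType k) (f : U -> V -> W) u v :
  bilinear f -> tsum (pure u v) f = f u v.
Proof. by move=> fb; rewrite /tsum (tsum_rel fb (repr_rel _)) big_seq1. Qed.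

Lemma tsum_linear (W : lmodType k) (f : U -> V -> W) :
  bilinear f -> linear (fun t : tensor => tsum t f).
Proof.
move=> fb a t t'; rewrite /tsum.
have rel : tens_rel (repr (a *: t + t')) (scale_seq a (repr t) ++ repr t').
  by apply/tensP; rewrite reprK pi_cat pi_scl !reprK.
rewrite (tsum_rel fb rel) big_cat big_map /=; congr (_ + _).
rewrite scaler_sumr; apply: eq_bigr => -[u v] _ /=.
have [fl _] := fb.
have fl0 : f 0 v = 0.
  by have := fl v (-1) 0 0; rewrite /= scaler0 addr0 scaleN1r addNr.
by have := fl v a u 0; rewrite /= addr0 fl0 addr0.
Qed.

End TensorDef.

Arguments tens_rel {k U V}.
Arguments pure {k U V}.
Arguments tsum {k U V W}.

Notation "u \ox v" := (pure u v) (at level 38, left associativity).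
Notation "'\tsum_' ( u , v <- t ) E" := (tsum t (fun u v => E))
  (at level 41, u name, v name, t at level 200, E at level 41,
   format "'[' '\tsum_' ( u ,  v  <-  t ) '/  '  E ']'").

Section TensorMaps.
Variable k : fieldType.

Definition tmap (U V U' V' : lmodType k) (f : U -> U') (g : V -> V')
    (t : tensor U V) : tensor U' V' :=
  \tsum_(u, v <- t) (f u \ox g v).

Definition tswap (U V : lmodType k) (t : tensor U V) : tensor V U :=
  \tsum_(u, v <- t) (v \ox u).

Definition tassoc (U V W : lmodType k) (t : tensor (tensor U V) W) :
    tensor U (tensor V W) :=
  \tsum_(t', w <- t) \tsum_(u, v <- t') (u \ox (v \ox w)).

Definition tassoc' (U V W : lmodType k) (t : tensor U (tensor V W)) :
    tensor (tensor U V) W :=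
  \tsum_(u, t' <- t) \tsum_(v, w <- t') ((u \ox v) \ox w).

Definition tinterchange (A B C D : lmodType k)
    (t : tensor (tensor A B) (tensor C D)) : tensor (tensor A C) (tensor B D) :=
  \tsum_(r, r' <- t) \tsum_(a, b <- r) \tsum_(c, d <- r')
    ((a \ox c) \ox (b \ox d)).

End TensorMaps.

Section Coalgebra.
Variable k : fieldType.

Record coalgStr (C : lmodType k) := CoalgStr {
  cdelta : C -> tensor C C;
  ceps : C -> k }.

Record is_coalg (C : lmodType k) (c : coalgStr C) : Prop := IsCoalg {
  cdelta_linear : linear (cdelta c);
  ceps_linear : scalar (ceps c);
  cdeltaA : forall x, tassoc (tmap (cdelta c) id (cdelta c x))
                      = tmap id (cdelta c) (cdelta c x);
  ceps_l : forall x, \tsum_(x1, x2 <- cdelta c x) (ceps c x1 *: x2) = x;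
  ceps_r : forall x, \tsum_(x1, x2 <- cdelta c x) (ceps c x2 *: x1) = x }.

Definition cop (C : lmodType k) (c : coalgStr C) : coalgStr C :=
  CoalgStr (fun x => tswap (cdelta c x)) (ceps c).

Definition tens_coalg (C D : lmodType k) (c : coalgStr C) (d : coalgStr D) :
    coalgStr (tensor C D) :=
  CoalgStr (fun t => tinterchange (tmap (cdelta c) (cdelta d) t))
           (fun t => \tsum_(x, y <- t) (ceps c x * ceps d y)).

Record coalg_mor (C D : lmodType k) (c : coalgStr C) (d : coalgStr D)
    (f : C -> D) : Prop := CoalgMor {
  coalg_mor_linear : linear f;
  coalg_mor_delta : forall x, cdelta d (f x) = tmap f f (cdelta c x);
  coalg_mor_eps : forall x, ceps d (f x) = ceps c x }.

End Coalgebra.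

Record is_hopf (k : fieldType) (A : algType k) (c : coalgStr A) (S : A -> A)
    : Prop := IsHopf {
  hopf_coalg : is_coalg c;
  hopf_deltaM : forall x y, cdelta c (x * y) =
    \tsum_(x1, x2 <- cdelta c x) \tsum_(y1, y2 <- cdelta c y)
      ((x1 * y1) \ox (x2 * y2));
  hopf_delta1 : cdelta c 1 = 1 \ox 1;
  hopf_epsM : forall x y, ceps c (x * y) = ceps c x * ceps c y;
  hopf_eps1 : ceps c 1 = 1;
  hopf_S_linear : linear S;
  hopf_Sl : forall x, \tsum_(x1, x2 <- cdelta c x) (S x1 * x2) = ceps c x *: 1;
  hopf_Sr : forall x, \tsum_(x1, x2 <- cdelta c x) (x1 * S x2) = ceps c x *: 1 }.

(* [algType k] requires 1 != 0, which over a field already follows from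
   eps 1 = 1.  The antipode is not assumed to be bijective. *)
Record hopfAlg (k : fieldType) := HopfAlg {
  hopf_sort :> algType k;
  hopf_c : coalgStr hopf_sort;
  hopf_S : hopf_sort -> hopf_sort;
  hopfP : is_hopf hopf_c hopf_S }.

Arguments hopf_c {k} h.
Arguments hopf_S {k} h.

(* The Sweedler sum h_(1), h_(2) is written  \tsum_(h1, h2 <- Delta h);
   h_(1), h_(2), h_(3) is obtained by splitting h_(2) again. *)
Definition Delta (k : fieldType) (H : hopfAlg k) (h : H) : tensor H H :=
  cdelta (hopf_c H) h.
Definition eps (k : fieldType) (H : hopfAlg k) (h : H) : k := ceps (hopf_c H) h.

Arguments Delta {k H}.
Arguments eps {k H}.

Record hopf_mor (k : fieldType) (H K : hopfAlg k) (f : H -> K) : Prop :=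
    HopfMor {
  hopf_mor_coalg : coalg_mor (hopf_c H) (hopf_c K) f;
  hopf_mor1 : f 1 = 1;
  hopf_morM : forall x y, f (x * y) = f x * f y;
  hopf_morS : forall x, f (hopf_S H x) = hopf_S K (f x) }.

Section BraidingOperators.
Variables (k : fieldType) (H : hopfAlg k).

Definition mu (t : tensor H H) : H := \tsum_(x, y <- t) (x * y).

Section Legs.
Variable s : tensor H H -> tensor H H.

(* s (x) H and H (x) s, both acting on (H (x) H) (x) H *)
Definition leg12 : tensor (tensor H H) H -> tensor (tensor H H) H := tmap s id.
Definition leg23 (t : tensor (tensor H H) H) : tensor (tensor H H) H :=
  tassoc' (tmap id s (tassoc t)).
End Legs.

Record is_braiding (s : tensor H H -> tensor H H) : Prop := IsBraiding {
  braiding_coalg : coalg_mor (tens_coalg (hopf_c H) (hopf_c H))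
                             (tens_coalg (hopf_c H) (hopf_c H)) s;
  braiding_YB : forall t, leg12 s (leg23 s (leg12 s t)) =
                          leg23 s (leg12 s (leg23 s t));
  braiding_mul : forall t, s (tmap mu id t) =
                           tmap id mu (tassoc (leg12 s (leg23 s t)));
  braiding_mur : forall t, s (tmap id mu (tassoc t)) =
                           tmap mu id (leg23 s (leg12 s t));
  braiding_1l : forall x, s (1 \ox x) = x \ox 1;
  braiding_1r : forall x, s (x \ox 1) = 1 \ox x;
  braiding_comm : forall t, mu t = mu (s t) }.

End BraidingOperators.

Record braidOp (k : fieldType) := BraidOp {
  bo_hopf :> hopfAlg k;
  bo_s : tensor bo_hopf bo_hopf -> tensor bo_hopf bo_hopf;
  bo_ax : is_braiding bo_s }.

Definition braidOp_mor (k : fieldType) (B C : braidOp k) (f : B -> C) : Prop :=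
  hopf_mor f /\ (forall t, tmap f f (bo_s t) = bo_s (tmap f f t)).

(* [dot x y] is x . y and [col x y] is x : y; linear maps H (x) H -> H are
   given as bilinear maps. *)
Record is_hsb (k : fieldType) (H : hopfAlg k) (dot col : H -> H -> H) : Prop :=
    IsHSB {
  hsb_dot_bilinear : bilinear dot;
  hsb_col_bilinear : bilinear col;
  hsb_eps_dot : forall x y, eps (dot x y) = eps x * eps y;
  hsb_eps_col : forall x y, eps (col x y) = eps x * eps y;
  hsb_coalg :
    coalg_mor (tens_coalg (hopf_c H) (cop (hopf_c H)))
              (tens_coalg (cop (hopf_c H)) (hopf_c H))
      (fun t => \tsum_(x, y <- t)
         \tsum_(x1, x2 <- Delta x) \tsum_(y1, y2 <- Delta y)
           (col y1 x2 \ox dot x1 y2));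
  hsb_inv : bijective (fun t : tensor H H =>
    \tsum_(x, y <- t) \tsum_(y1, y2 <- Delta y) (dot x y1 \ox y2));
  hsb_dd : forall x y z,
    \tsum_(y1, y2 <- Delta y) dot (dot x y1) (col z y2) =
    \tsum_(z1, z2 <- Delta z) dot (dot x z2) (dot y z1);
  hsb_dc : forall x y z,
    \tsum_(y1, y2 <- Delta y) col (dot x y1) (dot z y2) =
    \tsum_(z1, z2 <- Delta z) dot (col x z2) (col y z1);
  hsb_cc : forall x y z,
    \tsum_(y1, y2 <- Delta y) col (col x y1) (col z y2) =
    \tsum_(z1, z2 <- Delta z) col (col x z2) (dot y z1);
  (* right H^op-modules: the product of y and z in H^op is z * y *)
  hsb_dot1 : forall x, dot x 1 = x;
  hsb_dotM : forall x y z, dot (dot x y) z = dot x (z * y);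
  hsb_col1 : forall x, col x 1 = x;
  hsb_colM : forall x y z, col (col x y) z = col x (z * y);
  hsb_Mdot : forall h m l, dot (h * m) l =
    \tsum_(m1, m2 <- Delta m) \tsum_(l1, l2 <- Delta l)
      (dot h (col l1 m2) * dot m1 l2);
  hsb_Mcol : forall h m l, col (h * m) l =
    \tsum_(m1, m2 <- Delta m) \tsum_(l1, l2 <- Delta l)
      (col h (dot l1 m2) * col m1 l2);
  hsb_comm : forall h m,
    \tsum_(h1, h2 <- Delta h) (col m h2 * h1) =
    \tsum_(m1, m2 <- Delta m) (dot h m1 * m2) }.

Record hsb (k : fieldType) := HSB {
  hsb_hopf :> hopfAlg k;
  hsb_dot : hsb_hopf -> hsb_hopf -> hsb_hopf;
  hsb_col : hsb_hopf -> hsb_hopf -> hsb_hopf;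
  hsb_ax : is_hsb hsb_dot hsb_col }.

Definition hsb_mor (k : fieldType) (B C : hsb k) (f : B -> C) : Prop :=
  [/\ hopf_mor f,
      forall x y, f (hsb_dot x y) = hsb_dot (f x) (f y) &
      forall x y, f (hsb_col x y) = hsb_col (f x) (f y)].

Section YetterDrinfeld.
Variables (k : fieldType) (H : hopfAlg k).

Record ydStr (X : lmodType k) := YDStr {
  yd_act : H -> X -> X;
  yd_coact : X -> tensor H X }.

Record is_yd (X : lmodType k) (D : ydStr X) : Prop := IsYD {
  yd_act_bilinear : bilinear (yd_act D);
  yd_act1 : forall x, yd_act D 1 x = x;
  yd_actM : forall h l x, yd_act D (h * l) x = yd_act D h (yd_act D l x);
  yd_coact_linear : linear (yd_coact D);
  yd_coactA : forall x, tassoc (tmap Delta id (yd_coact D x)) =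
                        tmap id (yd_coact D) (yd_coact D x);
  yd_coact_eps : forall x, \tsum_(h, x0 <- yd_coact D x) (eps h *: x0) = x;
  yd_compat : forall h x, yd_coact D (yd_act D h x) =
    \tsum_(h1, h' <- Delta h) \tsum_(h2, h3 <- Delta h')
    \tsum_(g, x0 <- yd_coact D x)
      ((h1 * g * hopf_S H h3) \ox yd_act D h2 x0) }.

Record yd_mor (X Y : lmodType k) (D : ydStr X) (E : ydStr Y) (f : X -> Y)
    : Prop := YDMor {
  yd_mor_linear : linear f;
  yd_mor_act : forall h x, f (yd_act D h x) = yd_act E h (f x);
  yd_mor_coact : forall x, yd_coact E (f x) = tmap id f (yd_coact D x) }.

Definition yd_unit : ydStr k^o :=
  YDStr (fun h (a : k^o) => eps h *: a) (fun a : k^o => 1 \ox a).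

Definition yd_tensor (X Y : lmodType k) (D : ydStr X) (E : ydStr Y) :
    ydStr (tensor X Y) :=
  YDStr
    (fun h t => \tsum_(h1, h2 <- Delta h) tmap (yd_act D h1) (yd_act E h2) t)
    (fun t => \tsum_(x, y <- t)
       \tsum_(g, x0 <- yd_coact D x) \tsum_(l, y0 <- yd_coact E y)
         ((g * l) \ox (x0 \ox y0))).

Definition yd_braid (X Y : lmodType k) (D : ydStr X) (E : ydStr Y)
    (t : tensor X Y) : tensor Y X :=
  \tsum_(x, y <- t) \tsum_(g, x0 <- yd_coact D x) (yd_act E g y \ox x0).

(* Hopf algebra in the braided tensor category of Yetter-Drinfeld modules:
   all structure maps, antipode included, are morphisms of the category, and
   the comultiplication is multiplicative with respect to the product of
   X (x) X twisted by the braiding. *)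
Record is_yd_hopf (X : lmodType k) (D : ydStr X)
    (m : X -> X -> X) (u : X) (c : coalgStr X) (T : X -> X) : Prop :=
    IsYDHopf {
  ydh_yd : is_yd D;
  ydh_m_bilinear : bilinear m;
  ydh_m_mor : yd_mor (yd_tensor D D) D (fun t => \tsum_(x, y <- t) m x y);
  ydh_u_mor : yd_mor yd_unit D (fun a : k^o => a *: u);
  ydh_mA : associative m;
  ydh_m1l : left_id u m;
  ydh_m1r : right_id u m;
  ydh_coalg : is_coalg c;
  ydh_delta_mor : yd_mor D (yd_tensor D D) (cdelta c);
  ydh_eps_mor : yd_mor D yd_unit (ceps c : X -> k^o);
  ydh_deltaM : forall x y, cdelta c (m x y) =
    \tsum_(x1, x2 <- cdelta c x) \tsum_(y1, y2 <- cdelta c y)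
    \tsum_(y1', x2' <- yd_braid D D (x2 \ox y1))
      (m x1 y1' \ox m x2' y2);
  ydh_delta1 : cdelta c u = u \ox u;
  ydh_epsM : forall x y, ceps c (m x y) = ceps c x * ceps c y;
  ydh_eps1 : ceps c u = 1;
  ydh_T_mor : yd_mor D D T;
  ydh_Tl : forall x, \tsum_(x1, x2 <- cdelta c x) m (T x1) x2 = ceps c x *: u;
  ydh_Tr : forall x, \tsum_(x1, x2 <- cdelta c x) m x1 (T x2) = ceps c x *: u }.

End YetterDrinfeld.

Section YDBrace.
Variables (k : fieldType) (H : hopfAlg k) (m : H -> H -> H) (T : H -> H).

Definition ydb_lact (h l : H) : H :=
  \tsum_(h1, h2 <- Delta h) m (T h1) (h2 * l).

Definition ydb_coact (h : H) : tensor H H :=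
  \tsum_(h1, h' <- Delta h) \tsum_(h2, h3 <- Delta h')
    ((h1 * hopf_S H h3) \ox h2).

Definition ydb_ract (h l : H) : H :=
  \tsum_(h1, h2 <- Delta h) \tsum_(l1, l2 <- Delta l)
    (hopf_S H (ydb_lact h1 l1) * h2 * l2).

Record is_ydb : Prop := IsYDB {
  ydb_m_bilinear : bilinear m;
  ydb_mA : associative m;
  ydb_T_linear : linear T;
  ydb_hopf : is_yd_hopf (YDStr ydb_lact ydb_coact) m 1 (hopf_c H) T;
  ydb_flip : forall h l,
    \tsum_(h1, h2 <- Delta h) \tsum_(l1, l2 <- Delta l)
      (ydb_lact h1 l1 \ox ydb_ract h2 l2) =
    \tsum_(h1, h2 <- Delta h) \tsum_(l1, l2 <- Delta l)
      (ydb_lact h2 l2 \ox ydb_ract h1 l1);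
  ydb_distr : forall h n l, h * m n l =
    \tsum_(h1, h' <- Delta h) \tsum_(h2, h3 <- Delta h')
      m (m (h1 * n) (T h2)) (h3 * l) }.

End YDBrace.

Record ydb (k : fieldType) := YDB {
  ydb_alg :> hopfAlg k;
  ydb_times : ydb_alg -> ydb_alg -> ydb_alg;
  ydb_T : ydb_alg -> ydb_alg;
  ydb_ax : is_ydb ydb_times ydb_T }.

Definition ydb_mor (k : fieldType) (B C : ydb k) (f : B -> C) : Prop :=
  [/\ hopf_mor f,
      forall x y, f (ydb_times x y) = ydb_times (f x) (f y) &
      forall x, ydb_T (f x) = f (ydb_T x)].

Record category := Category {
  obj : Type;
  hom : obj -> obj -> Type;
  idm : forall X, hom X X;
  cmp : forall X Y Z, hom Y Z -> hom X Y -> hom X Z;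
  cmp1m : forall X Y (f : hom X Y), cmp (idm Y) f = f;
  cmpm1 : forall X Y (f : hom X Y), cmp f (idm X) = f;
  cmpA : forall X Y Z W (h : hom Z W) (g : hom Y Z) (f : hom X Y),
    cmp h (cmp g f) = cmp (cmp h g) f }.

Record functor (C D : category) := Functor {
  fobj : obj C -> obj D;
  fmap : forall X Y, hom X Y -> hom (fobj X) (fobj Y);
  fmap_id : forall X, fmap (idm X) = idm (fobj X);
  fmap_cmp : forall X Y Z (g : hom Y Z) (f : hom X Y),
    fmap (cmp g f) = cmp (fmap g) (fmap f) }.

Definition idF (C : category) : functor C C :=
  @Functor C C id (fun _ _ f => f) (fun _ => erefl) (fun _ _ _ _ _ => erefl).

Section CompFunctor.
Variables (C D E : category) (G : functor D E) (F : functor C D).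

Lemma compF_id X : fmap G (fmap F (idm X)) = idm (fobj G (fobj F X)).
Proof. by rewrite !fmap_id. Qed.

Lemma compF_cmp X Y Z (g : hom Y Z) (f : hom X Y) :
  fmap G (fmap F (cmp g f)) = cmp (fmap G (fmap F g)) (fmap G (fmap F f)).
Proof. by rewrite !fmap_cmp. Qed.

Definition compF : functor C E :=
  @Functor C E (fun X => fobj G (fobj F X)) (fun X Y f => fmap G (fmap F f))
    compF_id compF_cmp.
End CompFunctor.

(* Isomorphism, not mere equivalence: equality of functors is strict. *)
Definition isomorphic_cat (C D : category) : Prop :=
  exists (F : functor C D) (G : functor D C),
    compF G F = idF C /\ compF F G = idF D.

Section ConcreteCategory.
Variables (O : Type) (car : O -> Type).
Variable mor : forall X Y : O, (car X -> car Y) -> Prop.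
Hypothesis mor_id : forall X, mor (fun x : car X => x).
Hypothesis mor_comp : forall X Y Z (g : car Y -> car Z) (f : car X -> car Y),
  mor g -> mor f -> mor (fun x => g (f x)).

Definition chom (X Y : O) : Type := {f : car X -> car Y | mor f}.

Definition ccmp (X Y Z : O) (g : chom Y Z) (f : chom X Y) : chom X Z :=
  exist _ (fun x => sval g (sval f x)) (mor_comp (svalP g) (svalP f)).

Lemma chom_eq (X Y : O) (f g : chom X Y) : sval f = sval g -> f = g.
Proof. by case: f g => f fp [g gp] /= e; apply: eq_exist. Qed.

Definition concrete_cat : category.
Proof.
refine (@Category O chom (fun X => exist _ _ (@mor_id X)) ccmp _ _ _);
  by move=> *; apply: chom_eq.
Defined.
End ConcreteCategory.

Section Closure.
Variable k : fieldType.

Lemma tmap_id (U V : lmodType k) (t : tensor U V) :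
  tmap (fun x => x) (fun x => x) t = t.
Proof. by rewrite [RHS]tensor_sum_pure. Qed.

Lemma linear0' (U V : lmodType k) (f : U -> V) : linear f -> f 0 = 0.
Proof.
by move=> fl; have := fl (-1) 0 0; rewrite scaler0 addr0 scaleN1r addNr.
Qed.

Lemma pure_comp_bilinear (U V U' V' : lmodType k) (f : U -> U') (g : V -> V') :
  linear f -> linear g -> bilinear (fun u v => f u \ox g v).
Proof.
move=> fl gl; have [pl pr] := @pure_bilinear k U' V'.
split=> [v a u u' | u a v v'] /=; first by rewrite fl; exact: pl.
rewrite gl; exact: pr.
Qed.

Lemma tmap_linear (U V U' V' : lmodType k) (f : U -> U') (g : V -> V') :
  linear f -> linear g -> linear (tmap f g).
Proof. by move=> fl gl; exact/tsum_linear/pure_comp_bilinear. Qed.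

Lemma tmap_pure (U V U' V' : lmodType k) (f : U -> U') (g : V -> V') u v :
  linear f -> linear g -> tmap f g (u \ox v) = f u \ox g v.
Proof. by move=> fl gl; exact/tsum_pure/pure_comp_bilinear. Qed.

Lemma linear_sum' (U V : lmodType k) (f : U -> V) I (s : seq I) (F : I -> U) :
  linear f -> f (\sum_(i <- s) F i) = \sum_(i <- s) f (F i).
Proof.
move=> fl; elim: s => [|i s IH]; first by rewrite !big_nil linear0'.
by rewrite !big_cons -IH -[F i]scale1r fl !scale1r.
Qed.

Lemma tmap_comp (U V U' V' U'' V'' : lmodType k)
    (f : U -> U') (g : V -> V') (f' : U' -> U'') (g' : V' -> V'') t :
  linear f -> linear g -> linear f' -> linear g' ->
  tmap f' g' (tmap f g t) = tmap (fun x => f' (f x)) (fun x => g' (g x)) t.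
Proof.
move=> fl gl fl' gl'; rewrite [tmap f g t]/tmap /tsum.
rewrite (linear_sum' _ _ (tmap_linear fl' gl')); apply: eq_bigr => p _.
exact: tmap_pure.
Qed.

Lemma hopf_mor_linear (H K : hopfAlg k) (f : H -> K) : hopf_mor f -> linear f.
Proof. by case=> -[]. Qed.

Lemma hopf_mor_id (H : hopfAlg k) : @hopf_mor k H H (fun x => x).
Proof. by split=> //; split=> // x; rewrite tmap_id. Qed.

Lemma hopf_mor_comp (H K L : hopfAlg k) (g : K -> L) (f : H -> K) :
  hopf_mor g -> hopf_mor f -> hopf_mor (fun x => g (f x)).
Proof.
case=> -[gl gd ge] g1 gM gS [[fl fd fe] f1 fM fS].
have gfl : linear (fun x => g (f x)) by move=> a x y; rewrite fl gl.
split=> [|| x y | x]; rewrite ?f1 ?fM ?gM ?fS ?gS //.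
by split=> // x; rewrite ?gd ?fd ?ge ?fe // tmap_comp.
Qed.

Lemma braidOp_mor_id (B : braidOp k) : @braidOp_mor k B B (fun x => x).
Proof. by split=> [|t]; [exact: hopf_mor_id | rewrite !tmap_id]. Qed.

Lemma braidOp_mor_comp (A B C : braidOp k) (g : B -> C) (f : A -> B) :
  braidOp_mor g -> braidOp_mor f -> braidOp_mor (fun x => g (f x)).
Proof.
case=> gh gs [fh fs]; split=> [|t]; first exact: hopf_mor_comp.
have [gl fl] := (hopf_mor_linear gh, hopf_mor_linear fh).
by rewrite -!(tmap_comp _ fl fl gl gl) fs gs.
Qed.

Lemma hsb_mor_id (B : hsb k) : @hsb_mor k B B (fun x => x).
Proof. by split=> //; exact: hopf_mor_id. Qed.

Lemma hsb_mor_comp (A B C : hsb k) (g : B -> C) (f : A -> B) :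
  hsb_mor g -> hsb_mor f -> hsb_mor (fun x => g (f x)).
Proof.
case=> gh gd gc [fh fd fc]; split=> [|x y|x y]; first exact: hopf_mor_comp.
  by rewrite fd gd.
by rewrite fc gc.
Qed.

Lemma ydb_mor_id (B : ydb k) : @ydb_mor k B B (fun x => x).
Proof. by split=> //; exact: hopf_mor_id. Qed.

Lemma ydb_mor_comp (A B C : ydb k) (g : B -> C) (f : A -> B) :
  ydb_mor g -> ydb_mor f -> ydb_mor (fun x => g (f x)).
Proof.
case=> gh gm gT [fh fm fT]; split=> [|x y|x]; first exact: hopf_mor_comp.
  by rewrite fm gm.
by rewrite gT fT.
Qed.

End Closure.

Definition braidOpCat (k : fieldType) : category :=
  concrete_cat (@braidOp_mor_id k) (@braidOp_mor_comp k).
Definition hsbCat (k : fieldType) : category :=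
  concrete_cat (@hsb_mor_id k) (@hsb_mor_comp k).
Definition ydbCat (k : fieldType) : category :=
  concrete_cat (@ydb_mor_id k) (@ydb_mor_comp k).

(* Main.v *)
Require Import Defs.
From mathcomp Require Import all_boot all_order all_algebra.
From mathcomp Require Import sesquilinear.
From mathcomp Require Import boolp.

(** The three structures are three descriptions of one and the same object: a Hopf algebra H
    with a left action |> and a right action <| of H on its own coalgebra, which form a
    matched pair, x |> (y z) = (x1 |> y1) ((x2 <| y2) |> z) and symmetrically, such that
    x1 |> y1 (x) x2 <| y2 is symmetric in the components ([mp_flip]) and that
    x y = (x1 |> y1) (x2 <| y2). Each category is shown to be isomorphic to that of these
    matched pairs ([is_mp]). All functors keep the Hopf algebra and the maps underlying
    morphisms, so strict equality of functors reduces to equations between operations.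

    Braiding operators. A coalgebra map s into H (x) H is the convolution of its components
    (id (x) eps) s and (eps (x) id) s, which gives the two actions; the axioms of s other
    than the Yang-Baxter equation are then, component by component, those of a matched
    pair. Conversely the Yang-Baxter equation follows: both sides have the same outer
    components, and multiply to x y z, so that their middle components agree after
    cancelling the outer ones by the antipode ([YB_middle]).

    Hopf skew-braces. From a matched pair, x . y = x <| S y and
    y : x = (x <| S y1) |> y2. The key identity is S (l : m) = m |> S l ([antipode_col]),
    which turns the matched pair axioms into those of a skew-brace; the mixed axiom on
    x . y1 : (z . y2) is [YB_middle] again. Conversely, inverting x (x) y |-> x . y1 (x) y2
    gives <|, then x |> y = y2 : (x <| y1), and identities are checked after the change of
    variables x, y |-> x . y1, y2 ([shear_ext]).

    Yetter-Drinfeld braces. From a matched pair, x * y = x1 (S x2 |> y) and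
    T x = x1 |> S x2, so that x y = x1 * (x2 |> y); braided commutativity makes |> distribute
    over * ([lact_timesE]), and the Yetter-Drinfeld condition is the symmetry [mp_flip] in
    disguise ([coact_actE]). Conversely |> is the given action, and <| is forced by
    (x1 |> y1) (x2 <| y2) = x y.

    The computations in Sweedler notation are done by reflection. A Sweedler expression in
    which every component is used once is determined by the numbers of components of its
    variables and by monomials in these components ([normal_formP]); coassociativity, counit
    axioms, linearity and compatibility of operations with the coproduct are thus decided by
    comparing normal forms ([sweedler_eq]). What remains in the proofs are the steps that
    use an axiom of another kind, the antipode axioms above all, written as equations between
    functions so that they can be rewritten below binders. *)

Set Implicit Arguments.
Unset Strict Implicit.
Unset Printing Implicit Defensive.

Import GRing.Theory.
Local Open Scope ring_scope.

Local Notation linear f := (GRing.linear_for *:%R f).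
Local Notation scalar f := (GRing.linear_for *%R f).
Local Notation bilinear f := (bilinear_for *:%R *:%R f).

(** * Sums over tensors and Sweedler sums *)

Section TensorSums.
Variable k : fieldType.
Implicit Types U V W : lmodType k.

Lemma tsum_eta U V (t : tensor U V) : t = \tsum_(a, b <- t) (a \ox b).
Proof. exact: tensor_sum_pure. Qed.

Lemma eq_tsum U V (W : nmodType) (t : tensor U V) (f g : U -> V -> W) :
  (forall a b, f a b = g a b) -> tsum t f = tsum t g.
Proof. by move=> e; apply: eq_bigr. Qed.

Lemma exchange_tsum U V U' V' (W : nmodType) (t : tensor U V)
    (t' : tensor U' V') (f : U -> V -> U' -> V' -> W) :
  \tsum_(a, b <- t) \tsum_(c, d <- t') f a b c d =
  \tsum_(c, d <- t') \tsum_(a, b <- t) f a b c d.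
Proof. exact: exchange_big. Qed.

Lemma linear_tsum U V W W' (F : W -> W') (t : tensor U V) (f : U -> V -> W) :
  linear F -> F (tsum t f) = \tsum_(a, b <- t) F (f a b).
Proof. exact: linear_sum'. Qed.

Lemma tsum_linearP U V W W' (t : tensor U V) (f : U -> V -> W -> W') :
  (forall a b, linear (f a b)) -> linear (fun x => \tsum_(a, b <- t) f a b x).
Proof.
move=> fl c x y; rewrite /tsum scaler_sumr -big_split; apply: eq_bigr => p _.
exact: fl.
Qed.

Lemma linear_comp U V W (f : V -> W) (g : U -> V) :
  linear f -> linear g -> linear (fun x => f (g x)).
Proof. by move=> fl gl c x y; rewrite gl fl. Qed.

Lemma linearZ' U V (f : U -> V) : linear f ->
  forall a x, f (a *: x) = a *: f x.
Proof.
by move=> fl a x; have := fl a x 0; rewrite addr0 (linear0' fl) addr0.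
Qed.

Lemma linear_id' U : linear (fun x : U => x). Proof. by []. Qed.

Lemma linear_scale' U V (c : k) (f : U -> V) :
  linear f -> linear (fun x => c *: f x).
Proof.
by move=> fl a x y; rewrite fl scalerDr !scalerA mulrC.
Qed.

Lemma linear_scaler U V (e : U -> k) (v : V) :
  scalar e -> linear (fun x => e x *: v).
Proof. by move=> el a x y; rewrite el scalerDl scalerA. Qed.

Lemma tsum_sum_bilinear U V U' V' W (t : tensor U V)
    (g : U -> V -> tensor U' V') (f : U' -> V' -> W) : bilinear f ->
  tsum (tsum t g) f = \tsum_(a, b <- t) tsum (g a b) f.
Proof. by move=> fb; apply: (linear_tsum (F := fun t => tsum t f)); exact: tsum_linear. Qed.

Lemma tensor_ext U V W (F G : tensor U V -> W) : linear F -> linear G ->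
  (forall u v, F (u \ox v) = G (u \ox v)) -> forall t, F t = G t.
Proof.
move=> Fl Gl e t; rewrite (tensor_sum_pure t) !linear_sum' //.
by apply: eq_bigr => p _.
Qed.

Lemma tassoc_bilinear U V W :
  bilinear (fun (t' : tensor U V) (w : W) => \tsum_(u, v <- t') (u \ox (v \ox w))).
Proof.
have [ul ur] := @pure_bilinear k V W; have [vl vr] := @pure_bilinear k U (tensor V W).
split=> [w|t'].
  apply: tsum_linear; split=> [v|u]; first exact: vl.
  exact: (linear_comp (vr _) (ul _)).
by apply: tsum_linearP => u v; exact: (linear_comp (vr _) (ur _)).
Qed.

Lemma tassoc'_bilinear U V W :
  bilinear (fun (u : U) (t' : tensor V W) => \tsum_(v, w <- t') ((u \ox v) \ox w)).
Proof.
have [ul ur] := @pure_bilinear k U V; have [vl vr] := @pure_bilinear k (tensor U V) W.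
split=> [t'|u].
  by apply: tsum_linearP => v w; exact: (linear_comp (vl _) (ul _)).
apply: tsum_linear; split=> [w|v]; last exact: vr.
exact: (linear_comp (vl _) (ur _)).
Qed.

Lemma tassoc_linear U V W : linear (@tassoc k U V W).
Proof. exact: (tsum_linear (@tassoc_bilinear U V W)). Qed.

Lemma tassoc'_linear U V W : linear (@tassoc' k U V W).
Proof. exact: (tsum_linear (@tassoc'_bilinear U V W)). Qed.

Lemma tassoc_pure U V W (u : U) (v : V) (w : W) :
  tassoc ((u \ox v) \ox w) = u \ox (v \ox w).
Proof.
rewrite /tassoc (tsum_pure _ _ (@tassoc_bilinear U V W)) tsum_pure //.
have [ul ur] := @pure_bilinear k V W; have [vl vr] := @pure_bilinear k U (tensor V W).
by split=> [?|?]; [exact: vl | exact: (linear_comp (vr _) (ul _))].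
Qed.

Lemma tassoc'_pure U V W (u : U) (t : tensor V W) :
  tassoc' (u \ox t) = \tsum_(v, w <- t) ((u \ox v) \ox w).
Proof. exact: (tsum_pure _ _ (@tassoc'_bilinear U V W)). Qed.

Lemma tensor3_ext U V W (X : lmodType k) (F G : tensor (tensor U V) W -> X) :
  linear F -> linear G ->
  (forall u v w, F ((u \ox v) \ox w) = G ((u \ox v) \ox w)) -> forall t, F t = G t.
Proof.
move=> Fl Gl e; apply: tensor_ext => // t w.
have [ql qr] := @pure_bilinear k (tensor U V) W.
by apply: (tensor_ext (linear_comp Fl (ql w)) (linear_comp Gl (ql w))).
Qed.

Lemma counitL (C : lmodType k) (c : coalgStr C) W (f : C -> W) x :
  is_coalg c -> linear f -> \tsum_(a, b <- cdelta c x) (ceps c a *: f b) = f x.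
Proof.
move=> h fl; rewrite -[in RHS](ceps_l h x) (linear_tsum _ _ fl).
by apply: eq_tsum => a b; rewrite linearZ'.
Qed.

Lemma counitR (C : lmodType k) (c : coalgStr C) W (f : C -> W) x :
  is_coalg c -> linear f -> \tsum_(a, b <- cdelta c x) (ceps c b *: f a) = f x.
Proof.
move=> h fl; rewrite -[in RHS](ceps_r h x) (linear_tsum _ _ fl).
by apply: eq_tsum => a b; rewrite linearZ'.
Qed.

End TensorSums.

Section HopfSums.
Variables (k : fieldType) (H : hopfAlg k).
Implicit Types W : lmodType k.

Lemma Delta_linear : linear (@Delta k H).
Proof. exact: cdelta_linear (hopf_coalg (hopfP H)). Qed.

Lemma eps_scalar : scalar (@eps k H).
Proof. exact: ceps_linear (hopf_coalg (hopfP H)). Qed.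

Lemma tsum_Delta_linear W (f : H -> H -> W) :
  bilinear f -> linear (fun x => tsum (Delta x) f).
Proof. by move=> fb; exact: (linear_comp (tsum_linear fb) Delta_linear). Qed.

(** Trilinearity of the summand is what lets coassociativity, an equation between
    elements of H (x) (H (x) H), be pushed through the sum. *)
Lemma Delta_coassoc W (g : H -> H -> H -> W) (x : H) :
  (forall b c, linear (fun a => g a b c)) ->
  (forall a c, linear (fun b => g a b c)) ->
  (forall a b, linear (g a b)) ->
  \tsum_(a, c <- Delta x) \tsum_(a1, b <- Delta a) g a1 b c =
  \tsum_(a, b' <- Delta x) \tsum_(b, c <- Delta b') g a b c.
Proof.
move=> g1 g2 g3.
have gb a : bilinear (g a) by split=> [c|b]; [exact: g2 | exact: g3].
pose G (t : tensor H (tensor H H)) := \tsum_(a, t' <- t) tsum t' (g a).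
have Gb : bilinear (fun a t' => tsum t' (g a)).
  split=> [t'|a]; last exact: tsum_linear.
  by apply: tsum_linearP => b c; exact: g1.
have Gl : linear G by exact: tsum_linear.
have dl := Delta_linear.
have := congr1 G (cdeltaA (hopf_coalg (hopfP H)) x).
rewrite -/Delta /tmap /tassoc.
rewrite tsum_sum_bilinear; last exact: tassoc_bilinear.
rewrite [LHS](linear_tsum _ _ Gl) [RHS](linear_tsum _ _ Gl) => e.
transitivity (\tsum_(a, b <- Delta x) G (a \ox Delta b)); last first.
  by apply: eq_tsum => a b; rewrite /G tsum_pure.
rewrite -[RHS]e; apply: eq_tsum => a c; rewrite tsum_pure; last exact: tassoc_bilinear.
rewrite (linear_tsum _ _ Gl); apply: eq_tsum => a1 b.
by rewrite /G !tsum_pure.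
Qed.

Lemma counit_l W (f : H -> W) x : linear f ->
  \tsum_(a, b <- Delta x) (eps a *: f b) = f x.
Proof. exact/counitL/(hopf_coalg (hopfP H)). Qed.

Lemma counit_r W (f : H -> W) x : linear f ->
  \tsum_(a, b <- Delta x) (eps b *: f a) = f x.
Proof. exact/counitR/(hopf_coalg (hopfP H)). Qed.

Lemma scale1_inj (a b : k) : a *: (1 : H) = b *: 1 -> a = b.
Proof.
move/eqP; rewrite -subr_eq0 -scalerBl scaler_eq0 (negbTE (oner_neq0 H)) orbF subr_eq0.
by move/eqP.
Qed.

End HopfSums.

(** * Iterated Sweedler sums of multilinear functions *)

Section MultiSums.
Local Open Scope nat_scope.
Variables (k : fieldType) (H : hopfAlg k).
Implicit Types (W : lmodType k) (x a b : H) (s : seq H) (p n : nat).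

(** Functions of several arguments take them as a list, so that one definition
    covers every number [n] of Sweedler components. *)
Definition multilinear W n (f : seq H -> W) : Prop :=
  forall s1 s2, (size s1 + size s2).+1 = n -> linear (fun x => f (s1 ++ x :: s2)).

Lemma multilinear_head W n (f : seq H -> W) s :
  multilinear n.+1 f -> size s = n -> linear (fun x => f (x :: s)).
Proof. by move=> fl sn; apply: (fl [::]); rewrite add0n sn. Qed.

Lemma multilinear_cons W n (f : seq H -> W) x :
  multilinear n.+1 f -> multilinear n (fun s => f (x :: s)).
Proof. by move=> fl s1 s2 e; apply: (fl (x :: s1)); rewrite -e. Qed.

Lemma multilinear_cat W m n (f : seq H -> W) s : size s = m ->
  multilinear (m + n) f -> multilinear n (fun s' => f (s ++ s')).
Proof.
elim: s m f => [|x s IH] m f /= <-; first by rewrite add0n.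
by move=> fl; apply: (IH _ (fun s => f (x :: s))) => //; exact: multilinear_cons.
Qed.

(** [swsum n x f] is the sum of f [:: x_(1); ...; x_(n)]; for n = 0 it is the counit,
    which makes deletion of a component ([swsum_counit]) uniform in [n]. *)
Fixpoint swsum W n x (f : seq H -> W) : W :=
  if n is n'.+1 then \tsum_(a, b <- Delta x) swsum n' b (fun s => f (a :: s))
  else eps x *: f [::].

Lemma eq_swsum W n x (f g : seq H -> W) :
  (forall s, size s = n -> f s = g s) -> swsum n x f = swsum n x g.
Proof.
elim: n x f g => [|n IH] x f g e /=; first by rewrite e.
by apply: eq_tsum => a b; apply: IH => s sn; apply: e; rewrite /= sn.
Qed.

Lemma swsum_linear W W' n x (F : W -> W') (f : seq H -> W) :
  linear F -> F (swsum n x f) = swsum n x (fun s => F (f s)).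
Proof.
move=> Fl; elim: n x f => [|n IH] x f /=; first by rewrite linearZ'.
by rewrite (linear_tsum _ _ Fl); apply: eq_tsum => a b.
Qed.

Lemma swsum_linearP W W' n x (f : W -> seq H -> W') :
  (forall s, size s = n -> linear (fun w => f w s)) -> linear (fun w => swsum n x (f w)).
Proof.
elim: n x f => [|n IH] x f fl /=; first by apply: linear_scale'; exact: fl.
by apply: tsum_linearP => a b; apply: IH => s sn; apply: fl; rewrite /= sn.
Qed.

Lemma swsum_tsum W (U V : lmodType k) n x (t : tensor U V) (f : U -> V -> seq H -> W) :
  swsum n x (fun s => \tsum_(u, v <- t) f u v s) =
  \tsum_(u, v <- t) swsum n x (f u v).
Proof.
elim: n x f => [|n IH] x f /=.
  by rewrite (linear_tsum _ _ (linear_scale' _ (@linear_id' _ _))).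
rewrite exchange_tsum; apply: eq_tsum => a b.
exact: (IH b (fun u v s => f u v (a :: s))).
Qed.

Lemma swsum_multilinear W n (f : seq H -> W) :
  multilinear n f -> linear (fun x => swsum n x f).
Proof.
elim: n f => [|n IH] f fl /=.
  by apply: linear_scaler; exact: eps_scalar.
apply: tsum_Delta_linear; split=> [b|a].
  by apply: swsum_linearP => s sn; exact: multilinear_head fl sn.
exact/IH/multilinear_cons.
Qed.

Lemma swsum1 W (f : seq H -> W) x :
  multilinear 1 f -> swsum 1 x f = f [:: x].
Proof.
by move=> fl /=; apply: (counit_r (f := fun a => f [:: a])); exact: (multilinear_head fl).
Qed.

Definition split_at p a b s : seq H := take p s ++ a :: b :: drop p.+1 s.

Lemma split_at_catl p a b s s' : p < size s ->
  split_at p a b (s ++ s') = split_at p a b s ++ s'.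
Proof.
move=> ps; rewrite /split_at takel_cat ?(ltnW ps) // drop_cat -catA /=.
case: ltnP => // h; have -> : p.+1 = size s by apply/eqP; rewrite eqn_leq ps h.
by rewrite subnn drop0 drop_size.
Qed.

Lemma split_at_catr p a b s s' : size s <= p ->
  split_at p a b (s ++ s') = s ++ split_at (p - size s) a b s'.
Proof.
move=> ps; rewrite /split_at take_cat drop_cat ltnNge ps /= ltnNge leqW //=.
by rewrite -catA subSn.
Qed.

Lemma size_split_at p a b s : p < size s -> size (split_at p a b s) = (size s).+1.
Proof.
move=> ps; rewrite size_cat /= size_takel ?(ltnW ps) // size_drop.
by rewrite !addnS -addSn subnKC.
Qed.

(** Coassociativity: splitting any one of the n components of x yields the
    (n+1)-fold Sweedler sum. *)
Lemma swsum_split W n x p (f : seq H -> W) : p < n -> multilinear n.+1 f ->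
  swsum n x (fun s => \tsum_(a, b <- Delta (nth 0%R s p)) f (split_at p a b s)) =
  swsum n.+1 x f.
Proof.
elim: n x p f => // n IH x [|p] f pn fl.
  transitivity (\tsum_(a', c <- Delta x) \tsum_(a, b <- Delta a')
      swsum n c (fun s => f [:: a, b & s])).
    apply: eq_tsum => a' c.
    rewrite -(swsum_tsum _ _ _ (fun a b s => f [:: a, b & s])).
    by apply: eq_swsum => s sn; rewrite /split_at /= drop0.
  apply: Delta_coassoc => [b c|a c|a b].
  - by apply: swsum_linearP => s sn; apply: (multilinear_head fl); rewrite /= sn.
  - by apply: swsum_linearP => s sn; apply: (fl [:: a]); rewrite /= sn.
  - apply: swsum_multilinear.
    exact: (multilinear_cons b (multilinear_cons a fl)).
rewrite /=; apply: eq_tsum => a b.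
exact: (IH b p _ pn (multilinear_cons a fl)).
Qed.

Definition del_at p s : seq H := take p s ++ drop p.+1 s.

Lemma swsum_counit W n x p (f : seq H -> W) : p < n -> multilinear n.-1 f ->
  swsum n x (fun s => eps (nth 0%R s p) *: f (del_at p s)) = swsum n.-1 x f.
Proof.
elim: n x p f => // n IH x [|p] f pn fl /=.
  rewrite -[RHS](counit_l x (swsum_multilinear fl)).
  apply: eq_tsum => a b.
  rewrite (swsum_linear _ _ _ (linear_scale' (eps a) (@linear_id' _ _))).
  by apply: eq_swsum => s _; rewrite /del_at /= drop0.
case: n IH pn fl => // n IH pn fl; apply: eq_tsum => a b.
exact: (IH b p _ pn (multilinear_cons a fl)).
Qed.

(** A Sweedler sum over several elements: the components x_(1), ..., x_(n) of the
    first one, then those of the second one, and so on, in one list. The list [ns]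
    records the numbers of components, and is all that is left of the way in which
    the sum was written. *)
Fixpoint wsum W (ns : seq nat) (xs : seq H) (f : seq H -> W) : W :=
  match ns, xs with
  | n :: ns', x :: xs' =>
    swsum n x (fun s => wsum ns' xs' (fun s' => f (s ++ s')))
  | _, _ => f [::]
  end.

Lemma eq_wsum W ns xs (f g : seq H -> W) : size ns = size xs ->
  (forall s, size s = sumn ns -> f s = g s) -> wsum ns xs f = wsum ns xs g.
Proof.
elim: ns xs f g => [|n ns IH] [|x xs] f g //= => [_ -> //|[nx] e].
apply: eq_swsum => s sn; apply: IH => // s' sn'.
by apply: e; rewrite size_cat sn sn'.
Qed.

Lemma wsum_linear W W' ns xs (F : W -> W') (f : seq H -> W) :
  linear F -> F (wsum ns xs f) = wsum ns xs (fun s => F (f s)).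
Proof.
move=> Fl; elim: ns xs f => [|n ns IH] [|x xs] f //=.
by rewrite (swsum_linear _ _ _ Fl); apply: eq_swsum => s _.
Qed.

Lemma wsum_linearP W W' ns xs (f : W -> seq H -> W') : size ns = size xs ->
  (forall s, size s = sumn ns -> linear (fun w => f w s)) ->
  linear (fun w => wsum ns xs (f w)).
Proof.
elim: ns xs f => [|n ns IH] [|x xs] f //= => [_ fl|[nx] fl]; first exact: fl.
apply: swsum_linearP => s sn; apply: (IH xs (fun w s' => f w (s ++ s'))) => // s' sn'.
by apply: fl; rewrite size_cat sn sn'.
Qed.

Lemma wsum_tsum W (U V : lmodType k) ns xs (t : tensor U V)
    (f : U -> V -> seq H -> W) :
  wsum ns xs (fun s => \tsum_(u, v <- t) f u v s) =
  \tsum_(u, v <- t) wsum ns xs (f u v).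
Proof.
elim: ns xs f => [|n ns IH] [|x xs] f //=.
rewrite -swsum_tsum; apply: eq_swsum => s _.
exact: (IH xs (fun u v s' => f u v (s ++ s'))).
Qed.

Lemma wsum_nseq1 W xs (f : seq H -> W) : multilinear (size xs) f ->
  wsum (nseq (size xs) 1%N) xs f = f xs.
Proof.
elim: xs f => [|x xs IH] f fl //.
have e s : size s = 1%N -> wsum (nseq (size xs) 1%N) xs (fun s' => f (s ++ s')) = f (s ++ xs).
  by move=> s1; apply: (IH (fun s' => f (s ++ s'))); apply: (multilinear_cat s1).
rewrite [LHS](eq_swsum _ e) swsum1 // => -[|//] [|//] _.
exact: (multilinear_head fl).
Qed.

Fixpoint word_split (ns : seq nat) p : seq nat :=
  if ns is n :: ns' then
    if p < n then n.+1 :: ns' else n :: word_split ns' (p - n)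
  else [::].

Lemma size_word_split ns p : size (word_split ns p) = size ns.
Proof. by elim: ns p => //= n ns IH p; case: ifP => //= _; rewrite IH. Qed.

Lemma sumn_word_split ns p : p < sumn ns -> sumn (word_split ns p) = (sumn ns).+1.
Proof.
elim: ns p => //= n ns IH p; case: (ltnP p n) => [np|np] h; first by rewrite /= addSn.
by rewrite /= IH ?addnS // ltn_subLR.
Qed.

Lemma wsum_split W ns xs p (f : seq H -> W) : size ns = size xs ->
  p < sumn ns -> multilinear (sumn ns).+1 f ->
  wsum ns xs (fun s => \tsum_(a, b <- Delta (nth 0%R s p)) f (split_at p a b s)) =
  wsum (word_split ns p) xs f.
Proof.
elim: ns xs p f => [|n ns IH] [|x xs] p f //= [nx] pn fl.
case: ltnP => np /=.
  rewrite -[RHS]/(swsum n.+1 x (fun s => wsum ns xs (fun s' => f (s ++ s')))).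
  rewrite -(swsum_split _ np).
    apply: eq_swsum => s sn.
    rewrite -(wsum_tsum _ _ _ (fun a b s' => f (split_at p a b s ++ s'))).
    apply: eq_wsum => // s' _; rewrite nth_cat sn np.
    by apply: eq_tsum => a b; rewrite split_at_catl ?sn.
  move=> s1 s2 e; apply: wsum_linearP => // s' sn' w u v; rewrite -!catA /=.
  by apply: (fl s1 (s2 ++ s')); rewrite size_cat addnA -addSn e sn'.
apply: eq_swsum => s sn.
rewrite -(IH xs (p - n)%N (fun s' => f (s ++ s'))) //.
- apply: eq_wsum => // s' _; rewrite nth_cat sn ltnNge np /=.
  by apply: eq_tsum => a b; rewrite split_at_catr ?sn.
- by rewrite ltn_subLR.
- by apply: (multilinear_cat sn); rewrite addnS.
Qed.

Fixpoint word_del (ns : seq nat) p : seq nat :=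
  if ns is n :: ns' then
    if p < n then n.-1 :: ns' else n :: word_del ns' (p - n)
  else [::].

Lemma size_word_del ns p : size (word_del ns p) = size ns.
Proof. by elim: ns p => //= n ns IH p; case: ifP => //= _; rewrite IH. Qed.

Lemma sumn_word_del ns p : p < sumn ns -> sumn (word_del ns p) = (sumn ns).-1.
Proof.
elim: ns p => //= n ns IH p; case: (ltnP p n) => [|np h].
  by case: n => //= n _; rewrite addSn.
rewrite /= IH ?ltn_subLR //.
by case: (sumn ns) h => [|m]; [rewrite addn0 ltnNge np | rewrite addnS].
Qed.

Lemma del_at_catl p s s' : p < size s -> del_at p (s ++ s') = del_at p s ++ s'.
Proof.
move=> ps; rewrite /del_at takel_cat ?(ltnW ps) // drop_cat -catA.
case: ltnP => // h; have -> : p.+1 = size s by apply/eqP; rewrite eqn_leq ps h.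
by rewrite subnn drop0 drop_size.
Qed.

Lemma del_at_catr p s s' : size s <= p ->
  del_at p (s ++ s') = s ++ del_at (p - size s) s'.
Proof.
move=> ps; rewrite /del_at take_cat drop_cat ltnNge ps /= ltnNge leqW //=.
by rewrite -catA subSn.
Qed.

Lemma wsum_counit W ns xs p (f : seq H -> W) : size ns = size xs ->
  p < sumn ns -> multilinear (sumn ns).-1 f ->
  wsum ns xs (fun s => eps (nth 0%R s p) *: f (del_at p s)) =
  wsum (word_del ns p) xs f.
Proof.
elim: ns xs p f => [|n ns IH] [|x xs] p f //= [nx] pn fl.
case: ltnP => np /=.
  rewrite -[RHS](swsum_counit _ np).
    apply: eq_swsum => s sn.
    rewrite (wsum_linear _ _ _ (linear_scale' _ (@linear_id' _ _))).
    by apply: eq_wsum => // s' _; rewrite nth_cat sn np del_at_catl ?sn.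
  move=> s1 s2 e; apply: wsum_linearP => // s' sn' w u v.
  rewrite -!catA /=; apply: (fl s1 (s2 ++ s')).
  by rewrite size_cat addnA -addSn e sn'; case: n np {fl pn sn' e}.
apply: eq_swsum => s sn.
rewrite -(IH xs (p - n)%N (fun s' => f (s ++ s'))) //.
- apply: eq_wsum => // s' _; rewrite nth_cat sn ltnNge np /=.
  by rewrite del_at_catr ?sn.
- by rewrite ltn_subLR.
- apply: (multilinear_cat sn); suff -> : (n + (sumn ns).-1)%N = (n + sumn ns).-1 by [].
  by case: (sumn ns) pn => [|m _]; [rewrite addn0 ltnNge np | rewrite addnS].
Qed.

End MultiSums.

(** * Syntax and normal forms of Sweedler expressions *)

(** Monomials in the components of a Sweedler sum: [Lf i] is the i-th component in the
    current list of components, [Cs], [U1], [B2] apply the constants and the unary and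
    binary operations of a signature. *)
Inductive tm :=
  Lf of nat | Cs of nat | U1 of nat & tm | B2 of nat & tm & tm.

Fixpoint tm_eqb (t u : tm) : bool :=
  match t, u with
  | Lf i, Lf j => i == j
  | Cs i, Cs j => i == j
  | U1 o t1, U1 o' u1 => (o == o') && tm_eqb t1 u1
  | B2 o t1 t2, B2 o' u1 u2 => [&& o == o', tm_eqb t1 u1 & tm_eqb t2 u2]
  | _, _ => false
  end.

Lemma tm_eqbP t u : tm_eqb t u -> t = u.
Proof.
elim: t u => [i|i|o t IH|o t IH t' IH'] [j|j|o' u|o' u u'] //=.
- by move/eqP->.
- by move/eqP->.
- by case/andP=> /eqP-> /IH->.
- by case/and3P=> /eqP-> /IH-> /IH'->.
Qed.

(** Expressions with values in H, in H (x) H, and in the target of a multilinear function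
    of several arguments in H. Variables are de Bruijn levels; a sum over a tensor binds
    two of them. *)
Inductive expr :=
| EV of nat | EC of nat | E1 of nat & expr | E2 of nat & expr & expr
| EB of texpr & expr | ES of expr & expr
with texpr := TD of expr | TP of expr & expr | TB of texpr & texpr | TS of expr & texpr.

Inductive oexpr := RR of seq expr | RB of texpr & oexpr | RS of expr & oexpr.

Scheme ex_mind := Induction for expr Sort Prop
with tx_mind := Induction for texpr Sort Prop.
Combined Scheme ex_tx_ind from ex_mind, tx_mind.

(** A sum over a tensor may be evaluated along any decomposition only if its summand is
    linear in the two bound variables. The following tests decide a sufficient condition:
    [freshE i] says that variable [i] does not occur, [linE m i] that it occurs exactly
    once, and if in a tensor that is summed over, then with a summand linear in the two
    variables bound by the sum; [m] is the number of variables in scope. *)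
Fixpoint freshE (i : nat) (e : expr) : bool :=
  match e with
  | EV j => i != j
  | EC _ => true
  | E1 _ e => freshE i e
  | E2 _ e e' | ES e e' => freshE i e && freshE i e'
  | EB t e => freshT i t && freshE i e
  end
with freshT (i : nat) (t : texpr) : bool :=
  match t with
  | TD e => freshE i e
  | TP e e' => freshE i e && freshE i e'
  | TB t t' => freshT i t && freshT i t'
  | TS e t => freshE i e && freshT i t
  end.

(* conjunction and disjunction that call-by-value evaluation does not force *)
Local Notation "a &&& b" := (if a then b else false)
  (at level 40, left associativity, only parsing).
Local Notation "a ||| b" := (if a then true else b)
  (at level 50, left associativity, only parsing).

Fixpoint linE (m i : nat) (e : expr) : bool :=
  match e with
  | EV j => i == j
  | EC _ => false
  | E1 _ e => linE m i e
  | E2 _ e e' | ES e e' =>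
    (linE m i e &&& freshE i e') ||| (freshE i e &&& linE m i e')
  | EB t e =>
    (linT m i t &&& (freshE i e &&& (linE m.+2 m e &&& linE m.+2 m.+1 e)))
    ||| (freshT i t &&& linE m.+2 i e)
  end
with linT (m i : nat) (t : texpr) : bool :=
  match t with
  | TD e => linE m i e
  | TP e e' => (linE m i e &&& freshE i e') ||| (freshE i e &&& linE m i e')
  | TB t t' =>
    (linT m i t &&& (freshT i t' &&& (linT m.+2 m t' &&& linT m.+2 m.+1 t')))
    ||| (freshT i t &&& linT m.+2 i t')
  | TS e t => (linE m i e &&& freshT i t) ||| (freshE i e &&& linT m i t)
  end.

Fixpoint freshR (i : nat) (r : oexpr) : bool :=
  match r with
  | RR es => all (freshE i) es
  | RB t r => freshT i t && freshR i r
  | RS e r => freshE i e && freshR i r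
  end.

Fixpoint linEs (m i : nat) (es : seq expr) : bool :=
  if es is e :: es' then
    (linE m i e &&& all (freshE i) es') ||| (freshE i e &&& linEs m i es')
  else false.

Fixpoint linR (m i : nat) (r : oexpr) : bool :=
  match r with
  | RR es => linEs m i es
  | RB t r =>
    (linT m i t &&& (freshR i r &&& (linR m.+2 m r &&& linR m.+2 m.+1 r)))
    ||| (freshT i t &&& linR m.+2 i r)
  | RS e r => (linE m i e &&& freshR i r) ||| (freshE i e &&& linR m i r)
  end.

Fixpoint leaves (t : tm) : seq nat :=
  match t with
  | Lf i => [:: i]
  | Cs _ => [::]
  | U1 _ t => leaves t
  | B2 _ t u => leaves t ++ leaves u
  end.

(** How a monomial is renumbered when component [p] is split in two, resp. deleted. It
    fails if component [p] itself occurs: that would mean a component used twice. *)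
Fixpoint shift (p : nat) (t : tm) : option tm :=
  match t with
  | Lf q => if q == p then None else Some (Lf (if q < p then q else q.+1)%N)
  | Cs c => Some (Cs c)
  | U1 o t => omap (U1 o) (shift p t)
  | B2 o t u =>
    if shift p t is Some t' then omap (B2 o t') (shift p u) else None
  end.

Fixpoint unshift (p : nat) (t : tm) : option tm :=
  match t with
  | Lf q => if q == p then None else Some (Lf (if q < p then q else q.-1)%N)
  | Cs c => Some (Cs c)
  | U1 o t => omap (U1 o) (unshift p t)
  | B2 o t u =>
    if unshift p t is Some t' then omap (B2 o t') (unshift p u) else None
  end.

Fixpoint shifts (bs : seq nat) (o : option tm) : option tm :=
  if bs is p :: bs' then shifts bs' (obind (shift p) o) else o.

Fixpoint oall (T U : Type) (f : T -> option U) (s : seq T) : option (seq U) :=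
  if s is x :: s' then
    if f x is Some y then omap (cons y) (oall f s') else None
  else Some [::].

Definition shift_tms (bs : seq nat) (ts : seq tm) : option (seq tm) :=
  oall (fun t => shifts bs (Some t)) ts.

Fixpoint within (n : nat) (bs : seq nat) : bool :=
  if bs is p :: bs' then (p < n)%N && within n.+1 bs' else true.

Section Normalise.
Variables (flip1 : nat -> option bool) (flip2 : nat -> option (bool * bool)).

(** The comultiplication of a monomial: operations compatible with the comultiplication
    move it to their arguments, where the flags say in which order the two halves come
    out, and leaves are split. The result lists the splittings performed, in order. *)
Fixpoint split_tm (bs0 : seq nat) (t : tm) : option (seq nat * tm * tm) :=
  match t with
  | Lf l => if shifts bs0 (Some (Lf l)) is Some (Lf l') then
              Some ([:: l'], Lf l', Lf l'.+1) else None
  | Cs c => Some ([::], Cs c, Cs c)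
  | U1 o t =>
    match flip1 o, split_tm bs0 t with
    | Some f, Some (bs, t1, t2) =>
      Some (bs, U1 o (if f then t2 else t1), U1 o (if f then t1 else t2))
    | _, _ => None
    end
  | B2 o t u =>
    if flip2 o is Some (f, g) then
    if split_tm bs0 t is Some (bs1, t1, t2) then
    if split_tm (bs0 ++ bs1) u is Some (bs2, u1, u2) then
    if shifts bs2 (Some t1) is Some t1' then
    if shifts bs2 (Some t2) is Some t2' then
      Some (bs1 ++ bs2,
            B2 o (if f then t2' else t1') (if g then u2 else u1),
            B2 o (if f then t1' else t2') (if g then u1 else u2))
    else None else None else None else None else None
  end.

(** Symbolic evaluation. The state is the number of components reached so far, and each
    [run] returns the splittings performed, the monomials under a counit, and the value as
    monomials in the components present at the end. The environment maps variables to
    monomials; entries become [None] when the components they use are consumed. *)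
Definition senv := seq (option tm).
Definition shiftenv (bs : seq nat) (ts : senv) : senv := map (shifts bs) ts.

Fixpoint runE (ts : senv) (e : expr) : option (seq nat * seq tm * tm) :=
  match e with
  | EV i => if nth None ts i is Some t then Some ([::], [::], t) else None
  | EC c => Some ([::], [::], Cs c)
  | E1 o e => if runE ts e is Some (bs, el, t) then Some (bs, el, U1 o t) else None
  | E2 o e e' =>
    if runE ts e is Some (bs, el, t) then
    if runE (shiftenv bs ts) e' is Some (bs', el', t') then
    if shift_tms bs' (t :: el) is Some (u :: el2) then
      Some (bs ++ bs', el2 ++ el', B2 o u t')
    else None else None else None
  | ES e e' =>
    if runE ts e is Some (bs, el, t) then
    if runE (shiftenv bs ts) e' is Some (bs', el', t') then
    if shift_tms bs' (t :: el) is Some el2 then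
      Some (bs ++ bs', el2 ++ el', t')
    else None else None else None
  | EB t e =>
    if linE (size ts).+2 (size ts) e && linE (size ts).+2 (size ts).+1 e then
    if runT ts t is Some (bs, el, t1, t2) then
    if runE (rcons (rcons (shiftenv bs ts) (Some t1)) (Some t2)) e
      is Some (bs', el', t') then
    if shift_tms bs' el is Some el2 then
      Some (bs ++ bs', el2 ++ el', t')
    else None else None else None else None
  end
with runT (ts : senv) (t : texpr) : option (seq nat * seq tm * tm * tm) :=
  match t with
  | TD e =>
    if runE ts e is Some (bs, el, t) then
    if split_tm [::] t is Some (bs', t1, t2) then
    if shift_tms bs' el is Some el2 then
      Some (bs ++ bs', el2, t1, t2)
    else None else None else None
  | TP e e' =>
    if runE ts e is Some (bs, el, t) then
    if runE (shiftenv bs ts) e' is Some (bs', el', t') then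
    if shift_tms bs' (t :: el) is Some (u :: el2) then
      Some (bs ++ bs', el2 ++ el', u, t')
    else None else None else None
  | TS e e' =>
    if runE ts e is Some (bs, el, t) then
    if runT (shiftenv bs ts) e' is Some (bs', el', t1, t2) then
    if shift_tms bs' (t :: el) is Some el2 then
      Some (bs ++ bs', el2 ++ el', t1, t2)
    else None else None else None
  | TB t e =>
    if linT (size ts).+2 (size ts) e && linT (size ts).+2 (size ts).+1 e then
    if runT ts t is Some (bs, el, t1, t2) then
    if runT (rcons (rcons (shiftenv bs ts) (Some t1)) (Some t2)) e
      is Some (bs', el', u1, u2) then
    if shift_tms bs' el is Some el2 then
      Some (bs ++ bs', el2 ++ el', u1, u2)
    else None else None else None else None
  end.

Fixpoint runEs (ts : senv) (es : seq expr) : option (seq nat * seq tm * seq tm) :=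
  if es is e :: es' then
    if runE ts e is Some (bs, el, t) then
    if runEs (shiftenv bs ts) es' is Some (bs', el', us) then
    if shift_tms bs' (t :: el) is Some (u :: el2) then
      Some (bs ++ bs', el2 ++ el', u :: us)
    else None else None else None
  else Some ([::], [::], [::]).

Fixpoint runR (ts : senv) (r : oexpr) : option (seq nat * seq tm * seq tm) :=
  match r with
  | RR es => runEs ts es
  | RB t r =>
    if linR (size ts).+2 (size ts) r && linR (size ts).+2 (size ts).+1 r then
    if runT ts t is Some (bs, el, t1, t2) then
    if runR (rcons (rcons (shiftenv bs ts) (Some t1)) (Some t2)) r
      is Some (bs', el', us) then
    if shift_tms bs' el is Some el2 then
      Some (bs ++ bs', el2 ++ el', us)
    else None else None else None else None
  | RS e r =>
    if runE ts e is Some (bs, el, t) then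
    if runR (shiftenv bs ts) r is Some (bs', el', us) then
    if shift_tms bs' (t :: el) is Some el2 then
      Some (bs ++ bs', el2 ++ el', us)
    else None else None else None
  end.

Fixpoint eps_leaves (t : tm) : option (seq nat) :=
  match t with
  | Lf l => Some [:: l]
  | Cs _ => Some [::]
  | U1 o t => if flip1 o is Some _ then eps_leaves t else None
  | B2 o t u =>
    if flip2 o is Some _ then
    if eps_leaves t is Some s then omap (cat s) (eps_leaves u) else None
    else None
  end.

(** Every one of the n components occurs exactly once, so that the value is multilinear in
    them. *)
Definition once (n : nat) (us : seq tm) : bool :=
  all (fun i => count_mem i (flatten (map leaves us)) == 1%N) (iota 0 n).

(** The first [m] monomials of [us] are leaves standing under a counit; each deletes its
    component by the counit axiom. *)
Fixpoint drop_eps (m : nat) (ns : seq nat) (us : seq tm) :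
    option (seq nat * seq tm) :=
  if once (sumn ns) us then
    if m is m'.+1 then
      if us is Lf q :: us' then
        if (q < sumn ns)%N then
        if oall (unshift q) us' is Some us2 then drop_eps m' (word_del ns q) us2
        else None else None
      else None
    else Some (ns, us)
  else None.

Variable rules : seq (tm * tm).

Fixpoint inst (sub : nat -> tm) (t : tm) : tm :=
  match t with
  | Lf i => sub i
  | Cs c => Cs c
  | U1 o t => U1 o (inst sub t)
  | B2 o t u => B2 o (inst sub t) (inst sub u)
  end.

(** Rewriting of monomials by the oriented equations [rules]. The
    equality test after matching is what soundness rests on. *)
Fixpoint pmatch (p t : tm) : option (seq (nat * tm)) :=
  match p, t with
  | Lf i, _ => Some [:: (i, t)]
  | Cs c, Cs c' => if c == c' then Some [::] else None
  | U1 o p, U1 o' t => if o == o' then pmatch p t else None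
  | B2 o p p', B2 o' t t' =>
    if o == o' then
    if pmatch p t is Some s then omap (cat s) (pmatch p' t') else None
    else None
  | _, _ => None
  end.

Definition lookup (s : seq (nat * tm)) (i : nat) : tm :=
  if [seq q.2 | q <- s & q.1 == i] is t :: _ then t else Lf 0.

Fixpoint rewrite_head (rs : seq (tm * tm)) (t : tm) : option tm :=
  if rs is (l, r) :: rs' then
    if pmatch l t is Some s then
      if tm_eqb (inst (lookup s) l) t then Some (inst (lookup s) r)
      else rewrite_head rs' t
    else rewrite_head rs' t
  else None.

Fixpoint simplify (fuel : nat) (t : tm) : tm :=
  if fuel is f.+1 then
    let t' := match t with
      | U1 o u => U1 o (simplify f u)
      | B2 o u u' => B2 o (simplify f u) (simplify f u')
      | _ => t end in
    if rewrite_head rules t' is Some t2 then simplify f t2 else t'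
  else t.

(** The normal form of an expression in n variables: the numbers of Sweedler components of
    these, and the arguments as monomials in the components. *)
Definition normalise (fuel n m : nat) (r : oexpr) : option (seq nat * seq tm) :=
  if runR (map (fun i => Some (Lf i)) (iota 0 n)) r is Some (bs, el, us) then
  if within n bs && (size us == m) then
  if oall eps_leaves el is Some els then
  let el' := map Lf (flatten els) in
  if drop_eps (size el') (foldl word_split (nseq n 1%N) bs) (el' ++ us)
    is Some (ns, us') then
    Some (ns, map (simplify fuel) us')
  else None else None else None else None.

End Normalise.

Section Semantics.
Variables (k : fieldType) (H : hopfAlg k).
Implicit Types (W : lmodType k) (s : seq H).

(** Constants are group-like. An operation may be compatible with comultiplication and
    counit, possibly reversing the order of components: [u_flip] is [None] for a map that
    is only linear, [Some true] for an anti-morphism such as the antipode; [b_flip] has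
    one flag for each argument. *)
Record constant := Constant {
  c_val : H;
  c_ok : Delta c_val = c_val \ox c_val /\ eps c_val = 1 }.

Record unary := Unary {
  u_fun : H -> H;
  u_linear : linear u_fun;
  u_flip : option bool;
  u_ok : if u_flip is Some f then
      (forall x, Delta (u_fun x) = \tsum_(x1, x2 <- Delta x)
        (u_fun (if f then x2 else x1) \ox u_fun (if f then x1 else x2)))
      /\ (forall x, eps (u_fun x) = eps x)
    else True }.

Record binary := Binary {
  b_fun : H -> H -> H;
  b_bilinear : bilinear b_fun;
  b_flip : option (bool * bool);
  b_ok : if b_flip is Some (f, g) then
      (forall x y, Delta (b_fun x y) =
        \tsum_(x1, x2 <- Delta x) \tsum_(y1, y2 <- Delta y)
        (b_fun (if f then x2 else x1) (if g then y2 else y1)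
         \ox b_fun (if f then x1 else x2) (if g then y1 else y2)))
      /\ (forall x y, eps (b_fun x y) = eps x * eps y)
    else True }.

Lemma one_ok : Delta (1 : H) = 1 \ox 1 /\ eps (1 : H) = 1.
Proof. by split; [exact: hopf_delta1 (hopfP H) | exact: hopf_eps1 (hopfP H)]. Qed.

Definition one_constant := Constant one_ok.
Definition id_unary := Unary (fun a x y => erefl (a *: x + y)) (u_flip := None) I.

Lemma zero_bilinear : bilinear (fun _ _ : H => 0 : H).
Proof. by split=> [u|u] a x y; rewrite /= scaler0 addr0. Qed.
Definition zero_binary := Binary zero_bilinear (b_flip := None) I.

Record signature := Signature {
  consts : seq constant; unaries : seq unary; binaries : seq binary }.

Variable sg : signature.

Definition cI c := c_val (nth one_constant (consts sg) c).
Definition uI o := u_fun (nth id_unary (unaries sg) o).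
Definition bI o := b_fun (nth zero_binary (binaries sg) o).
Definition flip1 o := u_flip (nth id_unary (unaries sg) o).
Definition flip2 o := b_flip (nth zero_binary (binaries sg) o).

Fixpoint tmI (v : nat -> H) (t : tm) : H :=
  match t with
  | Lf i => v i
  | Cs c => cI c
  | U1 o t => uI o (tmI v t)
  | B2 o t u => bI o (tmI v t) (tmI v u)
  end.

Fixpoint exI (vs : seq H) (e : expr) : H :=
  match e with
  | EV i => nth 0 vs i
  | EC c => cI c
  | E1 o e => uI o (exI vs e)
  | E2 o e e' => bI o (exI vs e) (exI vs e')
  | ES e e' => eps (exI vs e) *: exI vs e'
  | EB t e => \tsum_(a, b <- txI vs t) exI (rcons (rcons vs a) b) e
  end
with txI (vs : seq H) (t : texpr) : tensor H H :=
  match t with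
  | TD e => Delta (exI vs e)
  | TP e e' => exI vs e \ox exI vs e'
  | TS e t => eps (exI vs e) *: txI vs t
  | TB t t' => \tsum_(a, b <- txI vs t) txI (rcons (rcons vs a) b) t'
  end.

Fixpoint rxI W (phi : seq H -> W) (vs : seq H) (r : oexpr) : W :=
  match r with
  | RR es => phi (map (exI vs) es)
  | RB t r => \tsum_(a, b <- txI vs t) rxI phi (rcons (rcons vs a) b) r
  | RS e r => eps (exI vs e) *: rxI phi vs r
  end.

Lemma bI_bilinear o : bilinear (bI o). Proof. exact: b_bilinear. Qed.
Lemma uI_linear o : linear (uI o). Proof. exact: u_linear. Qed.

Lemma fresh_sound i : (forall e, freshE i e -> forall v1 v2 x y, size v1 = i ->
    exI (v1 ++ x :: v2) e = exI (v1 ++ y :: v2) e) /\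
  (forall t, freshT i t -> forall v1 v2 x y, size v1 = i ->
    txI (v1 ++ x :: v2) t = txI (v1 ++ y :: v2) t).
Proof.
apply: ex_tx_ind => //=.
- move=> j ij v1 v2 x y si; rewrite !nth_cat si; case: ltnP => // le.
  by case d: (j - i)%N => [|//]; move/eqP: ij; case; apply/eqP; rewrite eqn_leq le -subn_eq0 d.
- by move=> o e IH /IH e1 v1 v2 x y si; rewrite (e1 _ _ _ y).
- by move=> o e IH e' IH' /andP[/IH h /IH' h'] v1 v2 x y si; rewrite (h _ _ _ y) ?(h' _ _ _ y).
- move=> t IH e IH' /andP[/IH h /IH' h'] v1 v2 x y si; rewrite (h _ _ _ y) //.
  by apply: eq_tsum => a b; rewrite -!cats1 -!catA !cat_cons; apply: h'.
- by move=> e IH e' IH' /andP[/IH h /IH' h'] v1 v2 x y si; rewrite (h _ _ _ y) ?(h' _ _ _ y).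
- by move=> e IH /IH e1 v1 v2 x y si; rewrite (e1 _ _ _ y).
- by move=> e IH e' IH' /andP[/IH h /IH' h'] v1 v2 x y si; rewrite (h _ _ _ y) ?(h' _ _ _ y).
- move=> t IH e IH' /andP[/IH h /IH' h'] v1 v2 x y si; rewrite (h _ _ _ y) //.
  by apply: eq_tsum => a b; rewrite -!cats1 -!catA !cat_cons; apply: h'.
- by move=> e IH e' IH' /andP[/IH h /IH' h'] v1 v2 x y si; rewrite (h _ _ _ y) ?(h' _ _ _ y).
Qed.

Lemma eq_linear (U V : lmodType k) (f g : U -> V) : f =1 g -> linear f -> linear g.
Proof. by move=> e fl a x y; rewrite -!e fl. Qed.

Lemma linear_bil (U V V' W' : lmodType k) (o : V -> V' -> W') (f : U -> V) (g : V') :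
  bilinear o -> linear f -> linear (fun x => o (f x) g).
Proof. by case=> ol _ fl a x y; rewrite fl ol. Qed.
Lemma linear_bir (U V V' W' : lmodType k) (o : V -> V' -> W') (f : U -> V') (g : V) :
  bilinear o -> linear f -> linear (fun x => o g (f x)).
Proof. by case=> _ ol fl a x y; rewrite fl ol. Qed.

Lemma scale_eps_bilinear W : bilinear (fun (x : H) (w : W) => eps x *: w).
Proof.
split=> [w|x] a u v /=; last by rewrite scalerDr !scalerA mulrC.
by rewrite eps_scalar scalerDl scalerA.
Qed.

Lemma linear_tsum_src (U W' : lmodType k) (f : U -> tensor H H) (g : H -> H -> W') :
  bilinear g -> linear f -> linear (fun x => tsum (f x) g).
Proof. by move=> gb fl; apply: (linear_comp (tsum_linear gb) fl). Qed.

Lemma rcons2_cat v1 v2 (x a b : H) :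
  rcons (rcons (v1 ++ x :: v2) a) b = v1 ++ x :: rcons (rcons v2 a) b.
Proof. by rewrite -!cats1 -!catA. Qed.

Lemma linear_rcons W' (F : seq H -> W') (vs : seq H) :
  (forall v1 v2, size v1 = size vs -> size (v1 ++ 0 :: v2) = (size vs).+2 -> linear (fun x => F (v1 ++ x :: v2))) ->
  (forall v1 v2, size v1 = (size vs).+1 -> size (v1 ++ 0 :: v2) = (size vs).+2 -> linear (fun x => F (v1 ++ x :: v2))) ->
  bilinear (fun a b => F (rcons (rcons vs a) b)).
Proof.
move=> h1 h2; split=> [b|a].
  apply: eq_linear (h1 vs [:: b] erefl _) => [x|]; first by rewrite -!cats1 -catA.
  by rewrite size_cat /= !addnS addn0.
have := h2 (rcons vs a) [::] (size_rcons _ _); rewrite size_cat size_rcons /= addn1.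
by move=> /(_ erefl); apply: eq_linear => x; rewrite -!cats1.
Qed.

Definition lin_spec W' (F : seq H -> W') m i := forall v1 v2, size v1 = i ->
  size (v1 ++ 0 :: v2) = m -> linear (fun x => F (v1 ++ x :: v2)).

Lemma lin_spec_bil W' (F : seq H -> W') (vs : seq H) m : size vs = m ->
  lin_spec F m.+2 m -> lin_spec F m.+2 m.+1 ->
  bilinear (fun a b => F (rcons (rcons vs a) b)).
Proof. by move=> <-; exact: linear_rcons. Qed.

Lemma lin_spec_bind W' (T : seq H -> tensor H H) (F : seq H -> W') m i :
  lin_spec T m i -> (forall v1 v2 x y, size v1 = i -> F (v1 ++ x :: v2) = F (v1 ++ y :: v2)) ->
  lin_spec F m.+2 m -> lin_spec F m.+2 m.+1 ->
  lin_spec (fun vs => \tsum_(a, b <- T vs) F (rcons (rcons vs a) b)) m i.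
Proof.
move=> Tl Fc Fl Fl' v1 v2 si sm.
apply: (eq_linear (f := fun x => \tsum_(a, b <- T (v1 ++ x :: v2))
   F (rcons (rcons (v1 ++ 0 :: v2) a) b))) => [x|].
  by apply: eq_tsum => a b; rewrite !rcons2_cat; exact: Fc.
by apply: linear_tsum_src; [exact: lin_spec_bil Fl Fl' | exact: Tl].
Qed.

Lemma lin_spec_bind' W' (T : seq H -> tensor H H) (F : seq H -> W') m i :
  (forall v1 v2 x y, size v1 = i -> T (v1 ++ x :: v2) = T (v1 ++ y :: v2)) ->
  lin_spec F m.+2 i ->
  lin_spec (fun vs => \tsum_(a, b <- T vs) F (rcons (rcons vs a) b)) m i.
Proof.
move=> Tc Fl v1 v2 si sm.
apply: (eq_linear (f := fun x => \tsum_(a, b <- T (v1 ++ 0 :: v2))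
   F (v1 ++ x :: rcons (rcons v2 a) b))) => [x|].
  by rewrite (Tc _ _ _ x) //; apply: eq_tsum => a b; rewrite rcons2_cat.
apply: tsum_linearP => a b; apply: Fl => //.
by rewrite -rcons2_cat !size_rcons sm.
Qed.

Lemma lin_spec2 (V V' W' : lmodType k) (o : V -> V' -> W') (F : seq H -> V)
    (G : seq H -> V') m i : bilinear o ->
  lin_spec F m i -> (forall v1 v2 x y, size v1 = i -> G (v1 ++ x :: v2) = G (v1 ++ y :: v2)) ->
  lin_spec (fun vs => o (F vs) (G vs)) m i.
Proof.
move=> ob Fl Gc v1 v2 si sm.
apply: eq_linear (linear_bil (G (v1 ++ 0 :: v2)) ob (Fl _ _ si sm)) => x.
by rewrite /= (Gc _ _ 0 x).
Qed.

Lemma lin_spec2' (V V' W' : lmodType k) (o : V -> V' -> W') (F : seq H -> V)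
    (G : seq H -> V') m i : bilinear o ->
  (forall v1 v2 x y, size v1 = i -> F (v1 ++ x :: v2) = F (v1 ++ y :: v2)) ->
  lin_spec G m i -> lin_spec (fun vs => o (F vs) (G vs)) m i.
Proof.
move=> ob Fc Gl v1 v2 si sm.
apply: eq_linear (linear_bir (F (v1 ++ 0 :: v2)) ob (Gl _ _ si sm)) => x.
by rewrite /= (Fc _ _ 0 x).
Qed.

Lemma lin_sound : (forall e m i, linE m i e -> lin_spec (exI^~ e) m i) /\
  (forall t m i, linT m i t -> lin_spec (txI^~ t) m i).
Proof.
have fE i := (fresh_sound i).1; have fT i := (fresh_sound i).2.
apply: ex_tx_ind => //=.
- move=> j m i /eqP<- v1 v2 si _ a x y; rewrite !nth_cat si ltnn subnn //=.
- move=> o e IH m i /IH h v1 v2 si sm.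
  exact: (linear_comp (uI_linear o) (h _ _ si sm)).
- move=> o e IH e' IH' m i /orP[]/andP[h h'].
    exact: (lin_spec2 (bI_bilinear o) (IH _ _ h) (fE _ _ h')).
  exact: (lin_spec2' (bI_bilinear o) (fE _ _ h) (IH' _ _ h')).
- move=> t IH e IH' m i /orP[/and4P[h h1 h2 h3]|/andP[h h']].
    exact: (lin_spec_bind (IH _ _ h) (fE _ _ h1) (IH' _ _ h2) (IH' _ _ h3)).
  exact: (lin_spec_bind' (fT _ _ h) (IH' _ _ h')).
- move=> e IH e' IH' m i /orP[]/andP[h h'].
    exact: (lin_spec2 (scale_eps_bilinear _) (IH _ _ h) (fE _ _ h')).
  exact: (lin_spec2' (scale_eps_bilinear _) (fE _ _ h) (IH' _ _ h')).
- move=> e IH m i /IH h v1 v2 si sm.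
  exact: (linear_comp (@Delta_linear k H) (h _ _ si sm)).
- move=> e IH e' IH' m i /orP[]/andP[h h'].
    exact: (lin_spec2 (@pure_bilinear _ _ _) (IH _ _ h) (fE _ _ h')).
  exact: (lin_spec2' (@pure_bilinear _ _ _) (fE _ _ h) (IH' _ _ h')).
- move=> t IH e IH' m i /orP[/and4P[h h1 h2 h3]|/andP[h h']].
    exact: (lin_spec_bind (IH _ _ h) (fT _ _ h1) (IH' _ _ h2) (IH' _ _ h3)).
  exact: (lin_spec_bind' (fT _ _ h) (IH' _ _ h')).
- move=> e IH e' IH' m i /orP[]/andP[h h'].
    exact: (lin_spec2 (scale_eps_bilinear _) (IH _ _ h) (fT _ _ h')).
  exact: (lin_spec2' (scale_eps_bilinear _) (fE _ _ h) (IH' _ _ h')).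
Qed.

End Semantics.

(** * Soundness of symbolic evaluation *)

Section Soundness.
Variables (k : fieldType) (H : hopfAlg k) (sg : signature H).
Implicit Types (W : lmodType k) (s vs : seq H) (t u : tm) (bs : seq nat).

Local Notation tmv s t := (tmI sg (fun i => nth 0 s i) t).
Local Notation flip1 := (flip1 sg).
Local Notation flip2 := (flip2 sg).

(** The sum obtained by performing the splittings [bs] on the list of components [s]. *)
Fixpoint split_sum W bs s (K : seq H -> W) : W :=
  if bs is p :: bs' then
    \tsum_(a, b <- Delta (nth 0 s p)) split_sum bs' (split_at p a b s) K
  else K s.

Definition eps_prod s (el : seq tm) : k := \prod_(t <- el) eps (tmv s t).

Lemma nth_split_at p (a b : H) s q : (p < size s)%N ->
  nth 0 (split_at p a b s) q =
  if (q < p)%N then nth 0 s q else if q == p then a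
  else if q == p.+1 then b else nth 0 s q.-1.
Proof.
move=> ps; rewrite nth_cat size_takel ?(ltnW ps) //.
case: ltnP => [qp|pq]; first by rewrite nth_take.
have [d ->] : exists d, q = (p + d)%N by exists (q - p)%N; rewrite subnKC.
rewrite addKn; case: d => [|[|d]] /=.
- by rewrite addn0 eqxx.
- by rewrite addn1 eqxx gtn_eqF.
by rewrite nth_drop !addnS !gtn_eqF ?ltnS ?leqW ?leq_addr.
Qed.

Lemma shiftP p t t' s a b : (p < size s)%N -> shift p t = Some t' ->
  tmv (split_at p a b s) t' = tmv s t.
Proof.
move=> ps; elim: t t' => [q|c|o t IH|o t IH u IH'] t' /=.
- case: eqP => // /eqP qp [<-] /=; rewrite nth_split_at //.
  case: (ltngtP q p) => [h|h|h]; first by rewrite h.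
    have -> : (q.+1 < p)%N = false by rewrite ltnNge leqW ?(ltnW h).
    have -> : (q.+1 == p) = false by apply: gtn_eqF; exact: leqW.
    by have -> : (q.+1 == p.+1) = false by rewrite eqSS gtn_eqF.
  by rewrite h eqxx in qp.
- by move=> [<-].
- by case: shift IH => //= t1 IH [<-] /=; rewrite IH.
- case: shift IH => //= t1 IH; case: shift IH' => //= u1 IH' [<-] /=.
  by rewrite IH ?IH'.
Qed.

Lemma shifts_None bs : shifts bs None = None.
Proof. by elim: bs. Qed.

Lemma shifts_cat bs bs' o : shifts (bs ++ bs') o = shifts bs' (shifts bs o).
Proof. by elim: bs o => //= p bs IH o. Qed.

(** [s'] is one of the lists met when performing the splittings [bs] on [s]. Its entries
    depend on the chosen decompositions of tensors; all that is retained is that monomials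
    not using the split components keep their value. *)
Definition refines bs s s' := size s' = (size s + size bs)%N /\
  forall t t', shifts bs (Some t) = Some t' -> tmv s' t' = tmv s t.

Lemma refines_trans bs bs' s s' s2 :
  refines bs s s' -> refines bs' s' s2 -> refines (bs ++ bs') s s2.
Proof.
move=> [n1 h1] [n2 h2]; split; first by rewrite n2 n1 size_cat addnA.
move=> t t'; rewrite shifts_cat; case e: (shifts bs (Some t)) => [t1|].
  by move/h2->; exact: h1.
by rewrite shifts_None.
Qed.

Lemma refines_nil s : refines [::] s s.
Proof. by split; rewrite ?addn0 // => t t' [->]. Qed.

Lemma within_cat n bs bs' :
  within n (bs ++ bs') = within n bs && within (n + size bs) bs'.
Proof.
elim: bs n => [|p bs IH] n /=; first by rewrite addn0.
by rewrite IH addSn addnS andbA.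
Qed.

Lemma eq_split_sum W bs s (K K' : seq H -> W) : within (size s) bs ->
  (forall s', refines bs s s' -> K s' = K' s') -> split_sum bs s K = split_sum bs s K'.
Proof.
elim: bs s => [|p bs IH] s /= => [_ h|/andP[ps wn] h].
  by apply: h; exact: refines_nil.
apply: eq_tsum => a b; apply: IH; first by rewrite size_split_at.
move=> s' [n1 h1]; apply: h; split; first by rewrite n1 size_split_at // addSnnS.
move=> t t' /=; case e: (shift p t) => [t1|]; last by rewrite shifts_None.
by move/h1->; exact: shiftP.
Qed.

Lemma split_sum_linear W W' bs s (F : W -> W') (K : seq H -> W) : linear F ->
  F (split_sum bs s K) = split_sum bs s (fun s' => F (K s')).
Proof.
move=> Fl; elim: bs s => //= p bs IH s.
by rewrite (linear_tsum _ _ Fl); apply: eq_tsum.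
Qed.

Lemma split_sum_step W bs bs' s (K K' : seq H -> W) : within (size s) (bs ++ bs') ->
  (forall s', refines bs s s' -> within (size s') bs' -> K s' = split_sum bs' s' K') ->
  split_sum bs s K = split_sum (bs ++ bs') s K'.
Proof.
rewrite within_cat => /andP[w w'] h.
rewrite (eq_split_sum (K' := fun s' => split_sum bs' s' K') w).
  by elim: bs s {w w' h} => //= p bs IH s; apply: eq_tsum => a b.
by move=> s' r; apply: h => //; rewrite r.1.
Qed.

Lemma shift_tmsP bs s s' ts us : refines bs s s' -> shift_tms bs ts = Some us ->
  map (fun t => tmv s' t) us = map (fun t => tmv s t) ts.
Proof.
move=> [_ h]; elim: ts us => [|t ts IH] us /=; first by move=> [<-].
rewrite /shift_tms /=; case e: (shifts bs _) => [t1|] //.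
case e2: (oall _ _) => [us1|] //= [<-] /=.
by rewrite (h _ _ e) (IH us1).
Qed.

Lemma eps_prod_map s el s' el' :
  map (fun t => tmv s t) el = map (fun t => tmv s' t) el' -> eps_prod s el = eps_prod s' el'.
Proof.
by move=> e; rewrite /eps_prod -(big_map (fun t => tmv s t) predT (@eps k H)) e big_map.
Qed.

Lemma split_tmP t bs0 s0 s bs t1 t2 : refines bs0 s0 s ->
  split_tm flip1 flip2 bs0 t = Some (bs, t1, t2) -> within (size s) bs ->
  forall W (f : H -> H -> W), bilinear f ->
  tsum (Delta (tmv s0 t)) f = split_sum bs s (fun s' => f (tmv s' t1) (tmv s' t2)).
Proof.
elim: t bs0 s0 s bs t1 t2 => [l|c|o t IH|o t IH u IH'] bs0 s0 s bs t1 t2 r.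
- rewrite /=; case e: shifts => [[l'|||]|] // [<- <- <-] /= /andP[ls _] W f fb.
  have /= <- := r.2 _ _ e; apply: eq_tsum => a b.
  rewrite !nth_split_at // ltnn eqxx ltnNge leqnSn /= gtn_eqF ?leqnn //.
  by rewrite eqxx.
- move=> /= [<- <- <-] _ W f fb /=; rewrite /cI.
  by case: (nth _ _ c) => c' [/= -> _]; rewrite tsum_pure.
- rewrite /=; have := u_ok (nth (id_unary H) (unaries sg) o).
  rewrite -/(flip1 o) -/(uI sg o); case: (flip1 o) => // f [ok _].
  case e: split_tm => [[[bs1 u1] u2]|] // [<- <- <-] w W g gb.
  rewrite /uI ok -/(uI sg o) tsum_sum_bilinear //.
  have gb' : bilinear (fun a b => g (uI sg o a) (uI sg o b)).
    split=> [b|a].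
      exact: (linear_bil (uI sg o b) gb (uI_linear sg o)).
    exact: (linear_bir (uI sg o a) gb (uI_linear sg o)).
  case: f {ok}.
    have gb2 : bilinear (fun b a => g (uI sg o a) (uI sg o b)).
      by split=> [a|b]; [exact: gb'.2 | exact: gb'.1].
    by rewrite -(IH _ _ _ _ _ _ r e w _ _ gb2); apply: eq_tsum => a b; rewrite tsum_pure.
  by rewrite -(IH _ _ _ _ _ _ r e w _ _ gb'); apply: eq_tsum => a b; rewrite tsum_pure.
- rewrite /=; have := b_ok (nth (zero_binary H) (binaries sg) o).
  rewrite -/(flip2 o) -/(bI sg o); case: (flip2 o) => // -[f g] [ok _].
  case e1: split_tm => [[[bs1 v1] v2]|] //.
  case e2: split_tm => [[[bs2 u1] u2]|] //.
  case e3: shifts => [v1'|] //; case e4: shifts => [v2'|] // [<- <- <-] w W h hb.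
  rewrite /bI ok -/(bI sg o) tsum_sum_bilinear //.
  have hb' y y' : bilinear (fun a b => h (bI sg o a y) (bI sg o b y')).
    split=> [b|a].
      apply: (linear_bil (f := fun a => bI sg o a y) _ hb); exact: (bI_bilinear sg o).1.
    apply: (linear_bir (f := fun a => bI sg o a y') _ hb); exact: (bI_bilinear sg o).1.
  have hb2 x x' : bilinear (fun a b => h (bI sg o x a) (bI sg o x' b)).
    split=> [b|a].
      apply: (linear_bil (f := fun a => bI sg o x a) _ hb); exact: (bI_bilinear sg o).2.
    apply: (linear_bir (f := fun a => bI sg o x' a) _ hb); exact: (bI_bilinear sg o).2.
  pose F x1 x2 y1 y2 := h (bI sg o (if f then x2 else x1) (if g then y2 else y1))
     (bI sg o (if f then x1 else x2) (if g then y1 else y2)).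
  have Fb x1 x2 : bilinear (F x1 x2).
    rewrite /F; case: (g); last exact: hb2.
    by split=> [a|b]; [exact: (hb2 _ _).2 | exact: (hb2 _ _).1].
  have Fb' y1 y2 : bilinear (fun x1 x2 => F x1 x2 y1 y2).
    rewrite /F; case: (f); last exact: hb'.
    by split=> [a|b]; [exact: (hb' _ _).2 | exact: (hb' _ _).1].
  transitivity (\tsum_(x1, x2 <- Delta (tmv s0 t)) tsum (Delta (tmv s0 u)) (F x1 x2)).
    apply: eq_tsum => x1 x2; rewrite tsum_sum_bilinear //.
    by apply: eq_tsum => y1 y2; rewrite tsum_pure.
  rewrite (IH _ _ _ _ _ _ r e1 _ _ (fun x1 x2 => tsum (Delta (tmv s0 u)) (F x1 x2))).
  + apply: split_sum_step => // s' r' w'.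
    rewrite (IH' _ _ _ _ _ _ (refines_trans r r') e2 w' _ _ (Fb _ _)).
    apply: eq_split_sum => // s2 r2.
    by rewrite -(r2.2 _ _ e3) -(r2.2 _ _ e4) /F; case: (f); case: (g).
  + by move: w; rewrite within_cat => /andP[].
  + by split=> [b|a]; apply: tsum_linearP => y1 y2; [exact: (Fb' _ _).1 | exact: (Fb' _ _).2].
Qed.

Definition agree s vs (ts : senv) := size vs = size ts /\
  forall i t, nth None ts i = Some t -> nth 0 vs i = tmv s t.

Lemma agree_shift bs s s' vs ts :
  refines bs s s' -> agree s vs ts -> agree s' vs (shiftenv bs ts).
Proof.
move=> [_ h] [n1 a]; split; first by rewrite size_map.
move=> i t; case: (ltnP i (size ts)) => it; last by rewrite nth_default ?size_map.
rewrite (nth_map None) //; case e: (nth None ts i) => [t0|]; last by rewrite shifts_None.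
by move=> e'; rewrite (h _ _ e'); exact: a.
Qed.

Lemma agree_rcons s vs ts t :
  agree s vs ts -> agree s (rcons vs (tmv s t)) (rcons ts (Some t)).
Proof.
move=> [n1 a]; split; first by rewrite !size_rcons n1.
move=> i t'; rewrite !nth_rcons n1; case: ltnP => _; first exact: a.
by case: eqP => // _ [->].
Qed.

Lemma eps_prod_cat s el el' : eps_prod s (el ++ el') = eps_prod s el * eps_prod s el'.
Proof. exact: big_cat. Qed.

Lemma shift_tms_consP bs s s' t ts u us : refines bs s s' ->
  shift_tms bs (t :: ts) = Some (u :: us) ->
  tmv s' u = tmv s t /\ eps_prod s' us = eps_prod s ts.
Proof. by move=> r /(shift_tmsP r) /= [-> /eps_prod_map]. Qed.

(** Evaluation is correct under every linear continuation [K], which stands for the part of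
    the expression around the subexpression being evaluated. *)
Lemma run_sound :
  (forall e ts s vs bs el t, agree s vs ts ->
    runE flip1 flip2 ts e = Some (bs, el, t) -> within (size s) bs ->
    forall W (K : H -> W), linear K ->
    K (exI sg vs e) = split_sum bs s (fun s' => eps_prod s' el *: K (tmv s' t))) /\
  (forall e ts s vs bs el t1 t2, agree s vs ts ->
    runT flip1 flip2 ts e = Some (bs, el, t1, t2) -> within (size s) bs ->
    forall W (K : H -> H -> W), bilinear K ->
    tsum (txI sg vs e) K =
      split_sum bs s (fun s' => eps_prod s' el *: K (tmv s' t1) (tmv s' t2))).
Proof.
apply: ex_tx_ind => /=.
- move=> i ts s vs bs el t [_ ag]; case e: nth => [t'|] // [<- <- <-] _ W K Kl /=.
  by rewrite /eps_prod big_nil scale1r (ag _ _ e).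
- move=> c ts s vs bs el t ag [<- <- <-] _ W K Kl /=.
  by rewrite /eps_prod big_nil scale1r.
- move=> o e IH ts s vs bs el t ag; case E: runE => [[[bs1 el1] t1]|] // [<- <- <-] w W K Kl.
  by rewrite (IH _ _ _ _ _ _ ag E w _ (fun x => K (uI sg o x))) //; exact/linear_comp/uI_linear.
- move=> o e IH e' IH' ts s vs bs el t ag.
  case E: runE => [[[bs1 el1] t1]|] //; case E': runE => [[[bs2 el2] t2]|] //.
  case S: shift_tms => [[|u el3]|] // [<- <- <-] w W K Kl.
  have Kb := bI_bilinear sg o.
  rewrite (IH _ _ _ _ _ _ ag E _ _ (fun x => K (bI sg o x (exI sg vs e')))).
  + apply: split_sum_step => // s' r w'.
    rewrite (IH' _ _ _ _ _ _ (agree_shift r ag) E' w' _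
      (fun y => eps_prod s' el1 *: K (bI sg o (tmv s' t1) y))); last first.
      by apply/linear_scale'/(linear_comp Kl)/Kb.2.
    apply: eq_split_sum => // s2 r2; have [<- <-] := shift_tms_consP r2 S.
    by rewrite eps_prod_cat scalerA mulrC.
  + by move: w; rewrite within_cat => /andP[].
  + exact/(linear_comp Kl)/Kb.1.
- move=> t IH e IH' ts s vs bs el u ag; case: ifP => // /andP[l1 l2].
  case E: runT => [[[[bs1 el1] t1] t2]|] //; case E': runE => [[[bs2 el2] t3]|] //.
  case S: shift_tms => [el3|] // [<- <- <-] w W K Kl.
  have sz := ag.1.
  have Kb : bilinear (fun a b => K (exI sg (rcons (rcons vs a) b) e)).
    apply: (lin_spec_bil (F := fun v => K (exI sg v e)) sz).
      by move=> v1 v2 h h'; apply: (linear_comp Kl); exact: (lin_sound sg).1 l1 v1 v2 h h'.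
    by move=> v1 v2 h h'; apply: (linear_comp Kl); exact: (lin_sound sg).1 l2 v1 v2 h h'.
  rewrite (linear_tsum _ _ Kl) (IH _ _ _ _ _ _ _ ag E _ _ _ Kb).
    apply: split_sum_step => // s' r w'.
    rewrite (IH' _ _ _ _ _ _ (agree_rcons _ (agree_rcons _ (agree_shift r ag))) E' w' _
      (fun y => eps_prod s' el1 *: K y)); last exact: linear_scale'.
    apply: eq_split_sum => // s2 r2; rewrite eps_prod_cat (eps_prod_map (shift_tmsP r2 S)).
    by rewrite scalerA mulrC.
  by move: w; rewrite within_cat => /andP[].
- move=> e IH e' IH' ts s vs bs el t ag.
  case E: runE => [[[bs1 el1] t1]|] //; case E': runE => [[[bs2 el2] t2]|] //.
  case S: shift_tms => [el3|] // [<- <- <-] w W K Kl.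
  rewrite (linearZ' Kl) (IH _ _ _ _ _ _ ag E _ _ (fun x => eps x *: K (exI sg vs e'))).
  + apply: split_sum_step => // s' r w'.
    rewrite (IH' _ _ _ _ _ _ (agree_shift r ag) E' w' _
      (fun y => eps_prod s' el1 *: (eps (tmv s' t1) *: K y))); last first.
      exact/linear_scale'/linear_scale'.
    apply: eq_split_sum => // s2 r2; rewrite eps_prod_cat (eps_prod_map (shift_tmsP r2 S)).
    rewrite [eps_prod s' (_ :: _)]big_cons !scalerA -/(eps_prod s' el1).
    by congr (_ *: _); rewrite mulrC [eps_prod _ _ * eps_prod _ _]mulrC mulrA.
  + by move: w; rewrite within_cat => /andP[].
  + by apply: linear_scaler; exact: eps_scalar.
- move=> e IH ts s vs bs el t1 t2 ag; case E: runE => [[[bs1 el1] t]|] //.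
  case D: split_tm => [[[bs2 u1] u2]|] //; case S: shift_tms => [el2|] // [<- <- <- <-] w W K Kb.
  rewrite (IH _ _ _ _ _ _ ag E _ _ (fun x => tsum (Delta x) K)).
  + apply: split_sum_step => // s' r w'.
    rewrite (split_tmP (refines_nil s') D w' Kb).
    rewrite (split_sum_linear _ _ _ (linear_scale' _ (@linear_id' _ _))).
    by apply: eq_split_sum => // s2 r2; rewrite (eps_prod_map (shift_tmsP r2 S)).
  + by move: w; rewrite within_cat => /andP[].
  + exact: tsum_Delta_linear.
- move=> e IH e' IH' ts s vs bs el u1 u2 ag.
  case E: runE => [[[bs1 el1] t1]|] //; case E': runE => [[[bs2 el2] t2]|] //.
  case S: shift_tms => [[|u el3]|] // [<- <- <- <-] w W K Kb.
  rewrite tsum_pure // (IH _ _ _ _ _ _ ag E _ _ (fun x => K x (exI sg vs e'))).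
  + apply: split_sum_step => // s' r w'.
    rewrite (IH' _ _ _ _ _ _ (agree_shift r ag) E' w' _
      (fun y => eps_prod s' el1 *: K (tmv s' t1) y)); last by apply/linear_scale'/Kb.2.
    apply: eq_split_sum => // s2 r2; have [<- <-] := shift_tms_consP r2 S.
    by rewrite eps_prod_cat scalerA mulrC.
  + by move: w; rewrite within_cat => /andP[].
  + exact: Kb.1.
- move=> t IH e IH' ts s vs bs el u u' ag; case: ifP => // /andP[l1 l2].
  case E: runT => [[[[bs1 el1] t1] t2]|] //; case E': runT => [[[[bs2 el2] t3] t4]|] //.
  case S: shift_tms => [el3|] // [<- <- <- <-] w W K Kb.
  have sz := ag.1; have tl := tsum_linear Kb.
  rewrite tsum_sum_bilinear //.
  have Kb' : bilinear (fun a b => tsum (txI sg (rcons (rcons vs a) b) e) K).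
    apply: (lin_spec_bil (F := fun v => tsum (txI sg v e) K) sz).
      by move=> v1 v2 h h'; apply: (linear_comp tl); exact: (lin_sound sg).2 l1 v1 v2 h h'.
    by move=> v1 v2 h h'; apply: (linear_comp tl); exact: (lin_sound sg).2 l2 v1 v2 h h'.
  rewrite (IH _ _ _ _ _ _ _ ag E _ _ _ Kb').
    apply: split_sum_step => // s' r w'.
    have Kb2 : bilinear (fun a b => eps_prod s' el1 *: K a b).
      by split=> [b|a]; apply: linear_scale'; case: Kb.
    rewrite (linear_tsum _ _ (linear_scale' _ (@linear_id' _ _))).
    rewrite (IH' _ _ _ _ _ _ _ (agree_rcons _ (agree_rcons _ (agree_shift r ag))) E' w' _ _ Kb2).
    apply: eq_split_sum => // s2 r2; rewrite eps_prod_cat (eps_prod_map (shift_tmsP r2 S)).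
    by rewrite scalerA mulrC.
  by move: w; rewrite within_cat => /andP[].
- move=> e IH e' IH' ts s vs bs el u1 u2 ag.
  case E: runE => [[[bs1 el1] t1]|] //; case E': runT => [[[[bs2 el2] t2] t3]|] //.
  case S: shift_tms => [el3|] // [<- <- <- <-] w W K Kb.
  rewrite (linearZ' (tsum_linear Kb)).
  rewrite (IH _ _ _ _ _ _ ag E _ _ (fun x => eps x *: tsum (txI sg vs e') K)).
  + apply: split_sum_step => // s' r w'.
    have Kb2 : bilinear (fun a b => eps_prod s' el1 *: (eps (tmv s' t1) *: K a b)).
      by split=> [b|a]; apply: linear_scale'; apply: linear_scale'; case: Kb.
    rewrite !(linear_tsum _ _ (linear_scale' _ (@linear_id' _ _))).
    rewrite (IH' _ _ _ _ _ _ _ (agree_shift r ag) E' w' _ _ Kb2).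
    apply: eq_split_sum => // s2 r2; rewrite eps_prod_cat (eps_prod_map (shift_tmsP r2 S)).
    rewrite [eps_prod s' (_ :: _)]big_cons !scalerA -/(eps_prod s' el1).
    by congr (_ *: _); rewrite mulrC [eps_prod _ _ * eps_prod _ _]mulrC mulrA.
  + by move: w; rewrite within_cat => /andP[].
  + by apply: linear_scaler; exact: eps_scalar.
Qed.

End Soundness.

(** * Proving Sweedler identities by normalisation *)

Section Theory.
Variables (k : fieldType) (H : hopfAlg k).
Implicit Types (W : lmodType k) (s vs xs : seq H) (t u : tm) (bs ns : seq nat).

Record rule (sg : signature H) := Rule {
  r_lhs : tm; r_rhs : tm; r_ok : forall v, tmI sg v r_lhs = tmI sg v r_rhs }.

Record theory := Theory { th_sig :> signature H; th_rules : seq (rule th_sig) }.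

Section WithSignature.
Variable sg : signature H.
Local Notation tmv s t := (tmI sg (fun i => nth 0 s i) t).
Local Notation flip1 := (flip1 sg).
Local Notation flip2 := (flip2 sg).

Lemma runEs_sound es ts s vs bs el us W (phi : seq H -> W) : agree sg s vs ts ->
  runEs flip1 flip2 ts es = Some (bs, el, us) -> within (size s) bs ->
  multilinear (size es) phi ->
  phi (map (exI sg vs) es) =
    split_sum bs s (fun s' => eps_prod sg s' el *: phi (map (fun t => tmv s' t) us)).
Proof.
elim: es ts s bs el us phi => [|e es IH] ts s bs el us phi ag /=.
  by move=> [<- <- <-] _ _ /=; rewrite /eps_prod big_nil scale1r.
case E: runE => [[[bs1 el1] t1]|] //; case E': runEs => [[[bs2 el2] us2]|] //.
case S: shift_tms => [[|u el3]|] // [<- <- <-] w fl.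
rewrite ((run_sound sg).1 _ _ _ _ _ _ _ ag E _ _ (fun x => phi (x :: map (exI sg vs) es))).
- apply: (@split_sum_step _ _ sg) => // s' r w'.
  have fl' : multilinear (size es) (fun l => eps_prod sg s' el1 *: phi (tmv s' t1 :: l)).
    by move=> s1 s2 n1; apply: linear_scale'; exact: (multilinear_cons _ fl) n1.
  rewrite (IH _ _ _ _ _ _ (agree_shift r ag) E' w' fl').
  apply: (@eq_split_sum _ _ sg) => // s2 r2; have [<- <-] := shift_tms_consP r2 S.
  by rewrite eps_prod_cat scalerA mulrC.
- by move: w; rewrite within_cat => /andP[].
- by apply: (multilinear_head fl); rewrite size_map.
Qed.

Fixpoint arity (r : oexpr) : nat :=
  match r with RR es => size es | RB _ r => arity r | RS _ r => arity r end.

Lemma runEs_size ts es bs el us :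
  runEs flip1 flip2 ts es = Some (bs, el, us) -> size us = size es.
Proof.
elim: es ts bs el us => [|e es IH] ts bs el us /=; first by move=> [_ _ <-].
case E: runE => [[[bs1 el1] t1]|] //; case E': runEs => [[[bs2 el2] us2]|] //.
by case S: shift_tms => [[|u el3]|] // [_ _ <-] /=; rewrite (IH _ _ _ _ E').
Qed.

Lemma runR_size ts r bs el us :
  runR flip1 flip2 ts r = Some (bs, el, us) -> size us = arity r.
Proof.
elim: r ts bs el us => [es|t r IH|e r IH] ts bs el us /=; first exact: runEs_size.
- case: ifP => // _; case: runT => [[[[bs1 el1] t1] t2]|] //.
  case E: runR => [[[bs2 el2] us2]|] //; case: shift_tms => [el3|] // [_ _ <-].
  exact: IH E.
- case: runE => [[[bs1 el1] t1]|] //.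
  case E: runR => [[[bs2 el2] us2]|] //; case: shift_tms => [el3|] // [_ _ <-].
  exact: IH E.
Qed.

Lemma freshEs_sound i es : all (freshE i) es -> forall v1 v2 x y, size v1 = i ->
  map (exI sg (v1 ++ x :: v2)) es = map (exI sg (v1 ++ y :: v2)) es.
Proof.
elim: es => //= e es IH /andP[/(fresh_sound sg i).1 fe /IH h] v1 v2 x y si.
by rewrite (fe _ _ _ y) // (h _ _ _ y).
Qed.

Lemma freshR_sound W (phi : seq H -> W) i r : freshR i r -> forall v1 v2 x y, size v1 = i ->
  rxI sg phi (v1 ++ x :: v2) r = rxI sg phi (v1 ++ y :: v2) r.
Proof.
elim: r => [es|t r IH|e r IH] /=.
- by move=> /freshEs_sound h v1 v2 x y si; rewrite (h _ _ _ y).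
- move=> /andP[/(fresh_sound sg i).2 ft /IH h] v1 v2 x y si; rewrite (ft _ _ _ y) //.
  by apply: eq_tsum => a b; rewrite !rcons2_cat; exact: h.
- move=> /andP[/(fresh_sound sg i).1 fe /IH h] v1 v2 x y si.
  by rewrite (fe _ _ _ y) // (h _ _ _ y).
Qed.

Lemma linEs_sound W (phi : seq H -> W) m i es : multilinear (size es) phi ->
  linEs m i es -> lin_spec (fun vs => phi (map (exI sg vs) es)) m i.
Proof.
elim: es phi => //= e es IH phi fl /orP[]/andP[h h'] v1 v2 si sm.
  apply: (eq_linear (f := fun x => phi (exI sg (v1 ++ x :: v2) e
      :: map (exI sg (v1 ++ 0 :: v2)) es))) => [x|].
    by rewrite (freshEs_sound h' _ 0 x).
  apply: (linear_comp (f := fun y => phi (y :: _))).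
    by apply: (multilinear_head fl); rewrite size_map.
  exact: (lin_sound sg).1 h _ _ si sm.
apply: (eq_linear (f := fun x => phi (exI sg (v1 ++ 0 :: v2) e
      :: map (exI sg (v1 ++ x :: v2)) es))) => [x|].
  by rewrite ((fresh_sound sg i).1 _ h _ _ 0 x).
exact: IH (multilinear_cons _ fl) h' _ _ si sm.
Qed.

Lemma linR_sound W (phi : seq H -> W) r m i : multilinear (arity r) phi ->
  linR m i r -> lin_spec (rxI sg phi ^~ r) m i.
Proof.
elim: r m i => [es|t r IH|e r IH] m i /= fl; first exact: linEs_sound.
- case/orP=> [/and4P[h h1 h2 h3]|/andP[h h']].
    exact: (lin_spec_bind ((lin_sound sg).2 _ _ _ h) (freshR_sound _ h1) (IH _ _ fl h2) (IH _ _ fl h3)).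
  exact: (lin_spec_bind' ((fresh_sound sg i).2 _ h) (IH _ _ fl h')).
- case/orP=> /andP[h h'].
    exact: (lin_spec2 (scale_eps_bilinear _ _) ((lin_sound sg).1 _ _ _ h) (freshR_sound _ h')).
  exact: (lin_spec2' (scale_eps_bilinear _ _) ((fresh_sound sg i).1 _ h) (IH _ _ fl h')).
Qed.

Lemma runR_sound r ts s vs bs el us W (phi : seq H -> W) : agree sg s vs ts ->
  runR flip1 flip2 ts r = Some (bs, el, us) -> within (size s) bs ->
  multilinear (arity r) phi ->
  rxI sg phi vs r =
    split_sum bs s (fun s' => eps_prod sg s' el *: phi (map (fun t => tmv s' t) us)).
Proof.
elim: r ts s vs bs el us => [es|t r IH|e r IH] ts s vs bs el us ag /=.
- exact: runEs_sound.
- case: ifP => // /andP[l1 l2].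
  case E: runT => [[[[bs1 el1] t1] t2]|] //; case E': runR => [[[bs2 el2] us2]|] //.
  case S: shift_tms => [el3|] // [<- <- <-] w fl; have sz := ag.1.
  have Kb : bilinear (fun a b => rxI sg phi (rcons (rcons vs a) b) r).
    exact: (lin_spec_bil (F := fun v => rxI sg phi v r) sz (linR_sound fl l1) (linR_sound fl l2)).
  rewrite ((run_sound sg).2 _ _ _ _ _ _ _ _ ag E _ _ _ Kb).
    apply: (@split_sum_step _ _ sg) => // s' r' w'.
    rewrite (IH _ _ _ _ _ _ (agree_rcons _ (agree_rcons _ (agree_shift r' ag))) E' w' fl).
    rewrite (split_sum_linear _ _ _ (linear_scale' _ (@linear_id' _ _))).
    apply: (@eq_split_sum _ _ sg) => // s2 r2; rewrite eps_prod_cat (eps_prod_map (shift_tmsP r2 S)).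
    by rewrite scalerA.
  by move: w; rewrite within_cat => /andP[].
- case E: runE => [[[bs1 el1] t1]|] //; case E': runR => [[[bs2 el2] us2]|] //.
  case S: shift_tms => [el3|] // [<- <- <-] w fl.
  rewrite ((run_sound sg).1 _ _ _ _ _ _ _ ag E _ _ (fun x => eps x *: rxI sg phi vs r)).
  + apply: (@split_sum_step _ _ sg) => // s' r' w'.
    rewrite (IH _ _ _ _ _ _ (agree_shift r' ag) E' w' fl) scalerA.
    rewrite (split_sum_linear _ _ _ (linear_scale' _ (@linear_id' _ _))).
    apply: (@eq_split_sum _ _ sg) => // s2 r2; rewrite eps_prod_cat (eps_prod_map (shift_tmsP r2 S)).
    by rewrite [eps_prod _ _ (_ :: _)]big_cons scalerA [_ * eps _]mulrC.
  + by move: w; rewrite within_cat => /andP[].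
  + by apply: linear_scaler; exact: eps_scalar.
Qed.

Lemma split_sum_multilinear W bs n (K : seq H -> W) : within n bs ->
  multilinear (n + size bs) K -> multilinear n (fun s => split_sum bs s K).
Proof.
elim: bs n => [|p bs IH] n /=; first by rewrite addn0 => _.
move=> /andP[pn w]; rewrite addnS -addSn => /(IH _ w) fl s1 s2 e.
case: (ltngtP p (size s1)) => ps.
- apply: (eq_linear (f := fun x => \tsum_(a, b <- Delta (nth 0 s1 p))
      split_sum bs (split_at p a b s1 ++ x :: s2) K)) => [x|].
    by rewrite nth_cat ps; apply: eq_tsum => a b; rewrite split_at_catl.
  by apply: tsum_linearP => a b; apply: fl; rewrite size_split_at // addSn e.
- have ps' := ltnW ps; have [d dE] : exists d, (p - size s1)%N = d.+1.
    by move: ps; rewrite -subn_gt0; case: (p - _)%N => // d _; exists d.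
  apply: (eq_linear (f := fun x => \tsum_(a, b <- Delta (nth 0 s2 d))
      split_sum bs (s1 ++ x :: split_at d a b s2) K)) => [x|].
    rewrite nth_cat ltnNge ps' /= dE; apply: eq_tsum => a b.
    by rewrite split_at_catr // dE.
  apply: tsum_linearP => a b; apply: fl; rewrite size_split_at ?addnS ?e //.
  by rewrite -(ltn_add2l (size s1)) -ltnS -addnS -dE subnKC // e.
- rewrite ps; apply: (eq_linear (f := fun x => \tsum_(a, b <- Delta x)
      split_sum bs (s1 ++ a :: b :: s2) K)) => [x|].
    rewrite nth_cat ltnn subnn /=; apply: eq_tsum => a b.
    by rewrite split_at_catr // subnn /split_at /= drop0.
  apply: tsum_Delta_linear; split=> [b|a]; first by apply: fl; rewrite /= addnS e.
  apply: (eq_linear (f := fun b => split_sum bs (rcons s1 a ++ b :: s2) K)) => [b|].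
    by rewrite cat_rcons.
  by apply: fl; rewrite size_rcons addSn e.
Qed.

(** By coassociativity a sequence of splittings only matters through the resulting numbers
    of components. *)
Lemma wsum_split_sum W bs ns xs (K : seq H -> W) : size ns = size xs ->
  within (sumn ns) bs -> multilinear (sumn ns + size bs) K ->
  wsum ns xs (fun s => split_sum bs s K) = wsum (foldl word_split ns bs) xs K.
Proof.
elim: bs ns => //= p bs IH ns sn /andP[pn w] fl; rewrite addnS -addSn in fl.
rewrite (wsum_split (f := fun s => split_sum bs s K)) //; last exact: split_sum_multilinear.
by apply: IH; rewrite ?size_word_split ?sumn_word_split.
Qed.

Lemma foldl_word_split bs ns : within (sumn ns) bs ->
  sumn (foldl word_split ns bs) = (sumn ns + size bs)%N /\
  size (foldl word_split ns bs) = size ns.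
Proof.
elim: bs ns => [|p bs IH] ns /=; first by rewrite addn0.
move=> /andP[pn w]; have [|-> ->] := IH (word_split ns p).
  by rewrite sumn_word_split.
by rewrite sumn_word_split // size_word_split addSnnS.
Qed.

Lemma tmI_fresh i t (v1 v2 : seq H) x y : i \notin leaves t -> size v1 = i ->
  tmv (v1 ++ x :: v2) t = tmv (v1 ++ y :: v2) t.
Proof.
move=> + si; elim: t => [j|c|o t IH|o t IH u IH'] //=.
- rewrite inE !nth_cat si => ij; case: ltnP => // le.
  case d: (j - i)%N => [|//]; case/eqP: ij; apply/eqP.
  by rewrite eqn_leq le -subn_eq0 d.
- by move/IH->.
- by rewrite mem_cat negb_or => /andP[/IH-> /IH'->].
Qed.

Lemma tmsI_fresh i us (v1 v2 : seq H) x y :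
  count_mem i (flatten (map leaves us)) = 0%N -> size v1 = i ->
  map (fun t => tmv (v1 ++ x :: v2) t) us = map (fun t => tmv (v1 ++ y :: v2) t) us.
Proof.
move=> + si; elim: us => //= t us IH /eqP; rewrite count_cat addn_eq0.
move=> /andP[/eqP c0 /eqP/IH->]; congr (_ :: _); apply: tmI_fresh si.
by rewrite -has_pred1 has_count c0.
Qed.

Lemma tmI_linear i t (v1 v2 : seq H) : count_mem i (leaves t) = 1%N -> size v1 = i ->
  linear (fun x => tmv (v1 ++ x :: v2) t).
Proof.
move=> + si; elim: t => [j|c|o t IH|o t IH u IH'] //=.
- rewrite addn0; case: eqP => // -> _ a x y.
  by rewrite !nth_cat si ltnn subnn.
- by move/IH; exact/linear_comp/uI_linear.
- rewrite count_cat => c1.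
  have [c0|c0] : count_mem i (leaves u) = 0%N \/ count_mem i (leaves t) = 0%N.
    move: c1; case: (count_mem i (leaves u)) => [|n]; first by left.
    by rewrite addnS; case: (count_mem i (leaves t)) => [|//]; right.
  + rewrite c0 addn0 in c1.
    apply: eq_linear (linear_bil (tmv (v1 ++ 0 :: v2) u) (bI_bilinear sg o) (IH c1)) => x /=.
    congr (bI sg o _ _); apply: tmI_fresh si.
    by rewrite -has_pred1 has_count c0.
  + rewrite c0 add0n in c1.
    apply: eq_linear (linear_bir (tmv (v1 ++ 0 :: v2) t) (bI_bilinear sg o) (IH' c1)) => x /=.
    congr (bI sg o _ _); apply: tmI_fresh si.
    by rewrite -has_pred1 has_count c0.
Qed.

Lemma once_multilinear W n us (phi : seq H -> W) : once n us ->
  multilinear (size us) phi ->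
  multilinear n (fun s => phi (map (fun t => tmv s t) us)).
Proof.
move=> /allP on fl s1 s2 e; set i := size s1.
have {on} /eqP : count_mem i (flatten (map leaves us)) == 1%N.
  by apply: on; rewrite mem_iota add0n /= -e ltnS leq_addr.
elim: us phi fl => [|t us IH] phi //= fl; rewrite count_cat.
case c1: (count_mem i (leaves t)) => [|[|//]].
  rewrite add0n => c2.
  apply: eq_linear (IH (fun l => phi (tmv (s1 ++ 0 :: s2) t :: l)) (multilinear_cons _ fl) c2) => x /=.
  by congr (phi (_ :: _)); apply: (@tmI_fresh i) => //; rewrite -has_pred1 has_count c1.
move=> [c2].
apply: (eq_linear (f := fun x => phi (tmv (s1 ++ x :: s2) t
   :: map (fun t => tmv (s1 ++ 0 :: s2) t) us))) => [x|].
  by rewrite (tmsI_fresh s2 0 x c2).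
apply: (linear_comp (f := fun y => phi (y :: _))).
  by apply: (multilinear_head fl); rewrite size_map.
exact: (@tmI_linear i).
Qed.

Fixpoint counit_prefix W (phi : seq H -> W) m (l : seq H) : W :=
  if m is m'.+1 then eps (head 0 l) *: counit_prefix phi m' (behead l) else phi l.

Lemma counit_prefix_multilinear W (phi : seq H -> W) m n :
  multilinear n phi -> multilinear (m + n) (counit_prefix phi m).
Proof.
move=> fl; elim: m => //= m IH [|y s1] s2 e /=.
  by apply: linear_scaler; exact: eps_scalar.
by apply: linear_scale'; apply: IH; case: e.
Qed.

Lemma unshiftP q t t' s : (q < size s)%N -> unshift q t = Some t' ->
  tmv (del_at q s) t' = tmv s t.
Proof.
move=> qs; elim: t t' => [r|c|o t IH|o t IH u IH'] t' /=.
- case: eqP => // /eqP rq [<-] /=; rewrite nth_cat size_takel ?(ltnW qs) //.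
  case: (ltngtP r q) => [h|h|h]; first by rewrite h nth_take.
    have -> : (r.-1 < q)%N = false by rewrite ltnNge -ltnS prednK // (leq_ltn_trans _ h).
    rewrite nth_drop; congr nth; rewrite addSn -addnS -subSn; last first.
      by rewrite -ltnS prednK // (leq_ltn_trans _ h).
    by rewrite prednK ?(leq_ltn_trans _ h) // subnKC // ltnW.
  by rewrite h eqxx in rq.
- by move=> [<-].
- by case: unshift IH => //= t1 IH [<-] /=; rewrite IH.
- case: unshift IH => //= t1 IH; case: unshift IH' => //= u1 IH' [<-] /=.
  by rewrite IH ?IH'.
Qed.

Lemma oall_unshiftP q ts ts' s : (q < size s)%N -> oall (unshift q) ts = Some ts' ->
  map (fun t => tmv (del_at q s) t) ts' = map (fun t => tmv s t) ts.
Proof.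
move=> qs; elim: ts ts' => [|t ts IH] ts' /=; first by move=> [<-].
case E: unshift => [t1|] //; case E': oall => [us|] //= [<-] /=.
by rewrite (unshiftP qs E) (IH us).
Qed.

Lemma size_oall (T U : Type) (f : T -> option U) (l : seq T) l' :
  oall f l = Some l' -> size l' = size l.
Proof.
elim: l l' => [|x l IH] l' /=; first by move=> [<-].
by case: (f x) => // y; case E: oall => [l1|] //= [<-] /=; rewrite (IH _ E).
Qed.

Lemma drop_epsP W (phi : seq H -> W) m j ns us ns' us' xs :
  drop_eps m ns us = Some (ns', us') -> size ns = size xs ->
  multilinear j phi -> size us = (m + j)%N ->
  wsum ns xs (fun s => counit_prefix phi m (map (fun t => tmv s t) us)) =
  wsum ns' xs (fun s => phi (map (fun t => tmv s t) us')).
Proof.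
elim: m ns us => [|m IH] ns us /=; case: ifP => // on.
  by move=> [<- <-].
case: us on => [|[q|||] us] // on; case: ifP => // qn.
case U: oall => [us2|] // D sn fl [su].
rewrite -(IH _ _ D) //; last 2 first.
- by rewrite size_word_del.
- by rewrite (size_oall U).
rewrite -wsum_counit //.
  by apply: eq_wsum => // s ss /=; rewrite (oall_unshiftP _ U) // ss.
rewrite -(sumn_word_del qn); apply: (once_multilinear (phi := counit_prefix phi m)).
  by move: D; rewrite /drop_eps; case: (m) => [|n] /=; case: ifP.
by rewrite (size_oall U) su; exact: counit_prefix_multilinear.
Qed.

Lemma eps_leavesP t l s : eps_leaves flip1 flip2 t = Some l ->
  eps (tmv s t) = \prod_(i <- l) eps (nth 0 s i).
Proof.
elim: t l => [i|c|o t IH|o t IH u IH'] l /=.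
- by move=> [<-]; rewrite big_seq1.
- by move=> [<-]; rewrite big_nil /cI; case: nth => c' [].
- have := u_ok (nth (id_unary H) (unaries sg) o).
  rewrite -/(flip1 o) -/(uI sg o); case: (flip1 o) => // f [_ ok] /IH <-.
  exact: ok.
- have := b_ok (nth (zero_binary H) (binaries sg) o).
  rewrite -/(flip2 o) -/(bI sg o); case: (flip2 o) => // -[f g] [_ ok].
  case: eps_leaves IH => // l1 /(_ _ erefl) e1; case: eps_leaves IH' => //= l2 /(_ _ erefl) e2.
  by move=> [<-]; rewrite big_cat -e1 -e2; exact: ok.
Qed.

Lemma counit_prefixE W (phi : seq H -> W) (ls : seq nat) (l : seq H) s :
  counit_prefix phi (size (map Lf ls)) (map (fun t => tmv s t) (map Lf ls) ++ l) =
  (\prod_(i <- ls) eps (nth 0 s i)) *: phi l.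
Proof.
elim: ls => [|i ls IH] /=; first by rewrite big_nil scale1r.
by rewrite IH big_cons scalerA.
Qed.

Lemma normaliseP r n m bs el us ns' us' W (phi : seq H -> W) xs :
  size xs = n -> multilinear m phi ->
  runR flip1 flip2 (map (fun i => Some (Lf i)) (iota 0 n)) r = Some (bs, el, us) ->
  within n bs && (size us == m) ->
  forall els, oall (eps_leaves flip1 flip2) el = Some els ->
  drop_eps (size (map Lf (flatten els))) (foldl word_split (nseq n 1%N) bs)
    (map Lf (flatten els) ++ us) = Some (ns', us') ->
  rxI sg phi xs r = wsum ns' xs (fun s => phi (map (fun t => tmv s t) us')).
Proof.
move=> sn fl R /andP[w /eqP su] els E D.
have ar := runR_size R; rewrite su in ar.
have ag : agree sg xs xs (map (fun i => Some (Lf i)) (iota 0 n)).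
  split; first by rewrite size_map size_iota.
  move=> i t; case: (ltnP i n) => h; last by rewrite nth_default // size_map size_iota.
  by rewrite (nth_map 0%N) ?size_iota // nth_iota // add0n => -[<-].
rewrite (runR_sound (phi := phi) ag R) ?sn //; last by rewrite -ar.
have sm : sumn (nseq n 1%N) = n by rewrite sumn_nseq mul1n.
have [sw zw] := foldl_word_split (bs := bs) (ns := nseq n 1%N) ltac:(by rewrite sm).
have e s : counit_prefix phi (size (map Lf (flatten els))) (map (fun t => tmv s t) (map Lf (flatten els) ++ us))
   = eps_prod sg s el *: phi (map (fun t => tmv s t) us).
  rewrite map_cat counit_prefixE; congr (_ *: _); rewrite /eps_prod.
  elim: el els E {R D} => [|t el IH] els /=; first by move=> [<-]; rewrite !big_nil.
  case: (eps_leaves _ _ t) (@eps_leavesP t) => // l /(_ _ s erefl) et.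
  by case O: oall => [l'|] //= [<-] /=; rewrite big_cat big_cons et (IH _ O).
rewrite -(drop_epsP D _ fl); last 2 first.
- by rewrite zw size_nseq.
- by rewrite size_cat su.
have <- : (fun s => eps_prod sg s el *: phi (map (fun t => tmv s t) us)) =
    (fun s => counit_prefix phi (size (map Lf (flatten els))) (map (fun t => tmv s t) (map Lf (flatten els) ++ us))).
  by apply: funext => s; rewrite e.
have ml : multilinear (n + size bs) (fun s => eps_prod sg s el *: phi (map (fun t => tmv s t) us)).
  move=> s1 s2 es; apply: (eq_linear (f := fun x => counit_prefix phi (size (map Lf (flatten els)))
    (map (fun t => tmv (s1 ++ x :: s2) t) (map Lf (flatten els) ++ us)))) => [x|].
    by rewrite e.
  apply: (once_multilinear (phi := counit_prefix phi (size (map Lf (flatten els)))) _ _ es).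
    have <- : sumn (foldl word_split (nseq n 1%N) bs) = (n + size bs)%N by rewrite sw sm.
    move: D; rewrite /drop_eps.
    by case: (size (map Lf _)) => [|j] /=; case: ifP.
  by rewrite size_cat su; exact: counit_prefix_multilinear.
rewrite -wsum_split_sum ?sm ?size_nseq //; rewrite -sn wsum_nseq1 //.
by apply: split_sum_multilinear; rewrite sn.
Qed.

End WithSignature.

Variable th : theory.

Definition rule_pairs : seq (tm * tm) :=
  [seq (r_lhs r, r_rhs r) | r <- th_rules th].

Lemma inst_tmI v sub t : tmI th v (inst sub t) = tmI th (fun i => tmI th v (sub i)) t.
Proof. by elim: t => //= [o t ->|o t -> u ->]. Qed.

Lemma rewrite_headP t t' v : rewrite_head rule_pairs t = Some t' -> tmI th v t' = tmI th v t.
Proof.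
rewrite /rule_pairs; elim: (th_rules th) => //= r rs IH.
case: pmatch => // sub; case: ifP => // /tm_eqbP e [<-]; rewrite -e.
by rewrite !inst_tmI r_ok.
Qed.

Lemma simplifyP f t v : tmI th v (simplify rule_pairs f t) = tmI th v t.
Proof.
elim: f t => //= f IH t; case E: rewrite_head => [t2|].
  rewrite IH (rewrite_headP _ E); case: (t) => //= [o u|o u u']; by rewrite !IH.
by case: (t) => //= [o u|o u u']; rewrite !IH.
Qed.

Definition normal_form fuel n m r := normalise (flip1 th) (flip2 th) rule_pairs fuel n m r.

Lemma normal_formP fuel W (phi : seq H -> W) m xs r ns us : multilinear m phi ->
  normal_form fuel (size xs) m r = Some (ns, us) ->
  rxI th phi xs r =
    wsum ns xs (fun s => phi (map (tmI th (fun i => nth 0 s i)) us)).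
Proof.
rewrite /normal_form /normalise => fl.
case R: runR => [[[bs el] us0]|] //; case: ifP => // w.
case E: oall => [els|] //; case D: drop_eps => [[ns' us']|] // [<- <-].
rewrite (normaliseP erefl fl R w E D) //.
congr wsum; apply: funext => s; rewrite -map_comp; congr phi.
by apply: eq_map => t /=; rewrite simplifyP.
Qed.

(** Two expressions with the same normal form are equal, since the normal form determines
    the value. *)
Lemma sweedler_eq fuel W (phi : seq H -> W) m xs l r : multilinear m phi ->
  (if normal_form fuel (size xs) m l is Some _ then true else false) ->
  normal_form fuel (size xs) m l = normal_form fuel (size xs) m r ->
  rxI th phi xs l = rxI th phi xs r.
Proof.
move=> fl; case L: (normal_form _ _ _ l) => [[ns us]|] // _ /esym R.
by rewrite (normal_formP fl L) (normal_formP fl R).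
Qed.

End Theory.

(** The bracketing of an iterated tensor product of copies of H, used to see pure tensors
    as multilinear functions of their entries. *)
Inductive shape := Sh | Sp of shape & shape.

Section Shapes.
Variables (k : fieldType) (H : hopfAlg k).

Fixpoint shape_space (sh : shape) : lmodType k :=
  if sh is Sp a b then tensor (shape_space a) (shape_space b) else H.

Fixpoint width (sh : shape) : nat := if sh is Sp a b then (width a + width b)%N else 1.

Fixpoint tensor_of_seq (sh : shape) : seq H -> shape_space sh :=
  match sh return seq H -> shape_space sh with
  | Sh => fun s => nth 0 s 0
  | Sp a b => fun s => tensor_of_seq a (take (width a) s) \ox tensor_of_seq b (drop (width a) s)
  end.

Lemma tensor_of_seq_multilinear sh : multilinear (width sh) (tensor_of_seq sh).
Proof.
elim: sh => [|a IHa b IHb] /= s1 s2 e; first by case: s1 e => // -[].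
have [pl pr] := @pure_bilinear k (shape_space a) (shape_space b).
case: (ltnP (size s1) (width a)) => h.
  have [c cE] : exists c, width a = ((size s1).+1 + c)%N.
    by exists (width a - (size s1).+1)%N; rewrite subnKC.
  apply: (eq_linear (f := fun x => tensor_of_seq a (s1 ++ x :: take c s2) \ox tensor_of_seq b (drop c s2))) => [x|].
    rewrite take_cat drop_cat ltnNge (ltnW h) /= cE addSn -addnS.
    by rewrite addKn.
  apply: (linear_bil (tensor_of_seq b (drop c s2)) (@pure_bilinear k _ _)); apply: IHa.
  rewrite size_takel ?cE //.
  by move: e; rewrite cE addSn => -[/eqP]; rewrite -addnA eqn_add2l => /eqP->; exact: leq_addr.
apply: (eq_linear (f := fun x => tensor_of_seq a (take (width a) s1) \ox
    tensor_of_seq b (drop (width a) s1 ++ x :: s2))) => [x|].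
  rewrite take_cat drop_cat; case: ltnP => // h'.
  have E : width a = size s1 by apply/eqP; rewrite eqn_leq h h'.
  by rewrite E subnn take_size drop_size cats0.
apply: (linear_bir (tensor_of_seq a (take (width a) s1)) (@pure_bilinear k _ _)); apply: IHb.
apply/eqP; rewrite size_drop -(eqn_add2l (width a)) -e addnS addnA subnKC //.
Qed.

(* 60 is fuel for the rewriting; running out of it would leave monomials unreduced *)
Definition sweedler_shape (th : theory H) (sh : shape) xs l r :=
  @sweedler_eq k H th 60 (shape_space sh) (tensor_of_seq sh) (width sh) xs l r (@tensor_of_seq_multilinear sh).

End Shapes.

(** Reification. The bound variables of sums are replaced by [mark i], which are
    recognised when met again; closed subterms whose head is not in the signature become
    variables. The arguments [C], [U], [B] list the constants and operations in the order
    of the signature of the theory [th]. *)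
Definition mark (k : fieldType) (H : hopfAlg k) (i : nat) : H := 0.

Ltac sw_find f l :=
  match l with
  | cons ?g _ => let __ := match goal with _ => constr_eq f g end in constr:(O)
  | cons ?g _ => let __ := match goal with _ => unify f g end in constr:(O)
  | cons _ ?r => let n := sw_find f r in constr:(S n)
  end.

Ltac sw_add x l :=
  match l with
  | nil => constr:(cons x nil)
  | cons x _ => l
  | cons ?y ?r => let r' := sw_add x r in constr:(cons y r')
  end.

Ltac sw_atoms H C U B env e :=
  match e with
  | tsum ?t ?f =>
    let env1 := sw_atoms H C U B env t in
    let b := eval cbv beta in (f (mark H O) (mark H O)) in
    sw_atoms H C U B env1 b
  | pure ?a ?b =>
    let env1 := sw_atoms H C U B env a in sw_atoms H C U B env1 b
  | Delta ?x => sw_atoms H C U B env x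
  | cdelta _ ?x => sw_atoms H C U B env x
  | eps ?x => sw_atoms H C U B env x
  | ceps _ ?x => sw_atoms H C U B env x
  | GRing.scale ?c ?x =>
    let env1 := sw_atoms H C U B env c in sw_atoms H C U B env1 x
  | mark _ _ => env
  | ?f ?a ?b => let __ := sw_find f B in
    let env1 := sw_atoms H C U B env a in sw_atoms H C U B env1 b
  | ?f ?a => let __ := sw_find f U in sw_atoms H C U B env a
  | ?c => let __ := sw_find c C in env
  | _ => sw_add e env
  end.

Ltac sw_ex H C U B env n e :=
  match e with
  | tsum ?t ?f =>
    let t' := sw_tx H C U B env n t in
    let b := eval cbv beta in (f (mark H n) (mark H (S n))) in
    let b' := sw_ex H C U B env (S (S n)) b in
    constr:(EB t' b')
  | GRing.scale (eps ?x) ?y =>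
    let x' := sw_ex H C U B env n x in
    let y' := sw_ex H C U B env n y in constr:(ES x' y')
  | GRing.scale (ceps _ ?x) ?y =>
    let x' := sw_ex H C U B env n x in
    let y' := sw_ex H C U B env n y in constr:(ES x' y')
  | mark _ ?i => constr:(EV i)
  | ?f ?a ?b => let i := sw_find f B in
    let a' := sw_ex H C U B env n a in
    let b' := sw_ex H C U B env n b in constr:(E2 i a' b')
  | ?f ?a => let i := sw_find f U in
    let a' := sw_ex H C U B env n a in constr:(E1 i a')
  | ?c => let i := sw_find c C in constr:(EC i)
  | _ => let i := sw_find e env in constr:(EV i)
  end
with sw_tx H C U B env n e :=
  match e with
  | tsum ?t ?f =>
    let t' := sw_tx H C U B env n t in
    let b := eval cbv beta in (f (mark H n) (mark H (S n))) in
    let b' := sw_tx H C U B env (S (S n)) b in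
    constr:(TB t' b')
  | GRing.scale (eps ?x) ?y =>
    let x' := sw_ex H C U B env n x in
    let y' := sw_tx H C U B env n y in constr:(TS x' y')
  | GRing.scale (ceps _ ?x) ?y =>
    let x' := sw_ex H C U B env n x in
    let y' := sw_tx H C U B env n y in constr:(TS x' y')
  | pure ?a ?b =>
    let a' := sw_ex H C U B env n a in
    let b' := sw_ex H C U B env n b in constr:(TP a' b')
  | Delta ?x => let x' := sw_ex H C U B env n x in constr:(TD x')
  | cdelta _ ?x => let x' := sw_ex H C U B env n x in constr:(TD x')
  end.

Ltac sw_out H C U B env n e :=
  match e with
  | pure ?a ?b =>
    match sw_out H C U B env n a with
    | (?l, ?s) => match sw_out H C U B env n b with
      | (?l', ?s') =>
        let l2 := eval cbv [cat] in (cat l l') in constr:((l2, Sp s s'))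
      end
    end
  | _ => let e' := sw_ex H C U B env n e in constr:(([:: e'], Sh))
  end.

Ltac sw_rx H C U B env n e :=
  match e with
  | tsum ?t ?f =>
    let t' := sw_tx H C U B env n t in
    let b := eval cbv beta in (f (mark H n) (mark H (S n))) in
    match sw_rx H C U B env (S (S n)) b with
    | (?b', ?s) => constr:((RB t' b', s))
    end
  | GRing.scale (eps ?x) ?y =>
    let x' := sw_ex H C U B env n x in
    match sw_rx H C U B env n y with (?y', ?s) => constr:((RS x' y', s)) end
  | GRing.scale (ceps _ ?x) ?y =>
    let x' := sw_ex H C U B env n x in
    match sw_rx H C U B env n y with (?y', ?s) => constr:((RS x' y', s)) end
  | _ => match sw_out H C U B env n e with (?l, ?s) => constr:((RR l, s)) end
  end.

Ltac sw_reify k th H C U B tac :=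
  cbv beta;
  lazymatch goal with |- ?L = ?R =>
    let nl := constr:(@nil (hopf_sort H)) in
    let env0 := sw_atoms H C U B nl L in
    let env := sw_atoms H C U B env0 R in
    let n := eval cbv [size] in (size env) in
    lazymatch sw_rx H C U B env n L with
    | (?l, ?s) => lazymatch sw_rx H C U B env n R with
      | (?r, s) => tac s env l r
      | (?r, ?s') => fail 10 "shapes" s s'
      end
    end
  end.

Ltac sw_with k th H C U B :=
  sw_reify k th H C U B ltac:(fun s env l r =>
    refine (@sweedler_shape k H th s env l r _ _);
    [vm_compute; exact isT | vm_compute; exact erefl]).

(** * Hopf algebra identities *)

Section HopfTheory.
Variables (k : fieldType) (H : hopfAlg k).

Local Notation S := (hopf_S H).

Lemma mul_bilinear : bilinear (fun x y : H => x * y).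
Proof.
split=> [y|x] a u v /=; first by rewrite mulrDl scalerAl.
by rewrite mulrDr scalerAr.
Qed.

Lemma mul_ok : (forall x y : H, Delta (x * y) =
     \tsum_(x1, x2 <- Delta x) \tsum_(y1, y2 <- Delta y) ((x1 * y1) \ox (x2 * y2)))
   /\ (forall x y : H, eps (x * y) = eps x * eps y).
Proof.
by split; [exact: hopf_deltaM (hopfP H) | exact: hopf_epsM (hopfP H)].
Qed.

Definition mul_op := @Binary k H (@GRing.mul H) mul_bilinear (Some (false, false)) mul_ok.

Lemma S_linear : linear S. Proof. exact: hopf_S_linear (hopfP H). Qed.

(** Here the antipode is only a linear map: its compatibility with products and coproducts
    is what the lemmas up to [antipode_ok] establish. *)
Definition bare_antipode_op := @Unary k H S S_linear None I.

Definition bare_hopf_sig : signature H := Signature [:: one_constant H] [:: bare_antipode_op] [:: mul_op].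

Definition mulA_rule := @Rule k H bare_hopf_sig (B2 0 (B2 0 (Lf 0) (Lf 1)) (Lf 2))
  (B2 0 (Lf 0) (B2 0 (Lf 1) (Lf 2))) (fun v => esym (mulrA _ _ _)).
Definition mul1_rule := @Rule k H bare_hopf_sig (B2 0 (Cs 0) (Lf 0)) (Lf 0) (fun v => mul1r _).
Definition mulr1_rule := @Rule k H bare_hopf_sig (B2 0 (Lf 0) (Cs 0)) (Lf 0) (fun v => mulr1 _).

Definition bare_hopf_th := Theory [:: mulA_rule; mul1_rule; mulr1_rule].

Ltac sw0 := sw_with k bare_hopf_th H [:: 1 : H] [:: S] [:: @GRing.mul H].

(** The antipode axioms as equations between functions: these can be rewritten below the
    binders of a Sweedler sum, where the arguments are bound variables. *)
Definition scal (x : H) : H := eps x *: 1.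
Definition antL (x : H) : H := \tsum_(x1, x2 <- Delta x) (S x1 * x2).
Definition antR (x : H) : H := \tsum_(x1, x2 <- Delta x) (x1 * S x2).

Lemma antLE : antL = scal. Proof. exact/funext/(hopf_Sl (hopfP H)). Qed.
Lemma antRE : antR = scal. Proof. exact/funext/(hopf_Sr (hopfP H)). Qed.

Lemma Delta1 : Delta (1 : H) = 1 \ox 1. Proof. exact: hopf_delta1 (hopfP H). Qed.
Lemma eps1 : eps (1 : H) = 1. Proof. exact: hopf_eps1 (hopfP H). Qed.
Lemma epsM (x y : H) : eps (x * y) = eps x * eps y.
Proof. exact: (hopf_epsM (hopfP H) x y). Qed.

Lemma S1 : S 1 = 1.
Proof.
have /= := hopf_Sl (hopfP H) 1; rewrite -/(Delta _) Delta1 tsum_pure.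
  by rewrite mulr1 => ->; rewrite -/(eps _) eps1 scale1r.
split=> [y|z]; first exact: (linear_bil y mul_bilinear S_linear).
exact: (linear_bir (S z) mul_bilinear (@linear_id' _ _)).
Qed.

Lemma eps_S x : eps (S x) = eps x.
Proof.
have el : linear (@eps k H : H -> k^o) by exact: eps_scalar.
have := congr1 (@eps k H) (congr1 (@^~ x) antLE).
rewrite /antL /scal (linear_tsum (F := @eps k H : H -> k^o) _ _ el) => e.
transitivity (eps (eps x *: (1 : H))); last first.
  by rewrite (linearZ' el) eps1; exact: mulr1.
rewrite -e -[LHS](counit_r (f := fun a => eps (S a) : k^o)); last exact/(linear_comp el)/S_linear.
by apply: eq_tsum => a b; rewrite epsM; exact: mulrC.
Qed.

(** Uniqueness of convolution inverses of maps from H to A. The algebra A is given by a bare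
    bilinear product, because it is applied to the componentwise product of H (x) H. *)
Lemma conv_inverse_unique (A : lmodType k) (m : A -> A -> A) (u : A) (f g h : H -> A) :
  bilinear m -> associative m -> left_id u m -> right_id u m ->
  linear f -> linear g -> linear h ->
  (forall x, \tsum_(x1, x2 <- Delta x) m (f x1) (g x2) = eps x *: u) ->
  (forall x, \tsum_(x1, x2 <- Delta x) m (g x1) (h x2) = eps x *: u) ->
  forall x, f x = h x.
Proof.
move=> mb mA m1l m1r fl gl hl fg gh x; have [ml mr] := mb.
have m_l y : linear (fun x => m x y) by exact: ml.
have m_r y : linear (m y) by exact: mr.
transitivity (\tsum_(x1, x' <- Delta x) \tsum_(x2, x3 <- Delta x') m (f x1) (m (g x2) (h x3))).
  rewrite -[LHS](counit_r x fl); apply: eq_tsum => a b.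
  by rewrite -(linear_tsum _ _ (m_r _)) gh (linearZ' (m_r _)) m1r.
rewrite -Delta_coassoc.
- rewrite -[RHS](counit_l x hl); apply: eq_tsum => a b.
  transitivity (m (\tsum_(x1, x2 <- Delta a) m (f x1) (g x2)) (h b)).
    by rewrite (linear_tsum (F := fun z => m z (h b)) _ _ (m_l _)); apply: eq_tsum.
  by rewrite fg (linearZ' (m_l (h b))) m1l.
- by move=> b c; exact: (linear_comp (m_l _) fl).
- by move=> a c; exact: (linear_comp (m_r _) (linear_comp (m_l (h c)) gl)).
- by move=> a b; exact: (linear_comp (m_r _) (linear_comp (m_r _) hl)).
Qed.

Definition mul2 (t t' : tensor H H) : tensor H H :=
  \tsum_(a, b <- t) \tsum_(c, d <- t') ((a * c) \ox (b * d)).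

Lemma mul2_bilinear : bilinear mul2.
Proof.
have pb c d : bilinear (fun a b : H => (a * c) \ox (b * d)).
  by apply: pure_comp_bilinear; exact: mul_bilinear.1.
have pb' a b : bilinear (fun c d : H => (a * c) \ox (b * d)).
  by apply: pure_comp_bilinear; exact: mul_bilinear.2.
split=> [t'|t].
  apply: tsum_linear; split=> [b|a]; apply: tsum_linearP => c d; exact: (pb c d).1 || exact: (pb c d).2.
by apply: tsum_linearP => a b; exact: tsum_linear.
Qed.

Lemma mul2_pure a b c d : mul2 (a \ox b) (c \ox d) = (a * c) \ox (b * d).
Proof.
rewrite /mul2 tsum_pure; first by rewrite tsum_pure //; apply: pure_comp_bilinear; exact: mul_bilinear.2.
have pb c' d' : bilinear (fun a b : H => (a * c') \ox (b * d')).
  by apply: pure_comp_bilinear; exact: mul_bilinear.1.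
by split=> [v|u]; apply: tsum_linearP => c' d'; [exact: (pb c' d').1 | exact: (pb c' d').2].
Qed.

Lemma mul2A : associative mul2.
Proof.
have [ml mr] := mul2_bilinear; move=> t u v.
have l1 z : linear (fun t => mul2 t z) by exact: ml.
have l2 z : linear (mul2 z) by exact: mr.
apply: (tensor_ext (F := fun t => mul2 t (mul2 u v)) (G := fun t => mul2 (mul2 t u) v))
  => [||a b]; [exact: l1 | exact: (linear_comp (l1 v) (l1 u)) | ].
apply: (tensor_ext (F := fun u => mul2 _ (mul2 u v)) (G := fun u => mul2 (mul2 _ u) v))
  => [||c d]; [exact: (linear_comp (l2 _) (l1 v)) | exact: (linear_comp (l1 v) (l2 _)) | ].
apply: (tensor_ext (F := fun v => mul2 _ (mul2 _ v)) (G := fun v => mul2 _ v))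
  => [||e f]; [exact: (linear_comp (l2 _) (l2 _)) | exact: l2 | ].
by rewrite !mul2_pure !mulrA.
Qed.

Lemma mul2_1l : left_id (1 \ox 1) mul2.
Proof.
have [ml mr] := mul2_bilinear; apply: tensor_ext => [||a b]; [exact: mr | by [] |].
by rewrite mul2_pure !mul1r.
Qed.

Lemma mul2_1r : right_id (1 \ox 1) mul2.
Proof.
have [ml mr] := mul2_bilinear.
apply: (tensor_ext (F := fun t => mul2 t _) (G := id)) => [||a b]; [exact: ml | by [] |].
by rewrite mul2_pure !mulr1.
Qed.

Lemma Delta_mul (x y : H) : Delta (x * y) = mul2 (Delta x) (Delta y).
Proof. exact: mul_ok.1. Qed.

(** Both sides are convolution inverse to the product of H on H (x) H; the proof writes out
    the uniqueness of that inverse. *)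
Lemma SM x y : S (x * y) = S y * S x.
Proof.
transitivity (\tsum_(x1, x2 <- Delta x) (S (x1 * y) * scal x2)).
  by rewrite /scal; sw0.
rewrite -antRE; transitivity (\tsum_(x1, x' <- Delta x) \tsum_(x2, x3 <- Delta x')
   \tsum_(y1, y2 <- Delta y) (S (x1 * y1) * (x2 * scal y2 * S x3))).
  by rewrite /antR /scal; sw0.
rewrite -antRE; transitivity (\tsum_(x1, x2 <- Delta x) \tsum_(y1, y2 <- Delta y)
   (antL (x1 * y1) * (S y2 * S x2))).
  by rewrite /antR /antL; sw0.
by rewrite antLE /scal; sw0.
Qed.

(** Delta o S and (S (x) S) o flip o Delta are both convolution inverse to Delta. *)
Lemma antipode_ok : (forall x, Delta (S x) =
    \tsum_(x1, x2 <- Delta x) (S x2 \ox S x1)) /\ (forall x, eps (S x) = eps x).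
Proof.
split; last exact: eps_S.
have dl := @Delta_linear k H; have [ml mr] := mul2_bilinear.
have sb : bilinear (fun a b => S b \ox S a).
  have [pl pr] := @pure_comp_bilinear k _ _ _ _ _ _ S_linear S_linear.
  by split=> [b|a]; [exact: pr | exact: pl].
apply: (conv_inverse_unique (f := fun x => Delta (S x)) (g := @Delta k H)
  (h := fun x => \tsum_(x1, x2 <- Delta x) (S x2 \ox S x1)) mul2_bilinear mul2A mul2_1l mul2_1r).
- exact: (linear_comp dl S_linear).
- exact: dl.
- exact: tsum_Delta_linear.
- move=> y; transitivity (Delta (scal y)).
    rewrite -antLE /antL (linear_tsum _ _ dl); apply: eq_tsum => a b.
    by rewrite Delta_mul.
  by rewrite /scal (linearZ' dl) Delta1.
- move=> y; transitivity (\tsum_(y1, y' <- Delta y) \tsum_(y2, y3 <- Delta y')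
      ((y1 * S y3) \ox antR y2)).
    rewrite /antR.
    transitivity (\tsum_(y1, y2 <- Delta y) \tsum_(a, b <- Delta y1)
       \tsum_(c, d <- \tsum_(u, v <- Delta y2) (S v \ox S u)) ((a * c) \ox (b * d))); first by [].
    by sw0.
  rewrite antRE; transitivity (antR y \ox (1 : H)); first by rewrite /scal /antR; sw0.
  by rewrite antRE /scal; sw0.
Qed.

Definition S_op := @Unary k H S S_linear (Some true) antipode_ok.

(** The rules of a Hopf algebra, for signatures extended by operations [us] and [bs]. *)
Section Extension.
Variables (us : seq (unary H)) (bs : seq (binary H)).

Definition hopf_sig : signature H :=
  Signature [:: one_constant H] (S_op :: us) (mul_op :: bs).

Definition hopf_rules : seq (rule hopf_sig) :=
 [:: @Rule k H hopf_sig (B2 0 (B2 0 (Lf 0) (Lf 1)) (Lf 2)) (B2 0 (Lf 0) (B2 0 (Lf 1) (Lf 2)))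
       (fun v => esym (mulrA _ _ _));
     @Rule k H hopf_sig (B2 0 (Cs 0) (Lf 0)) (Lf 0) (fun v => mul1r _);
     @Rule k H hopf_sig (B2 0 (Lf 0) (Cs 0)) (Lf 0) (fun v => mulr1 _);
     @Rule k H hopf_sig (U1 0 (B2 0 (Lf 0) (Lf 1))) (B2 0 (U1 0 (Lf 1)) (U1 0 (Lf 0)))
       (fun v => SM _ _);
     @Rule k H hopf_sig (U1 0 (Cs 0)) (Cs 0) (fun v => S1)].
End Extension.

Definition hopf_th := Theory (hopf_rules [::] [::]).

End HopfTheory.

Notation "'\D_' ( a , b <- x ) E" := (tsum (Delta x) (fun a b => E))
  (at level 41, a name, b name, x at level 200, E at level 41, only parsing).
Notation "'\D_' ( a , b , c <- x ) E" :=
  (tsum (Delta x) (fun a y => tsum (Delta y) (fun b c => E)))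
  (at level 41, a name, b name, c name, x at level 200, E at level 41, only parsing).
Notation "'\D_' ( a , b , c , d <- x ) E" :=
  (tsum (Delta x) (fun a y => tsum (Delta y) (fun b z => tsum (Delta z) (fun c d => E))))
  (at level 41, a name, b name, c name, d name, x at level 200, E at level 41,
   only parsing).
Notation "'\D_' ( a , b , c , d , e <- x ) E" :=
  (tsum (Delta x) (fun a y => tsum (Delta y) (fun b z => tsum (Delta z) (fun c w =>
     tsum (Delta w) (fun d e => E)))))
  (at level 41, a name, b name, c name, d name, e name, x at level 200, E at level 41,
   only parsing).
Notation "'\D_' ( a , b , c , d , e , f <- x ) E" :=
  (tsum (Delta x) (fun a y => tsum (Delta y) (fun b z => tsum (Delta z) (fun c w =>
     tsum (Delta w) (fun d v => tsum (Delta v) (fun e f => E))))))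
  (at level 41, a name, b name, c name, d name, e name, f name, x at level 200,
   E at level 41, only parsing).

(** * Matched pairs *)

(** Left and right actions of H on itself by coalgebra maps, which form a matched pair of
    Hopf algebras (each action distributes over the product up to the other one) and make
    H braided commutative. The associated braiding x1 |> y1 (x) x2 <| y2 is required to be a
    coalgebra map, which is what [mp_flip] amounts to. *)
Record is_mp (k : fieldType) (H : hopfAlg k) (act ract : H -> H -> H) : Prop := IsMP {
  mp_act_bilinear : bilinear act;
  mp_ract_bilinear : bilinear ract;
  mp_act_Delta : forall x y, Delta (act x y) =
    \D_(x1, x2 <- x) \D_(y1, y2 <- y) (act x1 y1 \ox act x2 y2);
  mp_act_eps : forall x y, eps (act x y) = eps x * eps y;
  mp_ract_Delta : forall x y, Delta (ract x y) =
    \D_(x1, x2 <- x) \D_(y1, y2 <- y) (ract x1 y1 \ox ract x2 y2);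
  mp_ract_eps : forall x y, eps (ract x y) = eps x * eps y;
  mp_1act : forall y, act 1 y = y;
  mp_actM : forall x y z, act (x * y) z = act x (act y z);
  mp_act1 : forall x, act x 1 = eps x *: 1;
  mp_ract1 : forall x, ract x 1 = x;
  mp_ractM : forall x y z, ract x (y * z) = ract (ract x y) z;
  mp_1ract : forall y, ract 1 y = eps y *: 1;
  mp_act_mul : forall x y z, act x (y * z) =
    \D_(x1, x2 <- x) \D_(y1, y2 <- y) (act x1 y1 * act (ract x2 y2) z);
  mp_mul_ract : forall x y z, ract (x * y) z =
    \D_(y1, y2 <- y) \D_(z1, z2 <- z) (ract x (act y1 z1) * ract y2 z2);
  mp_flip : forall x y,
    \D_(x1, x2 <- x) \D_(y1, y2 <- y) (act x1 y1 \ox ract x2 y2) =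
    \D_(x1, x2 <- x) \D_(y1, y2 <- y) (act x2 y2 \ox ract x1 y1);
  mp_comm : forall x y, x * y =
    \D_(x1, x2 <- x) \D_(y1, y2 <- y) (act x1 y1 * ract x2 y2) }.

(** The two sides of the identities of these theories, as closed functions: stated as equality
    of functions, an identity can be rewritten below the binders of a Sweedler sum. *)
Section Sides.
Variables (k : fieldType) (H : hopfAlg k).
Implicit Types (act ract dot col m : H -> H -> H) (T : H -> H).

Definition mulH (x y : H) := x * y.

Definition pair12 act ract x y :=
  \D_(x1, x2 <- x) \D_(y1, y2 <- y) (act x1 y1 \ox ract x2 y2).
Definition pair21 act ract x y :=
  \D_(x1, x2 <- x) \D_(y1, y2 <- y) (act x2 y2 \ox ract x1 y1).
Definition pair_mul act ract x y :=
  \D_(x1, x2 <- x) \D_(y1, y2 <- y) (act x1 y1 * ract x2 y2).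

Definition act_of_mul act x (y z : H) := act x (y * z).
Definition act_each act ract x y z :=
  \D_(x1, x2 <- x) \D_(y1, y2 <- y) (act x1 y1 * act (ract x2 y2) z).
Definition ract_of_mul ract (x y : H) z := ract (x * y) z.
Definition ract_each act ract x y z :=
  \D_(y1, y2 <- y) \D_(z1, z2 <- z) (ract x (act y1 z1) * ract y2 z2).

Definition YB_left act ract x y z :=
  \D_(x1, x2 <- x) \D_(y1, y2 <- y) ract (act x1 y1) (act (ract x2 y2) z).
Definition YB_right act ract x y z :=
  \D_(y1, y2 <- y) \D_(z1, z2 <- z) act (ract x (act y1 z1)) (ract y2 z2).

Definition skew12 dot col x y :=
  \D_(x1, x2 <- x) \D_(y1, y2 <- y) (col y1 x2 \ox dot x1 y2).
Definition skew21 dot col x y :=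
  \D_(x1, x2 <- x) \D_(y1, y2 <- y) (col y2 x1 \ox dot x2 y1).
Definition comm_col col h l := \D_(h1, h2 <- h) (col l h2 * h1).
Definition comm_dot dot h l := \D_(l1, l2 <- l) (dot h l1 * l2).
Definition dot_of_mul dot (x y : H) z := dot (x * y) z.
Definition dot_each dot col x y z :=
  \D_(y1, y2 <- y) \D_(z1, z2 <- z) (dot x (col z1 y2) * dot y1 z2).

Definition times_lact m act x y := \D_(x1, x2 <- x) m x1 (act x2 y).
Definition lact_times act m x y z : H := act x (m y z).
Definition lact_times_each act m x y z := \D_(x1, x2 <- x) m (act x1 y) (act x2 z).
Definition T_times m T x := \D_(x1, x2 <- x) m (T x1) x2.
Definition times_T m T x := \D_(x1, x2 <- x) m x1 (T x2).
End Sides.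

Ltac unfold_sides := cbv delta [scal antL antR mulH pair12 pair21 pair_mul act_of_mul
  act_each ract_of_mul ract_each YB_left YB_right skew12 skew21 comm_col comm_dot
  dot_of_mul dot_each times_lact lact_times lact_times_each T_times times_T].

Section MatchedPair.
Variables (k : fieldType) (H : hopfAlg k) (act ract : H -> H -> H).
Hypothesis M : is_mp act ract.

Local Notation S := (hopf_S H).
Local Notation "x |> y" := (act x y) (at level 39, left associativity).
Local Notation "x <| y" := (ract x y) (at level 39, left associativity).

Definition act_op := @Binary k H act (mp_act_bilinear M) (Some (false, false))
  (conj (mp_act_Delta M) (mp_act_eps M)).
Definition ract_op := @Binary k H ract (mp_ract_bilinear M) (Some (false, false))
  (conj (mp_ract_Delta M) (mp_ract_eps M)).

Definition mp_sig := hopf_sig [::] [:: act_op; ract_op].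

Definition mp_th : theory H := Theory (hopf_rules [::] [:: act_op; ract_op] ++
 [:: @Rule k H mp_sig (B2 1 (Cs 0) (Lf 0)) (Lf 0) (fun v => mp_1act M _);
     @Rule k H mp_sig (B2 2 (Lf 0) (Cs 0)) (Lf 0) (fun v => mp_ract1 M _);
     @Rule k H mp_sig (B2 1 (B2 0 (Lf 0) (Lf 1)) (Lf 2)) (B2 1 (Lf 0) (B2 1 (Lf 1) (Lf 2)))
       (fun v => mp_actM M _ _ _);
     @Rule k H mp_sig (B2 2 (Lf 0) (B2 0 (Lf 1) (Lf 2))) (B2 2 (B2 2 (Lf 0) (Lf 1)) (Lf 2))
       (fun v => mp_ractM M _ _ _)]).

Local Notation flipL := (pair12 act ract).
Local Notation flipR := (pair21 act ract).
Local Notation comR := (pair_mul act ract).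

Lemma flipE : flipL = flipR.
Proof. by apply: funext => x; apply: funext => y; exact: mp_flip. Qed.

Lemma comE : comR = mulH (H := H).
Proof. by apply: funext => x; apply: funext => y; rewrite [RHS](mp_comm M). Qed.

(** Convolving [m] with the two outer components of either side of the Yang-Baxter equation
    and multiplying gives, for the true middle component, the threefold product x y z. *)
Definition YB_prod (m : H -> H -> H -> H) x y z :=
 \D_(x1, x2, x3 <- x) \D_(y1, y2, y3 <- y)
 \D_(z1, z2, z3 <- z)
   ((x1 |> (y1 |> z1)) * m x2 y2 z2 * ((x3 <| y3) <| z3)).

Ltac sw := unfold_sides; cbv delta [YB_prod];
  sw_with k mp_th H [:: 1 : H] [:: S] [:: @GRing.mul H; act; ract].

Lemma YB_prod_left x y z : YB_prod (YB_left act ract) x y z = x * y * z.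
Proof.
transitivity (\D_(x1, x2 <- x) \D_(y1, y2 <- y) \D_(z1, z2 <- z)
  ((mulH x1 y1 |> z1) * \D_(a, b <- x2) \D_(c, d <- y2) \D_(e, f <- z2)
    ((YB_left act ract) a c e * ((b <| d) <| f)))); first by sw.
rewrite -comE.
transitivity (\D_(x1, x2, x3 <- x) \D_(y1, y2, y3 <- y)
  \D_(z1, z2 <- z) \tsum_(p, q <- flipR x2 y2)
  (((x1 |> y1) |> (q |> z1)) * \D_(a, b <- x3) \D_(c, d <- y3) \D_(e, f <- z2)
    ((p <| ((a <| c) |> e)) * ((b <| d) <| f)))); first by sw.
rewrite -flipE.
transitivity (\D_(x1, x2, x3 <- x) \D_(y1, y2, y3 <- y)
  \D_(z1, z2 <- z) (comR (x1 |> y1) ((x2 <| y2) |> z1) * ((x3 <| y3) <| z2))).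
  by sw.
rewrite comE.
transitivity (\D_(x1, x2 <- x) \D_(y1, y2 <- y) ((x1 |> y1) * comR (x2 <| y2) z)).
  by sw.
rewrite comE.
transitivity (comR x y * z); first by sw.
by rewrite comE.
Qed.

Lemma YB_prod_right x y z : YB_prod (YB_right act ract) x y z = x * y * z.
Proof.
transitivity (\D_(x1, x2, x3 <- x) \D_(y1, y2 <- y) \D_(z1, z2 <- z)
  ((x1 |> (y1 |> z1)) * \D_(a, b <- y2) \D_(e, f <- z2)
     ((YB_right act ract) x2 a e * (x3 <| mulH b f)))); first by sw.
rewrite -comE.
transitivity (\D_(x1, x2, x3 <- x) \D_(y1, y' <- y) \D_(z1, z' <- z)
  \D_(y2, y2' <- y') \D_(z2, z2' <- z') \D_(y3, y4 <- y2') \D_(z3, z4 <- z2')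
  \tsum_(p, q <- flipR y3 z3)
   ((x1 |> (y1 |> z1)) * (((x2 <| (y2 |> z2)) |> q) * ((x3 <| p) <| (y4 <| z4))))).
  by sw.
rewrite -flipE.
transitivity (\D_(x1, x2 <- x) \D_(y1, y' <- y) \D_(z1, z' <- z)
  \D_(y2, y3 <- y') \D_(z2, z3 <- z')
   ((x1 |> (y1 |> z1)) * comR (x2 <| (y2 |> z2)) (y3 <| z3))); first by sw.
rewrite comE.
transitivity (\D_(y1, y2 <- y) \D_(z1, z2 <- z) (comR x (y1 |> z1) * (y2 <| z2))).
  by sw.
rewrite comE.
transitivity (x * comR y z); first by sw.
by rewrite comE; exact: mulrA.
Qed.

(** The middle components of the two sides of the Yang-Baxter equation agree: both sides
    multiply to x y z, their outer components agree because |> and <| are actions and H is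
    braided commutative, and these, being coalgebra maps, are cancelled by the antipode. *)
Lemma YB_middle x y z : (YB_left act ract) x y z = (YB_right act ract) x y z.
Proof.
pose cancel m := \D_(x1, x2, x3 <- x) \D_(y1, y2, y3 <- y)
  \D_(z1, z2, z3 <- z)
   (S (x1 |> (y1 |> z1)) * YB_prod m x2 y2 z2 * S ((x3 <| y3) <| z3)).
have e : YB_prod (YB_left act ract) = YB_prod (YB_right act ract).
  by apply: funext => a; apply: funext => b; apply: funext => c; rewrite YB_prod_left YB_prod_right.
pose mid m := \D_(x1, x2, x3 <- x) \D_(y1, y2, y3 <- y)
  \D_(z1, z2, z3 <- z)
   (antL (x1 |> (y1 |> z1)) * m x2 y2 z2 * antR ((x3 <| y3) <| z3)) : H.
transitivity (mid (YB_left act ract)); first by rewrite /mid antLE antRE; sw.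
transitivity (cancel (YB_left act ract)); first by rewrite /mid /cancel; sw.
rewrite /cancel e.
transitivity (mid (YB_right act ract)); first by rewrite /mid; sw.
by rewrite /mid antLE antRE; sw.
Qed.

End MatchedPair.

(** * From matched pairs to Hopf skew-braces *)

(** In the group case x . y = x <| y^-1, and y : x is the left action in the variables
    x <| y^-1 and y; all axioms come from those of matched pairs by that change of
    variables. *)
Definition dot_of (k : fieldType) (H : hopfAlg k) (ract : H -> H -> H) (x y : H) : H :=
  ract x (hopf_S H y).
Definition col_of (k : fieldType) (H : hopfAlg k) (act ract : H -> H -> H) (y x : H) : H :=
  \D_(y1, y2 <- y) act (ract x (hopf_S H y1)) y2.

Section ToSkewBrace.
Variables (k : fieldType) (H : hopfAlg k) (act ract : H -> H -> H).
Hypothesis M : is_mp act ract.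

Local Notation S := (hopf_S H).
Local Notation "x |> y" := (act x y) (at level 39, left associativity).
Local Notation "x <| y" := (ract x y) (at level 39, left associativity).
Local Notation flipL := (pair12 act ract).
Local Notation flipR := (pair21 act ract).
Local Notation flipE := (flipE M).
Local Notation comR := (pair_mul act ract).
Local Notation comE := (comE M).
Local Notation dot := (dot_of ract).
Local Notation col := (col_of act ract).

Ltac sw := unfold_sides; cbv delta [dot_of col_of];
  sw_with k (mp_th M) H [:: 1 : H] [:: S] [:: @GRing.mul H; act; ract].

Lemma dot_bilinear : bilinear dot.
Proof.
split=> [y|x]; first exact: (mp_ract_bilinear M).1.
exact: (linear_comp ((mp_ract_bilinear M).2 x) (@S_linear k H)).
Qed.

Lemma col_bilinear : bilinear col.
Proof.
have [al ar] := mp_act_bilinear M.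
split=> [x|y].
  apply: tsum_Delta_linear; split=> [b|a]; last exact: ar.
  apply: (linear_comp (f := fun z => z |> b)); first exact: al.
  exact: (linear_comp ((mp_ract_bilinear M).2 x) (@S_linear k H)).
apply: tsum_linearP => a b; apply: (linear_comp (f := fun z => z |> b)); first exact: al.
exact: (mp_ract_bilinear M).1.
Qed.

Lemma Delta_dot x y : Delta (dot x y) =
  \D_(x1, x2 <- x) \D_(y1, y2 <- y) (dot x1 y2 \ox dot x2 y1).
Proof. by rewrite [LHS]tsum_eta; sw. Qed.

Lemma eps_dot x y : eps (dot x y) = eps x * eps y.
Proof. by rewrite (mp_ract_eps M) eps_S. Qed.

(** The compatibility of the two actions reverses the components of l. *)
Lemma Delta_col l m : Delta (col l m) =
  \D_(l1, l2 <- l) \D_(m1, m2 <- m) (col l1 m2 \ox col l2 m1).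
Proof.
transitivity (\D_(l1, l2, l3 <- l) \tsum_(p, q <- flipL (m <| S l1) l2)
  (p \ox \D_(l4, l5 <- l3) ((q <| S l4) |> l5))); last first.
  rewrite flipE; transitivity (\D_(m1, m2 <- m) \D_(l1, l2, l3, l4, l5 <- l)
      (((m2 <| S l1) |> l3) \ox (((m1 <| antL l2) <| S l4) |> l5))); first by sw.
  by rewrite antLE; sw.
transitivity (\D_(l1, l2, l3 <- l) \tsum_(p, q <- Delta (m <| S l1)) 
  \D_(l4, l5 <- l3) ((p |> l2) \ox ((q <| scal l4) |> l5))).
  by rewrite [LHS]tsum_eta; sw.
by rewrite -antRE; sw.
Qed.

Lemma eps_col l m : eps (col l m) = eps l * eps m.
Proof.
have el : linear (@eps k H : H -> k^o) by exact: eps_scalar.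
rewrite /col_of (linear_tsum (F := @eps k H : H -> k^o) _ _ el).
rewrite -[RHS](counit_l (f := fun b => eps b * eps m : k^o)); last first.
  by move=> a u v; rewrite eps_scalar /= mulrDl -mulrA.
apply: eq_tsum => a b; rewrite (mp_act_eps M) eps_dot /GRing.scale /=.
by rewrite [eps m * _]mulrC -mulrA [eps m * _]mulrC.
Qed.

Definition dot_op := @Binary k H dot dot_bilinear (Some (false, true)) (conj Delta_dot eps_dot).
Definition col_op := @Binary k H col col_bilinear (Some (false, true)) (conj Delta_col eps_col).

Definition sb_ops := [:: act_op M; ract_op M; dot_op; col_op].
Definition sb_sig := hopf_sig [::] sb_ops.

Definition sb_th : theory H := Theory (hopf_rules [::] sb_ops ++
 [:: @Rule k H sb_sig (B2 1 (Cs 0) (Lf 0)) (Lf 0) (fun v => mp_1act M _);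
     @Rule k H sb_sig (B2 2 (Lf 0) (Cs 0)) (Lf 0) (fun v => mp_ract1 M _);
     @Rule k H sb_sig (B2 1 (B2 0 (Lf 0) (Lf 1)) (Lf 2)) (B2 1 (Lf 0) (B2 1 (Lf 1) (Lf 2)))
       (fun v => mp_actM M _ _ _);
     @Rule k H sb_sig (B2 2 (Lf 0) (B2 0 (Lf 1) (Lf 2))) (B2 2 (B2 2 (Lf 0) (Lf 1)) (Lf 2))
       (fun v => mp_ractM M _ _ _);
     @Rule k H sb_sig (B2 3 (Lf 0) (Lf 1)) (B2 2 (Lf 0) (U1 0 (Lf 1)))
       (fun v => erefl)]).

(* [swc] keeps col as an operation with a known coproduct, [sw] unfolds it *)
Ltac swc := unfold_sides;
  sw_with k sb_th H [:: 1 : H] [:: S] [:: @GRing.mul H; act; ract; dot; col].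

Lemma skewE : skew12 dot col = skew21 dot col.
Proof.
apply: funext => x; apply: funext => y; rewrite /skew12 /skew21.
transitivity (\D_(y1, y2, y3 <- y) \tsum_(p, q <- flipR (x <| S y1) y2)
  (p \ox (q <| S y3))).
  transitivity (\D_(x1, x2 <- x) \D_(y1, y2, y3, y4 <- y)
    (((x2 <| S y1) |> y3) \ox ((x1 <| antL y2) <| S y4))); last by sw.
  by rewrite antLE; sw.
rewrite -flipE; transitivity (\D_(x1, x2 <- x) \D_(y1, y2, y3, y4 <- y) (((x1 <| S y2) |> y3) \ox ((x2 <| S y1) <| antR y4))); first by sw.
by rewrite antRE; sw.
Qed.

Lemma act_of_mulE : act_each act ract = act_of_mul act.
Proof. by do 3 apply: funext => ?; rewrite [RHS](mp_act_mul M). Qed.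

Definition S_col l m := S (col l m).
Definition act_S l m := m |> S l.

(** The antipode of l : m is m |> S l: multiplied with l : m it gives m |> (S l1 * l2), by
    the matched pair axiom for |> on a product. *)
Lemma antipode_col : S_col = act_S.
Proof.
apply: funext => l; apply: funext => m.
transitivity (\D_(l1, l2, l3 <- l) \D_(m1, m2 <- m)
   ((m2 |> (S l1 * l2)) * S_col l3 m1)).
  transitivity (\D_(l1, l2 <- l) \D_(m1, m2 <- m) ((m2 |> antL l1) * S_col l2 m1)).
    rewrite antLE; transitivity (\D_(m1, m2 <- m) ((m2 |> 1) * S_col l m1)).
      under eq_tsum => a b do rewrite (mp_act1 M).
      by rewrite /S_col; swc.
    by rewrite /S_col; swc.
  by rewrite /S_col; swc.
transitivity (\D_(l1, l2, l3 <- l) \D_(m1, m2 <- m)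
   (act_of_mul act m2 (S l1) l2 * S_col l3 m1)); first by [].
rewrite -act_of_mulE /act_each.
transitivity (\D_(l1, l2, l3 <- l) \D_(m1, m2 <- m)
   \tsum_(p, q <- flipL m2 (S l1)) ((p * (q |> l2)) * S_col l3 m1)).
  by rewrite /S_col; swc.
rewrite flipE.
transitivity (\D_(l1, l2, l3 <- l) \D_(m1, m2, m3 <- m)
  ((m3 |> S l1) * (\D_(a, b <- l2) ((m2 <| S a) |> b)) * S (col l3 m1))).
  by rewrite /S_col; swc.
transitivity (\D_(l1, l2, l3 <- l) \D_(m1, m2, m3 <- m)
  ((m3 |> S l1) * col l2 m2 * S (col l3 m1))); first by [].
transitivity (\D_(l1, l2 <- l) \D_(m1, m2 <- m) (act_S l1 m2 * antR (col l2 m1))).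
  by rewrite /act_S; swc.
by rewrite antRE /act_S; swc.
Qed.

(** This is braided commutativity in the variables h <| S m1 and m2. *)
Lemma commE : comm_col col = comm_dot dot.
Proof.
apply: funext => h; apply: funext => m; rewrite /comm_col /comm_dot.
transitivity (\D_(m1, m2 <- m) \tsum_(p, q <- flipR (h <| S m1) m2) (p * q)).
  transitivity (\D_(h1, h2 <- h) \D_(m1, m2, m3 <- m)
    (((h2 <| S m1) |> m3) * (h1 <| antL m2))); last by sw.
  by rewrite antLE; sw.
rewrite -flipE; transitivity (\D_(m1, m2 <- m) comR (h <| S m1) m2); first by sw.
by rewrite comE.
Qed.

(** The matched pair axiom for <| on a product, at S l; [antipode_col] turns the action on
    S l into the operation col. *)
Lemma Mdot h m l : dot (h * m) l =
  \D_(m1, m2 <- m) \D_(l1, l2 <- l) (dot h (col l1 m2) * dot m1 l2).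
Proof.
rewrite {1}/dot_of (mp_mul_ract M).
transitivity (\tsum_(p, q <- flipL m (S l)) ((h <| p) * q)); first by sw.
rewrite flipE.
transitivity (\D_(m1, m2 <- m) \D_(l1, l2 <- l) ((h <| act_S l1 m2) * (m1 <| S l2))).
  by rewrite /act_S; sw.
by rewrite -antipode_col.
Qed.

Lemma Mcol h m l : col (h * m) l =
  \D_(m1, m2 <- m) \D_(l1, l2 <- l) (col h (dot l1 m2) * col m1 l2).
Proof.
transitivity (\D_(h1, h2 <- h) \D_(m1, m2 <- m) act_of_mul act ((l <| S m1) <| S h1) h2 m2).
  by rewrite /act_of_mul; sw.
rewrite -act_of_mulE.
transitivity (\D_(h1, h2 <- h) \D_(m1, m2 <- m) \tsum_(p, q <- flipL ((l <| S m1) <| S h1) h2)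
  (p * (q |> m2))); first by rewrite /act_each; sw.
rewrite flipE.
transitivity (\D_(l1, l2 <- l) \D_(h1, h2, h3 <- h) \D_(m1, m2, m3 <- m) ((((l2 <| S m1) <| S h1) |> h3) * (((l1 <| S m2) <| antL h2) |> m3))).
  by sw.
rewrite antLE.
transitivity (\tsum_(p, q <- skew21 dot col l m) (col h q * p)); last by rewrite -skewE /skew12; swc.
by rewrite /skew21; sw.
Qed.

(** As col is built from dot and |>, this reduces to [Mdot]. *)
Lemma colM x y z : col (col x y) z = col x (z * y).
Proof.
transitivity (\D_(w1, w2 <- col x y) (dot z w1 |> w2)); first by [].
transitivity (\D_(x1, x2 <- x) \D_(y1, y2 <- y) (dot z (col x1 y2) |> col x2 y1)).
  by swc.
transitivity (\D_(x1, x2 <- x) \D_(y1, y2 <- y)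
  (dot z (col x1 y2) |> (\D_(a, b <- x2) (dot y1 a |> b)))); first by [].
transitivity (\D_(x1, x2 <- x) (dot (z * y) x1 |> x2)); last by [].
under [RHS]eq_tsum => a b do rewrite Mdot.
by swc.
Qed.

Lemma dot_dot x y z :
  \D_(y1, y2 <- y) dot (dot x y1) (col z y2) =
  \D_(z1, z2 <- z) dot (dot x z2) (dot y z1).
Proof.
transitivity (x <| S (comm_col col y z)); first by rewrite /comm_col; swc.
by rewrite commE /comm_dot; swc.
Qed.

Lemma col_col x y z :
  \D_(y1, y2 <- y) col (col x y1) (col z y2) =
  \D_(z1, z2 <- z) col (col x z2) (dot y z1).
Proof.
under eq_tsum => a b do rewrite colM.
under [RHS]eq_tsum => a b do rewrite colM.
transitivity (col x (comm_col col y z)); first by rewrite /comm_col; swc.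
by rewrite commE /comm_dot; swc.
Qed.

Lemma YB_E : YB_left act ract = YB_right act ract.
Proof. by do 3 apply: funext => ?; exact: YB_middle. Qed.

(** This is the equality of the middle components in the Yang-Baxter equation, with S y as
    third variable and z <| S x1 as first one. *)
Lemma dot_col x y z :
  \D_(y1, y2 <- y) col (dot x y1) (dot z y2) =
  \D_(z1, z2 <- z) dot (col x z2) (col y z1).
Proof.
transitivity (\D_(y1, y2 <- y) \D_(w1, w2 <- dot x y1) (dot (dot z y2) w1 |> w2)).
  by [].
transitivity (\D_(x1, x2 <- x) \D_(y1, y2 <- y) (dot z (comm_dot dot x1 y2) |> dot x2 y1)).
  by rewrite /comm_dot; swc.
rewrite -commE.
transitivity (\D_(x1, x2 <- x) \tsum_(p, q <- skew21 dot col x2 y)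
   (dot (dot z x1) p |> q)); first by rewrite /comm_col /skew21; swc.
rewrite -skewE.
transitivity (\D_(x1, x2, x3 <- x) \D_(y1, y2 <- y)
   ((dot z x1 <| S_col y1 x3) |> (x2 <| S y2))); first by rewrite /skew12 /S_col; swc.
rewrite antipode_col.
transitivity (\D_(x1, x2 <- x) \tsum_(p, q <- flipR x2 (S y))
   ((dot z x1 <| p) |> q)); first by rewrite /act_S; swc.
rewrite -flipE.
transitivity (\D_(x1, x2 <- x) YB_right act ract (z <| S x1) x2 (S y)); first by swc.
rewrite -YB_E.
transitivity (\D_(x1, x2 <- x) \tsum_(p, q <- flipL (z <| S x1) x2) (p <| (q |> S y))).
  by swc.
rewrite flipE.
transitivity (\D_(x1, x2, x3 <- x) \D_(z1, z2 <- z)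
   (((z2 <| S x1) |> x3) <| ((z1 <| antL x2) |> S y))); first by swc.
rewrite antLE.
transitivity (\D_(z1, z2 <- z) (col x z2 <| act_S y z1)); first by rewrite /act_S; sw.
rewrite -antipode_col /S_col; reflexivity.
Qed.

End ToSkewBrace.

(** * Coalgebra maps into tensor products *)

Section CoalgebraMaps.
Variable k : fieldType.
Implicit Types A B C D E F : lmodType k.

Lemma pure_tsum (U V U' V' W W' : lmodType k) (t : tensor U V) (t' : tensor U' V')
    (f : U -> V -> W) (g : U' -> V' -> W') :
  tsum t f \ox tsum t' g = \tsum_(a, b <- t) \tsum_(c, d <- t') (f a b \ox g c d).
Proof.
have [pl pr] := @pure_bilinear k W W'.
rewrite (linear_tsum (F := fun x => x \ox tsum t' g) _ _ (pl _)).
by apply: eq_tsum => a b; rewrite (linear_tsum (F := fun x => f a b \ox x) _ _ (pr _)).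
Qed.

Lemma tsum_pure2_bilinear A B C D (r : tensor C D) :
  bilinear (fun (a : A) (b : B) => \tsum_(c, d <- r) ((a \ox c) \ox (b \ox d))).
Proof.
have [pl pr] := @pure_bilinear k A C; have [pl' pr'] := @pure_bilinear k B D.
have [ql qr] := @pure_bilinear k (tensor A C) (tensor B D).
split=> [b|a]; apply: tsum_linearP => c d.
  exact: (linear_comp (ql _) (pl c)).
exact: (linear_comp (qr _) (pl' d)).
Qed.

Lemma tinterchange_bilinear A B C D : bilinear (fun (r : tensor A B) (r' : tensor C D) =>
  \tsum_(a, b <- r) \tsum_(c, d <- r') ((a \ox c) \ox (b \ox d))).
Proof.
split=> [t'|t].
  by apply: tsum_linear; exact: tsum_pure2_bilinear.
apply: tsum_linearP => a b; apply: tsum_linear.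
have [pl pr] := @pure_bilinear k A C; have [pl' pr'] := @pure_bilinear k B D.
have [ql qr] := @pure_bilinear k (tensor A C) (tensor B D).
by split=> [d|c]; [exact: (linear_comp (ql _) (pr a)) | exact: (linear_comp (qr _) (pr' b))].
Qed.

Lemma tinterchange_pure A B C D (r : tensor A B) (r' : tensor C D) :
  tinterchange (r \ox r') = \tsum_(a, b <- r) \tsum_(c, d <- r') ((a \ox c) \ox (b \ox d)).
Proof. exact: (tsum_pure _ _ (@tinterchange_bilinear A B C D)). Qed.

Lemma tinterchange_linear A B C D : linear (@tinterchange k A B C D).
Proof. exact: (tsum_linear (@tinterchange_bilinear A B C D)). Qed.

Section TensCoalg.
Variables (C D : lmodType k) (c : coalgStr C) (d : coalgStr D).
Hypotheses (cl : linear (cdelta c)) (dl : linear (cdelta d)).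
Hypotheses (ecl : scalar (ceps c)) (edl : scalar (ceps d)).

Lemma tens_delta_pure x y : cdelta (tens_coalg c d) (x \ox y) =
  \tsum_(x1, x2 <- cdelta c x) \tsum_(y1, y2 <- cdelta d y)
    ((x1 \ox y1) \ox (x2 \ox y2)).
Proof. by rewrite /= tmap_pure // tinterchange_pure. Qed.

Lemma tens_delta_linear : linear (cdelta (tens_coalg c d)).
Proof. exact: (linear_comp (@tinterchange_linear _ _ _ _) (tmap_linear cl dl)). Qed.

Lemma tens_eps_bilinear : bilinear (fun (x : C) (y : D) => ceps c x * ceps d y : k^o).
Proof.
split=> [y|x] a u v /=; first by rewrite ecl mulrDl -mulrA.
by rewrite edl mulrDr mulrCA.
Qed.

Lemma tens_eps_pure x y : ceps (tens_coalg c d) (x \ox y) = ceps c x * ceps d y.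
Proof. exact: (tsum_pure _ _ tens_eps_bilinear). Qed.

Lemma tens_eps_linear : linear (ceps (tens_coalg c d) : _ -> k^o).
Proof. exact: (tsum_linear tens_eps_bilinear). Qed.
End TensCoalg.

Lemma tens_coalg_morP C D E F (c : coalgStr C) (d : coalgStr D) (e : coalgStr E)
    (f : coalgStr F) (G : C -> D -> tensor E F) :
  linear (cdelta c) -> linear (cdelta d) -> linear (cdelta e) -> linear (cdelta f) ->
  scalar (ceps c) -> scalar (ceps d) -> scalar (ceps e) -> scalar (ceps f) ->
  bilinear G ->
  (forall x y,
    \tsum_(a, b <- G x y) \tsum_(a1, a2 <- cdelta e a) \tsum_(b1, b2 <- cdelta f b)
       ((a1 \ox b1) \ox (a2 \ox b2)) =
    \tsum_(x1, x2 <- cdelta c x) \tsum_(y1, y2 <- cdelta d y)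
    \tsum_(a, b <- G x1 y1) \tsum_(a', b' <- G x2 y2) ((a \ox b) \ox (a' \ox b'))) ->
  (forall x y, \tsum_(a, b <- G x y) (ceps e a * ceps f b) = ceps c x * ceps d y) ->
  coalg_mor (tens_coalg c d) (tens_coalg e f) (fun t => tsum t G).
Proof.
move=> cl dl el fl cel del eel fel Gb hd he; have Gl := tsum_linear Gb.
split=> // t.
- apply: (tensor_ext (F := fun t => cdelta (tens_coalg e f) (tsum t G))
    (G := fun t => tmap (tsum^~ G) (tsum^~ G) (cdelta (tens_coalg c d) t))) => [||x y].
  + exact: (linear_comp (tens_delta_linear el fl) Gl).
  + exact: (linear_comp (tmap_linear Gl Gl) (tens_delta_linear cl dl)).
  rewrite tens_delta_pure // tsum_pure // [X in cdelta _ X]tsum_eta.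
  rewrite (linear_tsum _ _ (tens_delta_linear el fl)).
  transitivity (\tsum_(a, b <- G x y) \tsum_(a1, a2 <- cdelta e a)
    \tsum_(b1, b2 <- cdelta f b) ((a1 \ox b1) \ox (a2 \ox b2))).
    by apply: eq_tsum => a b; rewrite tens_delta_pure.
  rewrite hd (linear_tsum _ _ (tmap_linear Gl Gl)); apply: eq_tsum => x1 x2.
  rewrite (linear_tsum _ _ (tmap_linear Gl Gl)); apply: eq_tsum => y1 y2.
  by rewrite tmap_pure // !tsum_pure // -pure_tsum -!tsum_eta.
- have Fl : linear (fun t => ceps (tens_coalg e f) (tsum t G) : k^o).
    exact: (linear_comp (tens_eps_linear eel fel) Gl).
  apply: (tensor_ext Fl (tens_eps_linear cel del)) => x y.
  by rewrite tens_eps_pure // tsum_pure // -he.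
Qed.

(** A coalgebra morphism s into a tensor product is determined by its components
    (id (x) eps) o s and (eps (x) id) o s, which are coalgebra morphisms and satisfy
    [components_flip]; this is how a braiding operator splits into two actions. *)
Definition cofst E F (f : coalgStr F) (t : tensor E F) : E := \tsum_(a, b <- t) (ceps f b *: a).
Definition cosnd E F (e : coalgStr E) (t : tensor E F) : F := \tsum_(a, b <- t) (ceps e a *: b).

Section Components.
Variables (A E F : lmodType k) (c : coalgStr A) (e : coalgStr E) (f : coalgStr F).
Hypotheses (Hc : is_coalg c) (He : is_coalg e) (Hf : is_coalg f).
Variable s : A -> tensor E F.
Hypothesis sm : coalg_mor c (tens_coalg e f) s.

Lemma cofst_bilinear : bilinear (fun (a : E) (b : F) => ceps f b *: a).
Proof.
split=> [b|a] x u v /=; first by rewrite scalerDr !scalerA mulrC.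
by rewrite (ceps_linear Hf) scalerDl scalerA.
Qed.

Lemma cosnd_bilinear : bilinear (fun (a : E) (b : F) => ceps e a *: b).
Proof.
split=> [b|a] x u v /=; last by rewrite scalerDr !scalerA mulrC.
by rewrite (ceps_linear He) scalerDl scalerA.
Qed.

Lemma cofst_linear : linear (fun t : tensor E F => cofst f t).
Proof. exact: (tsum_linear cofst_bilinear). Qed.
Lemma cosnd_linear : linear (fun t : tensor E F => cosnd e t).
Proof. exact: (tsum_linear cosnd_bilinear). Qed.

Lemma cofst_pure (a : E) (b : F) : cofst f (a \ox b) = ceps f b *: a.
Proof. exact: (tsum_pure _ _ cofst_bilinear). Qed.
Lemma cosnd_pure (a : E) (b : F) : cosnd e (a \ox b) = ceps e a *: b.
Proof. exact: (tsum_pure _ _ cosnd_bilinear). Qed.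

(** The comultiplication of E (x) F, read through linear maps P and Q. The statements about
    components are obtained from it by choosing P and Q among the two projections. *)
Lemma components_expand (W W' : lmodType k) (P : tensor E F -> W) (Q : tensor E F -> W') x :
  linear P -> linear Q ->
  \tsum_(u, v <- cdelta c x) (P (s u) \ox Q (s v)) =
  \tsum_(a, b <- s x) \tsum_(a1, a2 <- cdelta e a) \tsum_(b1, b2 <- cdelta f b)
     (P (a1 \ox b1) \ox Q (a2 \ox b2)).
Proof.
move=> Pl Ql; have sl := coalg_mor_linear sm.
have PQ := tmap_linear Pl Ql; have el := cdelta_linear He; have fl := cdelta_linear Hf.
transitivity (tmap P Q (tmap s s (cdelta c x))).
  rewrite /tmap -[LHS]/(tsum _ _) (tsum_sum_bilinear _ _ (pure_comp_bilinear Pl Ql)).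
  by apply: eq_tsum => u v; rewrite tsum_pure //; exact: pure_comp_bilinear.
rewrite -(coalg_mor_delta sm) [X in cdelta _ X]tsum_eta.
rewrite (linear_tsum _ _ (tens_delta_linear el fl)) (linear_tsum _ _ PQ).
apply: eq_tsum => a b; rewrite tens_delta_pure //.
rewrite (linear_tsum _ _ PQ); apply: eq_tsum => a1 a2.
by rewrite (linear_tsum _ _ PQ); apply: eq_tsum => b1 b2; rewrite tmap_pure.
Qed.

Let p1 := fun t : tensor E F => cofst f t.
Let p2 := fun t : tensor E F => cosnd e t.

Lemma components_eq x : s x = \tsum_(u, v <- cdelta c x) (p1 (s u) \ox p2 (s v)).
Proof.
rewrite (components_expand _ cofst_linear cosnd_linear) [LHS]tsum_eta.
apply: eq_tsum => a b; have [pl pr] := @pure_bilinear k E F.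
rewrite -(counitR a He (pl b)); apply: eq_tsum => a1 a2.
rewrite -(counitL b Hf (pr a1)) (linear_tsum _ _ (linear_scale' _ (@linear_id' _ _))).
apply: eq_tsum => b1 b2; rewrite cofst_pure cosnd_pure.
by rewrite (linearZ' (pl _)) (linearZ' (pr _)) !scalerA mulrC.
Qed.

(** Applying the projections in the opposite order to the same coproduct. *)
Lemma components_flip x :
  \tsum_(u, v <- cdelta c x) (p1 (s u) \ox p2 (s v)) =
  \tsum_(u, v <- cdelta c x) (p1 (s v) \ox p2 (s u)).
Proof.
rewrite -components_eq [LHS]tsum_eta.
transitivity (tswap (\tsum_(u, v <- cdelta c x) (p2 (s u) \ox p1 (s v)))); last first.
  have sb : bilinear (fun (u : F) (v : E) => v \ox u).
    by have [pl pr] := @pure_bilinear k E F; split=> [v|u]; [exact: pr | exact: pl].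
  rewrite /tswap (tsum_sum_bilinear _ _ sb); apply: eq_tsum => u v.
  exact: tsum_pure.
rewrite (components_expand _ cosnd_linear cofst_linear).
have sb : bilinear (fun (u : F) (v : E) => v \ox u).
  by have [pl pr] := @pure_bilinear k E F; split=> [v|u]; [exact: pr | exact: pl].
rewrite /tswap (tsum_sum_bilinear _ _ sb); apply: eq_tsum => a b.
have [pl pr] := @pure_bilinear k E F.
rewrite (tsum_sum_bilinear _ _ sb) -(counitL a He (pl b)); apply: eq_tsum => a1 a2.
rewrite (tsum_sum_bilinear _ _ sb) -(counitR b Hf (pr a2)).
rewrite (linear_tsum _ _ (linear_scale' _ (@linear_id' _ _))).
apply: eq_tsum => b1 b2; rewrite cofst_pure cosnd_pure tsum_pure //.
by rewrite (linearZ' (pl _)) (linearZ' (pr _)) !scalerA mulrC.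
Qed.

Lemma component1_delta x :
  cdelta e (p1 (s x)) = \tsum_(u, v <- cdelta c x) (p1 (s u) \ox p1 (s v)).
Proof.
rewrite (components_expand _ cofst_linear cofst_linear).
have el := cdelta_linear He.
transitivity (cdelta e (\tsum_(a, b <- s x) (ceps f b *: a))); first by [].
rewrite (linear_tsum _ _ el); apply: eq_tsum => a b.
rewrite (linearZ' el) [in LHS](tsum_eta (cdelta e a)) (linear_tsum _ _ (linear_scale' _ (@linear_id' _ _))).
apply: eq_tsum => a1 a2; have [pl pr] := @pure_bilinear k E E.
have gl : linear (fun b => ceps f b *: (a1 \ox a2)) by apply: linear_scaler; exact: ceps_linear Hf.
rewrite -(counitL b Hf gl); apply: eq_tsum => b1 b2.
by rewrite !cofst_pure (linearZ' (pl _)) (linearZ' (pr _)).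
Qed.

Lemma component2_delta x :
  cdelta f (p2 (s x)) = \tsum_(u, v <- cdelta c x) (p2 (s u) \ox p2 (s v)).
Proof.
rewrite (components_expand _ cosnd_linear cosnd_linear).
have fl := cdelta_linear Hf.
transitivity (cdelta f (\tsum_(a, b <- s x) (ceps e a *: b))); first by [].
rewrite (linear_tsum _ _ fl); apply: eq_tsum => a b.
have [pl pr] := @pure_bilinear k F F.
rewrite (linearZ' fl).
have gl : linear (fun a => ceps e a *: cdelta f b) by apply: linear_scaler; exact: ceps_linear He.
rewrite -(counitL a He gl); apply: eq_tsum => a1 a2.
rewrite scalerA [in LHS](tsum_eta (cdelta f b)) (linear_tsum _ _ (linear_scale' _ (@linear_id' _ _))).
apply: eq_tsum => b1 b2.
by rewrite !cosnd_pure (linearZ' (pl _)) (linearZ' (pr _)) scalerA.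
Qed.

Lemma component1_eps x : ceps e (p1 (s x)) = ceps c x.
Proof.
have el : linear (ceps e : E -> k^o) by exact: ceps_linear He.
rewrite -(coalg_mor_eps sm) /p1 /cofst (linear_tsum (F := ceps e : E -> k^o) _ _ el).
by apply: eq_tsum => a b; rewrite (linearZ' el); exact: mulrC.
Qed.

Lemma component2_eps x : ceps f (p2 (s x)) = ceps c x.
Proof.
have el : linear (ceps f : F -> k^o) by exact: ceps_linear Hf.
rewrite -(coalg_mor_eps sm) /p2 /cosnd (linear_tsum (F := ceps f : F -> k^o) _ _ el).
by apply: eq_tsum => a b; rewrite (linearZ' el).
Qed.
End Components.
End CoalgebraMaps.

Section MoreCoalg.
Variables (k : fieldType) (H : hopfAlg k).

Lemma cop_delta_linear : linear (cdelta (cop (hopf_c H))).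
Proof.
have [pl pr] := @pure_bilinear k H H.
apply: (linear_comp (f := @tswap k H H)); last exact: Delta_linear.
by apply: tsum_linear; split=> [v|u]; [exact: pr | exact: pl].
Qed.

Lemma tsum_eps (t : tensor H H) (c : k) :
  \tsum_(a, b <- t) (eps a *: (eps b *: (1 : H))) = c *: 1 ->
  \tsum_(a, b <- t) (eps a * eps b) = c.
Proof.
move=> e; apply: (@scale1_inj _ H); rewrite -e /tsum scaler_suml.
by apply: eq_bigr => p _; rewrite scalerA.
Qed.

Lemma shear_bilinear (o : H -> H -> H) : bilinear o ->
    bilinear (fun x y => \tsum_(y1, y2 <- Delta y) (o x y1 \ox y2)).
Proof.
have [pl pr] := @pure_bilinear k H H; move=> [ol or]; split=> [y|x].
  by apply: tsum_linearP => y1 y2; exact: (linear_comp (pl _) (ol _)).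
apply: tsum_Delta_linear; split=> [y2|y1]; last exact: pr.
exact: (linear_comp (pl _) (or _)).
Qed.

End MoreCoalg.

Definition shear (k : fieldType) (H : hopfAlg k) (dot : H -> H -> H) (t : tensor H H) :=
  \tsum_(x, y <- t) \D_(y1, y2 <- y) (dot x y1 \ox y2).

Section ToSkewBraceEnd.
Variables (k : fieldType) (H : hopfAlg k) (act ract : H -> H -> H).
Hypothesis M : is_mp act ract.

Local Notation S := (hopf_S H).
Local Notation dot := (dot_of ract).
Local Notation col := (col_of act ract).

Ltac swc := unfold_sides;
  sw_with k (sb_th M) H [:: 1 : H] [:: S] [:: @GRing.mul H; act; ract; dot; col].

Lemma skew_coalg : coalg_mor (tens_coalg (hopf_c H) (cop (hopf_c H)))
              (tens_coalg (cop (hopf_c H)) (hopf_c H))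
      (fun t => \tsum_(x, y <- t)
         \tsum_(x1, x2 <- Delta x) \tsum_(y1, y2 <- Delta y)
           (col y1 x2 \ox dot x1 y2)).
Proof.
have [dl dr] := dot_bilinear M; have [cl cr] := col_bilinear M.
have [pl pr] := @pure_bilinear k H H.
apply: tens_coalg_morP; try exact: cop_delta_linear; try exact: Delta_linear; try exact: eps_scalar.
- split=> [y|x].
    apply: tsum_Delta_linear; split=> [x2|x1]; apply: tsum_linearP => y1 y2.
      exact: (linear_comp (pr _) (dl _)).
    exact: (linear_comp (pl _) (cr _)).
  apply: tsum_linearP => x1 x2; apply: tsum_Delta_linear; split=> [y2|y1].
    exact: (linear_comp (pl _) (cl _)).
  exact: (linear_comp (pr _) (dr _)).
- move=> x y; rewrite /cop /tswap /=.
  transitivity (\D_(x1, x2, x3 <- x) \D_(y1, y2, y3 <- y)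
    \tsum_(p, q <- skew12 dot col x2 y2) ((p \ox dot x1 y3) \ox (col y1 x3 \ox q))).
    by swc.
  by rewrite (skewE M); swc.
- move=> x y; rewrite /=; apply: tsum_eps; rewrite -scalerA.
  by swc.
Qed.

(** The inverse is the same map for <| instead of dot, since S is the
    convolution inverse of the identity. *)
Lemma dot_shear_bijective : bijective (fun t : tensor H H =>
    \tsum_(x, y <- t) \tsum_(y1, y2 <- Delta y) (dot x y1 \ox y2)).
Proof.
have bd := shear_bilinear (dot_bilinear M); have br := shear_bilinear (mp_ract_bilinear M).
have ld := tsum_linear bd; have lr := tsum_linear br.
exists (fun t : tensor H H =>
    \tsum_(x, y <- t) \tsum_(y1, y2 <- Delta y) (ract x y1 \ox y2)).
  apply: (tensor_ext (linear_comp lr ld) (@linear_id' _ _)) => x y.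
  rewrite tsum_pure // tsum_sum_bilinear //.
  transitivity (\D_(y1, y2 <- y) (ract x (antL y1) \ox y2)); last by rewrite antLE; swc.
  rewrite /antL; transitivity (\tsum_(y1, y2 <- Delta y) \D_(y3, y4 <- y2) (ract (dot x y1) y3 \ox y4)).
    by apply: eq_tsum => a b; rewrite tsum_pure.
  by swc.
apply: (tensor_ext (linear_comp ld lr) (@linear_id' _ _)) => x y.
rewrite tsum_pure // tsum_sum_bilinear //.
transitivity (\D_(y1, y2 <- y) (ract x (antR y1) \ox y2)); last by rewrite antRE; swc.
rewrite /antR; transitivity (\tsum_(y1, y2 <- Delta y) \D_(y3, y4 <- y2) (dot (ract x y1) y3 \ox y4)).
  by apply: eq_tsum => a b; rewrite tsum_pure.
by swc.
Qed.

Lemma col1 x : col x 1 = x.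
Proof.
transitivity (\D_(x1, x2 <- x) act (ract 1 (S x1)) x2); first by [].
under eq_tsum => a b do rewrite (mp_1ract M).
by swc.
Qed.

Theorem mp_hsb : is_hsb dot col.
Proof.
split.
- exact: (dot_bilinear M).
- exact: (col_bilinear M).
- exact: (eps_dot M).
- exact: (eps_col M).
- exact: (skew_coalg).
- exact: dot_shear_bijective.
- exact: (dot_dot M).
- exact: (dot_col M).
- exact: (col_col M).
- by move=> x; rewrite /dot_of S1 (mp_ract1 M).
- by move=> x y z; rewrite /dot_of SM (mp_ractM M).
- exact: col1.
- exact: (colM M).
- exact: (Mdot M).
- exact: (Mcol M).
- by move=> h m; exact: (congr1 (fun f => f h m) (commE M)).
Qed.
End ToSkewBraceEnd.

(** * From Hopf skew-braces to matched pairs *)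

Section Cop.
Variables (k : fieldType) (H : hopfAlg k).

Lemma cop_tsum (W : lmodType k) (f : H -> H -> W) x : bilinear f ->
  tsum (cdelta (cop (hopf_c H)) x) f = \D_(a, b <- x) f b a.
Proof.
move=> fb; rewrite /= /tswap tsum_sum_bilinear //.
by apply: eq_tsum => a b; rewrite tsum_pure.
Qed.

Lemma cop_coalg : is_coalg (cop (hopf_c H)).
Proof.
have cl := @cop_delta_linear k H; have dl := @Delta_linear k H.
have el := @eps_scalar k H.
have [pl pr] := @pure_bilinear k H H.
have [ql qr] := @pure_bilinear k H (tensor H H).
have tl := @tassoc_linear k H H H.
split=> // x.
- transitivity (\D_(x1, x2, x3 <- x) (x3 \ox (x2 \ox x1))); last first.
    rewrite /tmap cop_tsum; last exact: pure_comp_bilinear.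
    transitivity (\tsum_(b, a <- Delta x) \D_(c, d <- b) (a \ox (d \ox c))).
      by sw_with k (hopf_th H) H [:: 1 : H] [:: hopf_S H] [:: @GRing.mul H].
    by apply: eq_tsum => b a; rewrite -(linear_tsum _ _ (qr a)).
  rewrite /tmap cop_tsum; last exact: pure_comp_bilinear.
  rewrite (linear_tsum _ _ tl); apply: eq_tsum => x1 x'.
  rewrite /tassoc tsum_pure; last exact: tassoc_bilinear.
  rewrite cop_tsum //; split=> [v|u]; first exact: ql.
  exact: (linear_comp (qr _) (pl _)).
- rewrite cop_tsum /=; last exact: scale_eps_bilinear.
  exact: (counit_r x (@linear_id' _ _)).
- have sb : bilinear (fun x1 x2 : H => eps x2 *: x1).
    by split=> [b|a]; [exact: (scale_eps_bilinear H H).2 | exact: (scale_eps_bilinear H H).1].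
  by rewrite cop_tsum //; exact: (counit_l x (@linear_id' _ _)).
Qed.
End Cop.

(** The inverse of a bijection, as a function of the map alone, so that the matched pair of
    a skew-brace depends on the operations only. *)
Definition inverse_of (T : Type) (f : T -> T) : T -> T :=
  if pselect (bijective f) is left b then
    sval (cid (let: Bijective g fg gf := b in ex_intro (fun g => cancel f g /\ cancel g f) g (conj fg gf)))
  else f.

Lemma inverse_ofK (T : Type) (f : T -> T) : bijective f ->
  cancel f (inverse_of f) /\ cancel (inverse_of f) f.
Proof. by rewrite /inverse_of; case: pselect => // b _; case: cid. Qed.

(** The inverse of x (x) y |-> x . y1 (x) y2 has the form x (x) y |-> x <| y1 (x) y2
    ([unshear_pure]), which defines the right action. *)
Definition ract_of (k : fieldType) (H : hopfAlg k) (dot : H -> H -> H) (x y : H) : H :=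
  cofst (hopf_c H) (inverse_of (shear dot) (x \ox y)).

Definition act_of (k : fieldType) (H : hopfAlg k) (dot col : H -> H -> H) (x y : H) : H :=
  \D_(y1, y2 <- y) col y2 (ract_of dot x y1).

Section HsbComponents.
Variables (k : fieldType) (H : hopfAlg k) (dot col : H -> H -> H).
Hypothesis B : is_hsb dot col.

Local Notation S := (hopf_S H).
Local Notation ract := (ract_of dot).
Local Notation act := (act_of dot col).
Local Notation "x |> y" := (act x y) (at level 39, left associativity).
Local Notation "x <| y" := (ract x y) (at level 39, left associativity).

Definition dot_op0 := @Binary k H dot (hsb_dot_bilinear B) None I.
Definition col_op0 := @Binary k H col (hsb_col_bilinear B) None I.
Definition hsb_th0 : theory H := Theory (hopf_rules [::] [:: dot_op0; col_op0]).

Ltac sw0 := unfold_sides; sw_with k hsb_th0 H [:: 1 : H] [:: S] [:: @GRing.mul H; dot; col].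

Let skew_map (t : tensor H H) := \tsum_(x, y <- t) skew12 dot col x y.

Lemma skew_map_pure x y : skew_map (x \ox y) = skew12 dot col x y.
Proof.
have [dl dr] := hsb_dot_bilinear B; have [cl cr] := hsb_col_bilinear B.
have [pl pr] := @pure_bilinear k H H.
rewrite /skew_map tsum_pure //; split=> [b|a].
  apply: tsum_Delta_linear; split=> [x2|x1]; apply: tsum_linearP => y1 y2.
    exact: (linear_comp (pr _) (dl _)).
  exact: (linear_comp (pl _) (cr _)).
apply: tsum_linearP => x1 x2; apply: tsum_Delta_linear; split=> [y2|y1].
  exact: (linear_comp (pl _) (cl _)).
exact: (linear_comp (pr _) (dr _)).
Qed.

Lemma skew_map_fst x y : cofst (hopf_c H) (skew_map (x \ox y)) = col y x.
Proof.
rewrite skew_map_pure (linear_tsum _ _ (cofst_linear (hopf_coalg (hopfP H)))).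
transitivity (\D_(x1, x2 <- x) \D_(y1, y2 <- y) (eps x1 *: (eps y2 *: col y1 x2))); last by sw0.
apply: eq_tsum => x1 x2; rewrite (linear_tsum _ _ (cofst_linear (hopf_coalg (hopfP H)))).
apply: eq_tsum => y1 y2; rewrite cofst_pure; last exact: hopf_coalg (hopfP H).
by rewrite -/(eps _) (hsb_eps_dot B) scalerA.
Qed.

Lemma skew_map_snd x y : cosnd (cop (hopf_c H)) (skew_map (x \ox y)) = dot x y.
Proof.
rewrite skew_map_pure (linear_tsum _ _ (cosnd_linear (cop_coalg H))).
transitivity (\D_(x1, x2 <- x) \D_(y1, y2 <- y) (eps x2 *: (eps y1 *: dot x1 y2))); last by sw0.
apply: eq_tsum => x1 x2; rewrite (linear_tsum _ _ (cosnd_linear (cop_coalg H))).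
apply: eq_tsum => y1 y2; rewrite cosnd_pure; last exact: cop_coalg.
by rewrite /= -/(eps _) (hsb_eps_col B) scalerA [eps y1 * _]mulrC.
Qed.

Let sH := hopf_coalg (hopfP H).
Let sm : coalg_mor (tens_coalg (hopf_c H) (cop (hopf_c H)))
              (tens_coalg (cop (hopf_c H)) (hopf_c H)) skew_map := hsb_coalg B.

Lemma source_delta x y :
  cdelta (tens_coalg (hopf_c H) (cop (hopf_c H))) (x \ox y) =
  \D_(x1, x2 <- x) \D_(y1, y2 <- y) ((x1 \ox y2) \ox (x2 \ox y1)).
Proof.
rewrite tens_delta_pure //; [|exact: Delta_linear|exact: cop_delta_linear].
by rewrite /= /tswap; sw0.
Qed.

Lemma source_tsum (W : lmodType k) (P Q : tensor H H -> W) x y (W' : lmodType k)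
    (f : W -> W -> W') : bilinear f -> linear P -> linear Q ->
  \tsum_(u, v <- cdelta (tens_coalg (hopf_c H) (cop (hopf_c H))) (x \ox y)) f (P u) (Q v) =
  \D_(x1, x2 <- x) \D_(y1, y2 <- y) f (P (x1 \ox y2)) (Q (x2 \ox y1)).
Proof.
move=> [fl fr] Pl Ql; have fb : bilinear (fun u v => f (P u) (Q v)).
  split=> [v|u]; first exact: (linear_comp (fl _) Pl).
  exact: (linear_comp (fr _) Ql).
rewrite source_delta tsum_sum_bilinear //; apply: eq_tsum => x1 x2.
rewrite tsum_sum_bilinear //; apply: eq_tsum => y1 y2.
by rewrite tsum_pure.
Qed.

Let skew_map_linear : linear skew_map := coalg_mor_linear sm.
Let l1 : linear (fun t => cofst (hopf_c H) (skew_map t) : H).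
Proof. exact: (linear_comp (cofst_linear sH) skew_map_linear). Qed.
Let l2 : linear (fun t => cosnd (cop (hopf_c H)) (skew_map t) : H).
Proof. exact: (linear_comp (cosnd_linear (cop_coalg H)) skew_map_linear). Qed.

Lemma hsb_flip : skew12 dot col = skew21 dot col.
Proof.
apply: funext => x; apply: funext => y.
have pb := @pure_bilinear k H H.
have pb' : bilinear (fun a b : H => b \ox a).
  by split=> [b|a]; [exact: pb.2 | exact: pb.1].
have e := etrans (esym (source_tsum x y pb l1 l2))
  (etrans (components_flip (cop_coalg H) sH sm (x \ox y)) (source_tsum x y pb' l2 l1)).
transitivity (\D_(x1, x2 <- x) \D_(y1, y2 <- y)
  (cofst (hopf_c H) (skew_map (x2 \ox y1)) \ox cosnd (cop (hopf_c H)) (skew_map (x1 \ox y2)))).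
  by apply: eq_tsum => x1 x2; apply: eq_tsum => y1 y2; rewrite skew_map_fst skew_map_snd.
rewrite -[LHS]e.
by apply: eq_tsum => x1 x2; apply: eq_tsum => y1 y2; rewrite skew_map_fst skew_map_snd.
Qed.

Lemma hsb_Delta_dot x y : Delta (dot x y) =
  \D_(x1, x2 <- x) \D_(y1, y2 <- y) (dot x1 y2 \ox dot x2 y1).
Proof.
have := component2_delta (cop_coalg H) sH sm (x \ox y).
rewrite (source_tsum x y (@pure_bilinear k H H) l2 l2) skew_map_snd -/(Delta _) => ->.
by apply: eq_tsum => x1 x2; apply: eq_tsum => y1 y2; rewrite !skew_map_snd.
Qed.

Lemma hsb_Delta_col y x : Delta (col y x) =
  \D_(y1, y2 <- y) \D_(x1, x2 <- x) (col y1 x2 \ox col y2 x1).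
Proof.
have pb := @pure_bilinear k H H.
have pb' : bilinear (fun a b : H => b \ox a).
  by split=> [b|a]; [exact: pb.2 | exact: pb.1].
have := component1_delta (cop_coalg H) sH sm (x \ox y).
rewrite (source_tsum x y pb l1 l1) skew_map_fst => e.
rewrite [LHS]tsum_eta -(cop_tsum _ pb') e.
transitivity (\D_(x1, x2 <- x) \D_(y1, y2 <- y) (col y1 x2 \ox col y2 x1)); last by sw0.
rewrite tsum_sum_bilinear //; apply: eq_tsum => x1 x2.
rewrite tsum_sum_bilinear //; apply: eq_tsum => y1 y2.
by rewrite tsum_pure // !skew_map_fst.
Qed.

End HsbComponents.

Section HsbRightAction.
Variables (k : fieldType) (H : hopfAlg k) (dot col : H -> H -> H).
Hypothesis B : is_hsb dot col.

Local Notation S := (hopf_S H).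
Local Notation ract := (ract_of dot).
Local Notation act := (act_of dot col).
Local Notation "x |> y" := (act x y) (at level 39, left associativity).
Local Notation "x <| y" := (ract x y) (at level 39, left associativity).
Local Notation dot_shear := (shear dot).
Local Notation unshear := (inverse_of (shear dot)).

Let dot_shearK : cancel dot_shear unshear. Proof. exact: (inverse_ofK (hsb_inv B)).1. Qed.
Let unshearK : cancel unshear dot_shear. Proof. exact: (inverse_ofK (hsb_inv B)).2. Qed.

Let dot_shear_linear : linear dot_shear. Proof. exact: (tsum_linear (shear_bilinear (hsb_dot_bilinear B))). Qed.
Let unshear_linear : linear unshear.
Proof. by move=> a t u; rewrite -[in LHS](unshearK t) -[in LHS](unshearK u) -dot_shear_linear dot_shearK. Qed.

Lemma shear_pure x y : dot_shear (x \ox y) = \D_(y1, y2 <- y) (dot x y1 \ox y2).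
Proof. exact: (tsum_pure _ _ (shear_bilinear (hsb_dot_bilinear B))). Qed.

Lemma ract_bilinear : bilinear ract.
Proof.
have [pl pr] := @pure_bilinear k H H.
have cl := cofst_linear (E := H) (hopf_coalg (hopfP H)).
split=> [y|x]; apply: (linear_comp cl); apply: (linear_comp unshear_linear); [exact: pl | exact: pr].
Qed.

(** The right coaction id (x) Delta of H (x) H. The shear is a morphism of comodules, hence
    so is its inverse, which is therefore determined by its first component. *)
Let rho (t : tensor H H) : tensor (tensor H H) H :=
  \tsum_(a, b <- t) \D_(b1, b2 <- b) ((a \ox b1) \ox b2).

Let rho_bilinear : bilinear (fun a b : H => \D_(b1, b2 <- b) ((a \ox b1) \ox b2)).
Proof.
have [pl pr] := @pure_bilinear k H H; have [ql qr] := @pure_bilinear k (tensor H H) H.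
split=> [b|a].
  by apply: tsum_linearP => b1 b2; exact: (linear_comp (ql _) (pl _)).
apply: tsum_Delta_linear; split=> [b2|b1]; last exact: qr.
exact: (linear_comp (ql _) (pr _)).
Qed.

Let rho_linear : linear rho. Proof. exact: (tsum_linear rho_bilinear). Qed.

Definition hsb_bare_th := hsb_th0 B.
Ltac sw0 := sw_with k hsb_bare_th H [:: 1 : H] [:: S] [:: @GRing.mul H; dot; col].

Let rho_shear t : rho (dot_shear t) = tmap dot_shear id (rho t).
Proof.
have Tl := tmap_linear dot_shear_linear (@linear_id' _ H).
apply: (tensor_ext (linear_comp rho_linear dot_shear_linear) (linear_comp Tl rho_linear)) => x y.
rewrite shear_pure (linear_tsum _ _ rho_linear).
transitivity (\D_(y1, y2, y3 <- y) ((dot x y1 \ox y2) \ox y3)).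
  by apply: eq_tsum => y1 y'; rewrite /rho tsum_pure.
rewrite /rho tsum_pure // (linear_tsum _ _ Tl).
transitivity (\D_(y1, y' <- y) \D_(y2, y3 <- y1) ((dot x y2 \ox y3) \ox y')); first by sw0.
apply: eq_tsum => y1 y'; rewrite tmap_pure // shear_pure.
by have [ql qr] := @pure_bilinear k (tensor H H) H; rewrite (linear_tsum _ _ (ql _)).
Qed.

Let rho_unshear t : rho (unshear t) = tmap unshear id (rho t).
Proof.
rewrite -[in RHS](unshearK t) rho_shear tmap_comp // (_ : (fun x => unshear (dot_shear x)) = id).
  by rewrite tmap_id.
by apply: funext => x; exact: dot_shearK.
Qed.

Lemma unshear_pure x y : unshear (x \ox y) = \D_(y1, y2 <- y) ((x <| y1) \ox y2).
Proof.
have sH := hopf_coalg (hopfP H).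
have cl := cofst_linear (E := H) sH.
have Tl := tmap_linear cl (@linear_id' _ H).
have [pl pr] := @pure_bilinear k H H.
have e t : tmap (cofst (hopf_c H)) id (rho t) = t.
  apply: (tensor_ext (linear_comp Tl rho_linear) (@linear_id' _ _)) => a b.
  rewrite /rho tsum_pure // (linear_tsum _ _ Tl).
  transitivity (\D_(b1, b2 <- b) (eps b1 *: (a \ox b2))); last by sw0.
  by apply: eq_tsum => b1 b2; rewrite tmap_pure // cofst_pure // (linearZ' (pl _)).
rewrite -[LHS]e rho_unshear tmap_comp // /rho tsum_pure //.
rewrite (linear_tsum _ _ (tmap_linear (linear_comp cl unshear_linear) (@linear_id' _ H))).
by apply: eq_tsum => y1 y2; rewrite tmap_pure //; exact: linear_comp cl unshear_linear.
Qed.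

Definition counit_right (x y : H) : H := eps y *: x.
Definition ract_then_dot x y := \D_(y1, y2 <- y) dot (x <| y1) y2.
Definition dot_then_ract x y := \D_(y1, y2 <- y) (dot x y1 <| y2).

Let inverse_counit_right (o o' : H -> H -> H) (Q Q' : tensor H H -> tensor H H) :
  bilinear o -> bilinear o' -> linear Q -> linear Q' -> cancel Q Q' ->
  (forall x y, Q (x \ox y) = \D_(y1, y2 <- y) (o x y1 \ox y2)) ->
  (forall x y, Q' (x \ox y) = \D_(y1, y2 <- y) (o' x y1 \ox y2)) ->
  forall x y, \D_(y1, y2 <- y) o' (o x y1) y2 = counit_right x y.
Proof.
move=> ob ob' Ql Ql' QK Qe Qe' x y.
have sH := hopf_coalg (hopfP H); have cl := cofst_linear (E := H) sH.
have := congr1 (cofst (hopf_c H)) (QK (x \ox y)).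
rewrite cofst_pure // Qe (linear_tsum _ _ Ql') (linear_tsum _ _ cl) => e.
rewrite -[RHS]/(ceps (hopf_c H) y *: x) -e.
have h a y' : cofst (hopf_c H) (Q' (a \ox y')) = o' a y'.
  rewrite Qe' (linear_tsum _ _ cl) -[RHS](counit_r y' (ob'.2 a)).
  by apply: eq_tsum => b c; rewrite cofst_pure.
by apply: eq_tsum => y1 y2; rewrite h.
Qed.

Lemma ract_dot : ract_then_dot = counit_right.
Proof.
apply: funext => x; apply: funext => y.
exact: (inverse_counit_right ract_bilinear (hsb_dot_bilinear B) unshear_linear dot_shear_linear unshearK unshear_pure shear_pure).
Qed.

Lemma dot_ract : dot_then_ract = counit_right.
Proof.
apply: funext => x; apply: funext => y.
exact: (inverse_counit_right (hsb_dot_bilinear B) ract_bilinear dot_shear_linear unshear_linear dot_shearK shear_pure unshear_pure).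
Qed.

(** The shear is a change of variables: a bilinear identity may be checked at x . y1 and
    y2. *)
Lemma shear_ext (W : lmodType k) (f g : H -> H -> W) : bilinear f -> bilinear g ->
  (forall x y, \D_(y1, y2 <- y) f (dot x y1) y2 = \D_(y1, y2 <- y) g (dot x y1) y2) ->
  forall x y, f x y = g x y.
Proof.
move=> fb gb h x y.
rewrite -(tsum_pure x y fb) -(tsum_pure x y gb) -(unshearK (x \ox y)).
have fl := tsum_linear fb; have gl := tsum_linear gb.
apply: (tensor_ext (linear_comp fl dot_shear_linear) (linear_comp gl dot_shear_linear)) => a b.
rewrite shear_pure !tsum_sum_bilinear //.
transitivity (\D_(y1, y2 <- b) f (dot a y1) y2); first by apply: eq_tsum => *; rewrite tsum_pure.
by rewrite h; apply: eq_tsum => *; rewrite tsum_pure.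
Qed.

Definition dot_op1 := @Binary k H dot (hsb_dot_bilinear B) (Some (false, true))
  (conj (hsb_Delta_dot B) (hsb_eps_dot B)).
Definition col_op1 := @Binary k H col (hsb_col_bilinear B) (Some (false, true))
  (conj (hsb_Delta_col B) (hsb_eps_col B)).
Definition ract_op1 := @Binary k H ract ract_bilinear None I.

Definition hsb_dot_ops := [:: dot_op1; col_op1; ract_op1].
Definition hsb_dot_sig := hopf_sig [::] hsb_dot_ops.
Definition hsb_dot_th : theory H := Theory (hopf_rules [::] hsb_dot_ops ++
 [:: @Rule k H hsb_dot_sig (B2 1 (Lf 0) (Cs 0)) (Lf 0) (fun v => hsb_dot1 B _);
     @Rule k H hsb_dot_sig (B2 2 (Lf 0) (Cs 0)) (Lf 0) (fun v => hsb_col1 B _);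
     @Rule k H hsb_dot_sig (B2 1 (B2 1 (Lf 0) (Lf 1)) (Lf 2)) (B2 1 (Lf 0) (B2 0 (Lf 2) (Lf 1)))
       (fun v => hsb_dotM B _ _ _);
     @Rule k H hsb_dot_sig (B2 2 (B2 2 (Lf 0) (Lf 1)) (Lf 2)) (B2 2 (Lf 0) (B2 0 (Lf 2) (Lf 1)))
       (fun v => hsb_colM B _ _ _)]).

Ltac sw1 := unfold_sides; cbv delta [counit_right ract_then_dot dot_then_ract];
  sw_with k hsb_dot_th H [:: 1 : H] [:: S] [:: @GRing.mul H; dot; col; ract].

Lemma hsb_ract1 x : x <| 1 = x.
Proof.
transitivity (dot_then_ract x 1); first by sw1.
by rewrite dot_ract; sw1.
Qed.

Lemma hsb_ractM x y z : x <| (y * z) = (x <| y) <| z.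
Proof.
transitivity (\D_(y1, y2 <- y) (counit_right x y1 <| (y2 * z))); first by sw1.
rewrite -ract_dot; transitivity (\D_(y1, y2, y3 <- y) \D_(z1, z2 <- z)
  (dot (counit_right (x <| y1) z1) y2 <| (y3 * z2))); first by sw1.
rewrite -ract_dot; transitivity (\D_(y1, y2 <- y) \D_(z1, z2 <- z)
  dot_then_ract ((x <| y1) <| z1) (y2 * z2)); first by sw1.
by rewrite dot_ract; sw1.
Qed.

(** As . inverts <|, it is the action of the antipode. *)
Lemma hsb_dot_ract x y : dot x y = x <| S y.
Proof.
transitivity (\D_(y1, y2 <- y) (dot x y1 <| scal y2)).
  rewrite /scal; transitivity (\D_(y1, y2 <- y) (eps y2 *: (dot x y1 <| 1))); last by sw1.
  by under [RHS]eq_tsum => a b do rewrite hsb_ract1; sw1.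
rewrite -antRE; transitivity (\D_(y1, y2, y3 <- y) ((dot x y1 <| y2) <| S y3)).
  rewrite /antR; transitivity (\D_(y1, y2, y3 <- y) (dot x y1 <| (y2 * S y3))).
    by sw1.
  by apply: eq_tsum => *; apply: eq_tsum => *; rewrite hsb_ractM.
transitivity (\D_(y1, y2 <- y) (dot_then_ract x y1 <| S y2)); first by sw1.
by rewrite dot_ract; sw1.
Qed.

Lemma hsb_Delta_ract x y : Delta (x <| y) =
  \D_(x1, x2 <- x) \D_(y1, y2 <- y) ((x1 <| y1) \ox (x2 <| y2)).
Proof.
have dl := @Delta_linear k H; have [rl rr] := ract_bilinear.
have [pl pr] := @pure_bilinear k H H.
move: x y; apply: shear_ext => [||x y].
- split=> [y|x]; [exact: (linear_comp dl (rl y)) | exact: (linear_comp dl (rr x))].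
- split=> [y|x].
    apply: tsum_Delta_linear; split=> [x2|x1]; apply: tsum_linearP => y1 y2.
      exact: (linear_comp (pl _) (rl _)).
    exact: (linear_comp (pr _) (rl _)).
  apply: tsum_linearP => x1 x2; apply: tsum_Delta_linear; split=> [y2|y1].
    exact: (linear_comp (pl _) (rr _)).
  exact: (linear_comp (pr _) (rr _)).
transitivity (Delta (dot_then_ract x y)); first by rewrite /dot_then_ract (linear_tsum _ _ dl).
rewrite dot_ract; transitivity (\D_(x1, x2 <- x) (x1 \ox counit_right x2 y)).
  by rewrite [LHS]tsum_eta; sw1.
rewrite -dot_ract; transitivity (\D_(x1, x2 <- x) \D_(y1, y3, y4 <- y) (counit_right x1 y3 \ox (dot x2 y1 <| y4))); first by sw1.
by rewrite -dot_ract; sw1.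
Qed.

Lemma hsb_eps_ract x y : eps (x <| y) = eps x * eps y.
Proof.
have el : linear (@eps k H : H -> k^o) by exact: eps_scalar.
have [rl rr] := ract_bilinear.
apply: (shear_ext (f := fun x y => eps (x <| y) : k^o) (g := fun x y => eps x * eps y : k^o)) => [||{}x {}y].
- split=> [y'|x']; [exact: (linear_comp el (rl _)) | exact: (linear_comp el (rr _))].
- split=> [y'|x'] a u v /=; first by rewrite eps_scalar mulrDl -mulrA.
  by rewrite eps_scalar mulrDr mulrCA.
transitivity (eps (dot_then_ract x y)); first by rewrite /dot_then_ract (linear_tsum (F := @eps k H : H -> k^o) _ _ el).
rewrite dot_ract /counit_right (linearZ' el) -[LHS](counit_l (f := fun z => eps z * eps x : k^o)); last first.
  by move=> a u v; rewrite eps_scalar /= mulrDl -mulrA.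
apply: eq_tsum => a b; rewrite (hsb_eps_dot B) /GRing.scale /=.
by rewrite [eps x * eps a]mulrC -mulrA [eps x * _]mulrC.
Qed.
End HsbRightAction.

Section HsbMatchedPair.
Variables (k : fieldType) (H : hopfAlg k) (dot col : H -> H -> H).
Hypothesis B : is_hsb dot col.

Local Notation S := (hopf_S H).
Local Notation ract := (ract_of dot).
Local Notation act := (act_of dot col).
Local Notation "x |> y" := (act x y) (at level 39, left associativity).
Local Notation "x <| y" := (ract x y) (at level 39, left associativity).

Definition ract_op2 := @Binary k H ract (ract_bilinear B) (Some (false, false))
  (conj (hsb_Delta_ract B) (hsb_eps_ract B)).

Definition hsb_mp_ops := [:: dot_op1 B; col_op1 B; ract_op2].
Definition hsb_mp_rules bs : seq (rule (hopf_sig [::] (hsb_mp_ops ++ bs))) :=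
  let sg := hopf_sig [::] (hsb_mp_ops ++ bs) in
 [:: @Rule k H sg (B2 1 (Lf 0) (Lf 1)) (B2 3 (Lf 0) (U1 0 (Lf 1))) (fun v => hsb_dot_ract B _ _);
     @Rule k H sg (B2 2 (Lf 0) (Cs 0)) (Lf 0) (fun v => hsb_col1 B _);
     @Rule k H sg (B2 3 (Lf 0) (Cs 0)) (Lf 0) (fun v => hsb_ract1 B _);
     @Rule k H sg (B2 2 (B2 2 (Lf 0) (Lf 1)) (Lf 2)) (B2 2 (Lf 0) (B2 0 (Lf 2) (Lf 1)))
       (fun v => hsb_colM B _ _ _);
     @Rule k H sg (B2 3 (Lf 0) (B2 0 (Lf 1) (Lf 2))) (B2 3 (B2 3 (Lf 0) (Lf 1)) (Lf 2))
       (fun v => hsb_ractM B _ _ _)].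
Definition hsb_ract_th : theory H := Theory (hopf_rules [::] (hsb_mp_ops ++ [::]) ++ hsb_mp_rules [::]).

(* [sw3] unfolds act, [sw4] treats it as an operation with a known coproduct *)
Ltac sw3 := unfold_sides; cbv delta [act_of];
  sw_with k hsb_ract_th H [:: 1 : H] [:: S] [:: @GRing.mul H; dot; col; ract].

Local Notation flipL := (pair12 act ract).
Local Notation flipR := (pair21 act ract).

(** The coalgebra morphism axiom in the variables x <| y1 and y2. *)
Lemma hsb_act_flip : flipL = flipR.
Proof.
apply: funext => x; apply: funext => y; symmetry.
transitivity (\D_(y1, y2, y3 <- y) \tsum_(p, q <- skew12 dot col (x <| y1) y2) (p \ox (q <| y3))).
  transitivity (\D_(x1, x2 <- x) \D_(y1, y2, y3, y4 <- y)
    (col y3 (x2 <| y2) \ox ((x1 <| y1) <| antL y4))); last by rewrite /skew12; sw3.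
  by rewrite antLE; sw3.
rewrite (hsb_flip B); transitivity (\D_(x1, x2 <- x) \D_(y1, y2, y3, y4 <- y)
    (col y3 (x1 <| y1) \ox ((x2 <| antR y2) <| y4))); first by rewrite /skew21; sw3.
by rewrite antRE; sw3.
Qed.

Lemma hsb_act_bilinear : bilinear act.
Proof.
have [cl cr] := hsb_col_bilinear B; have [rl rr] := ract_bilinear B.
split=> [y|x].
  by apply: tsum_linearP => y1 y2; exact: (linear_comp (cr _) (rl _)).
apply: tsum_Delta_linear; split=> [y2|y1]; last exact: cl.
exact: (linear_comp (cr _) (rr _)).
Qed.

Lemma hsb_Delta_act x y : Delta (x |> y) =
  \D_(x1, x2 <- x) \D_(y1, y2 <- y) ((x1 |> y1) \ox (x2 |> y2)).
Proof.
transitivity (\D_(y1, y2 <- y) \tsum_(p, q <- flipR x y1) (p \ox col y2 q)).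
  by rewrite [LHS]tsum_eta; sw3.
rewrite -hsb_act_flip.
transitivity (\D_(x1, x2 <- x) \D_(y1, y2, y3 <- y) ((x1 |> y1) \ox col y3 (x2 <| y2))).
  by sw3.
transitivity (\D_(x1, x2 <- x) \D_(y1, y2, y3 <- y) ((\D_(a, b <- y1) col b (x1 <| a)) \ox col y3 (x2 <| y2))).
  by [].
transitivity (\D_(x1, x2 <- x) \D_(y1, y2 <- y) \D_(c, d <- y1) \D_(e, f <- y2)
   (col d (x1 <| c) \ox col f (x2 <| e))); first by sw3.
have [pl pr] := @pure_bilinear k H H.
apply: eq_tsum => x1 x2; apply: eq_tsum => y1 y2; exact: esym (pure_tsum _ _ _ _).
Qed.

Lemma hsb_eps_act x y : eps (x |> y) = eps x * eps y.
Proof.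
have el : linear (@eps k H : H -> k^o) by exact: eps_scalar.
rewrite /act_of (linear_tsum (F := @eps k H : H -> k^o) _ _ el).
rewrite -[RHS](counit_l (f := fun b => eps x * eps b : k^o)); last first.
  by move=> a u v; rewrite eps_scalar /= mulrDr mulrCA.
apply: eq_tsum => a b; rewrite (hsb_eps_col B) (hsb_eps_ract B) /GRing.scale /=.
by rewrite [eps b * _]mulrC -mulrA mulrCA.
Qed.

Definition act_op2 := @Binary k H act hsb_act_bilinear (Some (false, false))
  (conj hsb_Delta_act hsb_eps_act).
Definition hsb_act_th : theory H := Theory (hopf_rules [::] (hsb_mp_ops ++ [:: act_op2])
  ++ hsb_mp_rules [:: act_op2]).
Ltac sw4 := unfold_sides;
  sw_with k hsb_act_th H [:: 1 : H] [:: S] [:: @GRing.mul H; dot; col; ract; act].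

Lemma hsb_commE : comm_col col = comm_dot dot.
Proof. by apply: funext => x; apply: funext => y; exact: (hsb_comm B). Qed.

Lemma hsb_braided_comm x y : x * y = \D_(x1, x2 <- x) \D_(y1, y2 <- y) ((x1 |> y1) * (x2 <| y2)).
Proof.
transitivity (\tsum_(p, q <- flipL x y) (p * q)); last by sw4.
rewrite hsb_act_flip; transitivity (\D_(y1, y2 <- y) comm_col col (x <| y1) y2); last by rewrite /comm_col; sw3.
rewrite hsb_commE; transitivity (\D_(y1, y2 <- y) ((x <| antR y1) * y2)); last by rewrite /comm_dot; sw3.
by rewrite antRE; sw3.
Qed.

(** Commutativity at h = 1 gives 1 . l1 * l2 = l, whence 1 . l is a scalar by the antipode. *)
Lemma hsb_1dot y : dot 1 y = scal y.
Proof.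
transitivity (\D_(y1, y2 <- y) (dot 1 y1 * scal y2)); first by sw3.
rewrite -antRE; transitivity (\D_(y1, y2 <- y) (comm_dot dot 1 y1 * S y2)); first by rewrite /comm_dot; sw3.
rewrite -hsb_commE; transitivity (antR y); first by rewrite /comm_col; sw3.
by rewrite antRE.
Qed.

Lemma hsb_1ract y : 1 <| y = eps y *: 1.
Proof.
transitivity (\D_(y1, y2 <- y) (scal y1 <| y2)); first by sw3.
under eq_tsum => a b do rewrite -hsb_1dot.
transitivity (1 <| antL y); first by sw3.
by rewrite antLE; sw3.
Qed.

Lemma hsb_1act y : 1 |> y = y.
Proof.
transitivity (\D_(y1, y2 <- y) col y2 (1 <| y1)); first by [].
under eq_tsum => a b do rewrite hsb_1ract.
by sw3.
Qed.

(** The map x |-> x |> 1 is a convolution idempotent, because 1 * 1 = 1 and col is compatible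
    with products, and it is convolution invertible, being a coalgebra map. *)
Lemma hsb_act1 x : x |> 1 = eps x *: 1.
Proof.
have e l : col 1 l = l |> 1 by symmetry; sw3.
have ee l : \D_(l1, l2 <- l) ((l1 |> 1) * (l2 |> 1)) = l |> 1.
  transitivity (col (1 * 1) l); last by rewrite mulr1.
  rewrite (hsb_Mcol B); under eq_tsum => a b do rewrite -!e.
  by sw3.
transitivity (\D_(x1, x2 <- x) ((x1 |> 1) * scal (x2 |> 1))); first by sw4.
rewrite -antRE.
transitivity (\D_(x1, x2 <- x) ((\D_(a, b <- x1) ((a |> 1) * (b |> 1))) * S (x2 |> 1))).
  by sw4.
under eq_tsum => a b do rewrite ee.
transitivity (antR (x |> 1)); first by sw4.
by rewrite antRE; sw4.
Qed.

Lemma hsb_MdotE : dot_of_mul dot = dot_each dot col.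
Proof. by do 3 apply: funext => ?; exact: (hsb_Mdot B). Qed.
Lemma hsb_McolE : dot_of_mul col = dot_each col dot.
Proof. by do 3 apply: funext => ?; exact: (hsb_Mcol B). Qed.

(** The axiom for (x y) . z in the variables of the right action; [hsb_act_flip] brings the
    components in the order in which the antipode cancels. *)
Lemma hsb_mul_ract h m l : (h * m) <| l =
  \D_(m1, m2 <- m) \D_(l1, l2 <- l) ((h <| (m1 |> l1)) * (m2 <| l2)).
Proof.
symmetry; transitivity (\D_(m1, m2 <- m) \D_(l1, l2, l3 <- l)
   (((h <| (m1 |> l1)) * (m2 <| l2)) <| antL l3)); first by rewrite antLE; sw4.
transitivity (\D_(m1, m2 <- m) \D_(l1, l2, l3, l4 <- l)
   (dot_of_mul dot (h <| (m1 |> l1)) (m2 <| l2) l3 <| l4)); first by rewrite /dot_of_mul; sw4.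
rewrite hsb_MdotE.
transitivity (\D_(m1, m2 <- m) \D_(l1, l2, l3, l4 <- l)
  \tsum_(p, q <- flipR m2 l2)
   ((((h <| (m1 |> l1)) <| S p) * (q <| S l3)) <| l4)); first by rewrite /dot_each; sw3.
rewrite -hsb_act_flip.
transitivity (\D_(m1, m2 <- m) \D_(l1, l2, l3 <- l)
   (((h <| antR (m1 |> l1)) * (m2 <| antR l2)) <| l3)); first by sw4.
by rewrite antRE; sw4.
Qed.

Lemma hsb_mul_ractE : ract_of_mul ract = ract_each act ract.
Proof. by do 3 apply: funext => ?; exact: hsb_mul_ract. Qed.

Lemma hsb_actM x y z : (x * y) |> z = x |> (y |> z).
Proof.
transitivity (\D_(z1, z2 <- z) col z2 (ract_of_mul ract x y z1)); first by rewrite /ract_of_mul; sw3.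
rewrite hsb_mul_ractE.
transitivity (\D_(w1, w2 <- y |> z) col w2 (x <| w1)); last by [].
transitivity (\D_(y1, y2 <- y) \D_(z1, z2 <- z) col (y2 |> z2) (x <| (y1 |> z1))); last by sw4.
transitivity (\D_(y1, y2 <- y) \D_(z1, z2 <- z) col (\D_(a, b <- z2) col b (y2 <| a)) (x <| (y1 |> z1))).
  by rewrite /ract_each; sw4.
by [].
Qed.

Lemma hsb_act_mul x y z : x |> (y * z) =
  \D_(x1, x2 <- x) \D_(y1, y2 <- y) ((x1 |> y1) * ((x2 <| y2) |> z)).
Proof.
transitivity (\D_(y1, y2 <- y) \D_(z1, z2 <- z) dot_of_mul col y2 z2 ((x <| y1) <| z1)).
  by rewrite /dot_of_mul; sw3.
rewrite hsb_McolE.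
transitivity (\D_(y1, y2 <- y) \D_(z1, z2 <- z) \tsum_(p, q <- flipR (x <| y1) z1)
   (col y2 (q <| S z2) * p)); first by rewrite /dot_each; sw3.
rewrite -hsb_act_flip.
transitivity (\D_(x1, x2 <- x) \D_(y1, y2, y3 <- y) \D_(z1, z2 <- z)
  (col y3 ((x2 <| y2) <| antR z2) * ((x1 <| y1) |> z1))); first by sw4.
rewrite antRE; transitivity (\tsum_(p, q <- flipR x y) (p * (q |> z))); first by sw3.
by rewrite -hsb_act_flip; sw4.
Qed.

Theorem hsb_mp : is_mp act ract.
Proof.
split.
- exact: hsb_act_bilinear.
- exact: (ract_bilinear B).
- exact: hsb_Delta_act.
- exact: hsb_eps_act.
- exact: (hsb_Delta_ract B).
- exact: (hsb_eps_ract B).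
- exact: hsb_1act.
- exact: hsb_actM.
- exact: hsb_act1.
- exact: (hsb_ract1 B).
- exact: (hsb_ractM B).
- exact: hsb_1ract.
- exact: hsb_act_mul.
- exact: hsb_mul_ract.
- by move=> x y; exact: (congr1 (fun f => f x y) hsb_act_flip).
- exact: hsb_braided_comm.
Qed.

Lemma hsb_roundtrip : dot_of ract = dot /\ col_of act ract = col.
Proof.
split; apply: funext => x; apply: funext => y; first by rewrite (hsb_dot_ract B).
transitivity (\D_(x1, x2 <- x) ((y <| S x1) |> x2)); first by [].
transitivity (\D_(x1, x2 <- x) col x2 (y <| antL x1)); first by sw3.
by rewrite antLE; sw3.
Qed.

End HsbMatchedPair.

Section MpRoundtrip.
Variables (k : fieldType) (H : hopfAlg k) (act ract : H -> H -> H).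
Hypothesis M : is_mp act ract.
Ltac sw := cbv delta [scal antL antR dot_of];
  sw_with k (mp_th M) H [:: 1 : H] [:: hopf_S H] [:: @GRing.mul H; act; ract].

Let ract' := ract_of (dot_of ract).
Let ops := [:: act_op M; ract_op M; @Binary k H ract' (ract_bilinear (mp_hsb M)) None I].
Let sg := hopf_sig [::] ops.
Let th : theory H := Theory (hopf_rules [::] ops ++
 [:: @Rule k H sg (B2 2 (Lf 0) (Cs 0)) (Lf 0) (fun v => mp_ract1 M _);
     @Rule k H sg (B2 2 (Lf 0) (B2 0 (Lf 1) (Lf 2))) (B2 2 (B2 2 (Lf 0) (Lf 1)) (Lf 2))
       (fun v => mp_ractM M _ _ _)]).
Ltac sw' := cbv delta [scal antL antR dot_of ract_then_dot counit_right];
  sw_with k th H [:: 1 : H] [:: hopf_S H] [:: @GRing.mul H; act; ract; ract'].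

(** Both right actions are inverse to . in the sense of [ract_dot]. *)
Lemma mp_roundtrip_ract : ract' = ract.
Proof.
apply: funext => x; apply: funext => y.
transitivity (\D_(y1, y2 <- y) ract (ract' x y1) (antL y2)); first by rewrite antLE; sw'.
transitivity (\D_(y1, y2 <- y) ract (ract_then_dot (dot_of ract) x y1) y2).
  rewrite /ract_then_dot -/ract'; sw'.
by rewrite (ract_dot (mp_hsb M)); sw'.
Qed.

Lemma mp_roundtrip_act : act_of (dot_of ract) (col_of act ract) = act.
Proof.
apply: funext => x; apply: funext => y; rewrite /act_of -/ract' mp_roundtrip_ract.
transitivity (\D_(y1, y2 <- y) act (ract x (antR y1)) y2); first by rewrite /col_of; sw.
by rewrite antRE; sw.
Qed.
End MpRoundtrip.

(** * From matched pairs to Yetter-Drinfeld braces *)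

(** In the group case x * y = x (x^-1 |> y), the other group law of the brace, and
    x |> x^-1 is the inverse of x for it. *)
Definition times_of (k : fieldType) (H : hopfAlg k) (act : H -> H -> H) (x y : H) : H :=
  \D_(x1, x2 <- x) (x1 * act (hopf_S H x2) y).
Definition T_of (k : fieldType) (H : hopfAlg k) (act : H -> H -> H) (x : H) : H :=
  \D_(x1, x2 <- x) act x1 (hopf_S H x2).

Section ToYDBrace.
Variables (k : fieldType) (H : hopfAlg k) (act ract : H -> H -> H).
Hypothesis M : is_mp act ract.

Local Notation S := (hopf_S H).
Local Notation "x |> y" := (act x y) (at level 39, left associativity).
Local Notation "x <| y" := (ract x y) (at level 39, left associativity).
Local Notation flipL := (pair12 act ract).
Local Notation flipR := (pair21 act ract).
Local Notation flipE := (flipE M).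
Local Notation comR := (pair_mul act ract).
Local Notation comE := (comE M).
Local Notation times := (times_of act).
Local Notation T := (T_of act).

Lemma times_bilinear : bilinear times.
Proof.
have [al ar] := mp_act_bilinear M; have [ml mr] := mul_bilinear H.
split=> [y|x].
  apply: tsum_Delta_linear; split=> [b|a]; first exact: ml.
  apply: (linear_comp (mr _)); exact: (linear_comp (al y) (@S_linear k H)).
by apply: tsum_linearP => a b; exact: (linear_comp (mr _) (ar _)).
Qed.

Lemma T_linear : linear T.
Proof.
have [al ar] := mp_act_bilinear M.
apply: tsum_Delta_linear; split=> [b|a]; first exact: al.
exact: (linear_comp (ar a) (@S_linear k H)).
Qed.

Definition times_op := @Binary k H times times_bilinear None I.
Definition T_op := @Unary k H T T_linear None I.

Definition yd_ops := [:: act_op M; ract_op M; times_op].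
Definition yd_sig := hopf_sig [:: T_op] yd_ops.

Definition yd_th : theory H := Theory (hopf_rules [:: T_op] yd_ops ++
 [:: @Rule k H yd_sig (B2 1 (Cs 0) (Lf 0)) (Lf 0) (fun v => mp_1act M _);
     @Rule k H yd_sig (B2 2 (Lf 0) (Cs 0)) (Lf 0) (fun v => mp_ract1 M _);
     @Rule k H yd_sig (B2 1 (B2 0 (Lf 0) (Lf 1)) (Lf 2)) (B2 1 (Lf 0) (B2 1 (Lf 1) (Lf 2)))
       (fun v => mp_actM M _ _ _);
     @Rule k H yd_sig (B2 2 (Lf 0) (B2 0 (Lf 1) (Lf 2))) (B2 2 (B2 2 (Lf 0) (Lf 1)) (Lf 2))
       (fun v => mp_ractM M _ _ _)]).

Ltac sw_core := sw_with k yd_th H [:: 1 : H] [:: S; T] [:: @GRing.mul H; act; ract; times].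
Ltac sw := unfold_sides; cbv delta [ydb_coact]; sw_core.
(* [sw] treats the derived operations as mere bilinear maps, [swu] unfolds them *)
Ltac swu := unfold_sides; cbv delta [ydb_coact times_of T_of]; sw_core.

Definition act_one x := x |> 1.
Lemma act_oneE : act_one = @scal k H.
Proof. by apply: funext => x; exact: (mp_act1 M). Qed.

(** This undoes the definition: x y = x1 * (x2 |> y) for the new product. *)
Lemma times_lactE : times_lact times act = mulH (H := H).
Proof.
apply: funext => x; apply: funext => y.
transitivity (\D_(x1, x2 <- x) (x1 * (antL x2 |> y))); first by rewrite /times_lact; swu.
by rewrite antLE; sw.
Qed.

(** Braided commutativity turns the compatibility of |> with the old product into
    compatibility with the new one: |> acts by module algebra maps. *)
Lemma lact_timesE : lact_times act times = lact_times_each act times.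
Proof.
apply: funext => x; apply: funext => y; apply: funext => w; rewrite /lact_times_each; symmetry.
transitivity (\D_(x1, x2, x3 <- x) \D_(y1, y2, y3 <- y)
  ((x1 |> y1) * ((S (x2 |> y2) * (x3 * scal y3)) |> w))); first by swu.
rewrite -antRE.
transitivity (\D_(x1, x2, x3 <- x) \D_(y1, y2, y3, y4 <- y) ((x1 |> y1) * ((S (x2 |> y2) * mulH x3 y3) |> (S y4 |> w)))); first by sw.
rewrite -comE.
transitivity (\D_(x1, x2, x3 <- x) \D_(y1, y2, y3, y4 <- y) ((x1 |> y1) * ((antL (x2 |> y2) * (x3 <| y3)) |> (S y4 |> w)))); first by sw.
rewrite antLE; transitivity (\D_(y1, y2 <- y) act_each act ract x y1 (S y2 |> w)); first by sw.
by rewrite act_of_mulE // /lact_times; swu.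
Qed.

Definition timesA_left x y z := times (times x y) z.
Definition timesA_right x y z := times x (times y z).
Lemma timesAE : timesA_left = timesA_right.
Proof.
apply: funext => x; apply: funext => y; apply: funext => z.
transitivity (\D_(x1, x2 <- x) (x1 * lact_times_each act times (S x2) y z)); first by rewrite /timesA_left /lact_times_each; swu.
rewrite -lact_timesE; transitivity (\D_(x1, x2 <- x) (x1 * (S x2 |> times y z))); first by [].
by [].
Qed.

Lemma times1l y : times 1 y = y. Proof. by swu. Qed.
Lemma times1r x : times x 1 = x.
Proof.
transitivity (\D_(x1, x2 <- x) (x1 * act_one (S x2))); first by [].
by rewrite act_oneE; sw.
Qed.

Lemma times_TE : times_T times T = @scal k H.
Proof.
apply: funext => x; transitivity (\D_(x1, x2, x3 <- x) (x1 * (antL x2 |> S x3))).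
  by rewrite /times_T; swu.
by rewrite antLE; transitivity (antR x); [sw | rewrite antRE].
Qed.

Definition Ttimes x y := times (T x) y.
Definition Ttimes_act x y := \D_(x1, x2 <- x) (x1 |> (S x2 * y)).
(** Multiplication by x on the left, followed by the candidate x1 |> (S x2 -) for
    multiplication by T x. *)
Definition unwind x y := \D_(x1, x2, x3 <- x) (x1 |> (S x2 * times x3 y)).

Lemma unwindE : unwind = (fun x y => eps x *: y).
Proof.
apply: funext => x; apply: funext => y.
transitivity (\D_(x1, x2, x3 <- x) (x1 |> (antL x2 * (S x3 |> y)))).
  by rewrite /unwind; swu.
rewrite antLE; transitivity (antR x |> y); first by sw.
by rewrite antRE; sw.
Qed.

(** Evaluate x1 |> (S x2 (x3 * (T x4 * y))) in two ways, by [unwindE] and by associativity. *)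
Lemma TtimesE : Ttimes = Ttimes_act.
Proof.
apply: funext => x; apply: funext => y.
transitivity (\D_(x1, x2 <- x) (eps x1 *: (times (T x2) y))); first by rewrite /Ttimes; sw.
transitivity (\D_(x1, x2 <- x) unwind x1 (times (T x2) y)); first by rewrite unwindE.
transitivity (\D_(x1, x2, x3, x4 <- x)
    (x1 |> (S x2 * timesA_right x3 (T x4) y))); first by rewrite /unwind /timesA_right; sw.
rewrite -timesAE.
transitivity (\D_(x1, x2, x3 <- x)
    (x1 |> (S x2 * times (times_T times T x3) y))); first by rewrite /times_T /timesA_left; sw.
rewrite times_TE /scal; transitivity (\D_(x1, x2, x3 <- x)
    (eps x3 *: (x1 |> (S x2 * times 1 y)))); first by sw.
under eq_tsum => a b do under eq_tsum => c d do rewrite times1l.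
by rewrite /Ttimes_act; sw.
Qed.

Lemma T_timesE : T_times times T = @scal k H.
Proof.
apply: funext => x; transitivity (\D_(x1, x2 <- x) Ttimes x1 x2); first by [].
rewrite TtimesE; transitivity (\D_(x1, x2 <- x) (x1 |> antL x2)); first by rewrite /Ttimes_act; sw.
rewrite antLE; transitivity (act_one x); first by rewrite /act_one; sw.
by rewrite act_oneE.
Qed.

Lemma ydb_lactE : ydb_lact times T = act.
Proof.
apply: funext => x; apply: funext => y.
transitivity (\D_(x1, x2 <- x) Ttimes x1 (x2 * y)); first by [].
rewrite TtimesE; transitivity (\D_(x1, x2 <- x) (x1 |> (antL x2 * y))); first by rewrite /Ttimes_act; sw.
by rewrite antLE; sw.
Qed.

Lemma ydb_ractE : ydb_ract times T = ract.
Proof.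
apply: funext => x; apply: funext => y; rewrite /ydb_ract ydb_lactE.
transitivity (\D_(x1, x2 <- x) \D_(y1, y2 <- y) (S (x1 |> y1) * mulH x2 y2)); first by sw.
rewrite -comE.
transitivity (\D_(x1, x2 <- x) \D_(y1, y2 <- y) (antL (x1 |> y1) * (x2 <| y2))); first by sw.
by rewrite antLE; sw.
Qed.

Local Notation rho := (@ydb_coact k H).

Definition coact_act x y := rho (x |> y).
Definition coact_act_each x y := \D_(x1, x2, x3 <- x) \tsum_(g, y0 <- rho y)
      ((x1 * g * S x3) \ox (x2 |> y0)).

(** The Yetter-Drinfeld condition: as x1 y1 = (x1 |> y1) (x2 <| y2), the last factor of the
    coaction of x |> y is expressed by <|, and [flipE] exchanges it with the middle one. *)
Lemma coact_actE : coact_act = coact_act_each.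
Proof.
apply: funext => x; apply: funext => y; rewrite /coact_act.
transitivity (\D_(x1, x2, x3, x4 <- x)
  \D_(y1, y2, y3, y4 <- y)
  ((((x1 |> y1) * (S (x3 |> y3)) * (antR (x4 * y4))) \ox (x2 |> y2)))).
  by rewrite antRE [LHS]tsum_eta; sw.
transitivity (\D_(x1, x2, x3, x4, x5 <- x)
  \D_(y1, y2, y3, y4, y5 <- y)
  (((x1 |> y1) * S (x3 |> y3) * mulH x4 y4 * S (x5 * y5)) \ox (x2 |> y2))); first by sw.
rewrite -comE.
transitivity (\D_(x1, x2, x3, x4, x5 <- x)
  \D_(y1, y2, y3, y4, y5 <- y)
  (((x1 |> y1) * antL (x3 |> y3) * (x4 <| y4) * S (x5 * y5)) \ox (x2 |> y2))); first by sw.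
rewrite antLE.
transitivity (\D_(x1, x2, x3 <- x) \D_(y1, y2, y3 <- y)
  \tsum_(p, q <- flipL x2 y2) (((x1 |> y1) * q * S (x3 * y3)) \ox p)); first by sw.
rewrite flipE.
transitivity (\D_(x1, x2, x3 <- x) \D_(y1, y2, y3 <- y)
  ((comR x1 y1 * S (x3 * y3)) \ox (x2 |> y2))); first by sw.
by rewrite comE /coact_act_each; sw.
Qed.

Lemma coact_linear : linear rho.
Proof.
have [pl pr] := @pure_bilinear k H H; have [ml mr] := mul_bilinear H.
have sl := @S_linear k H.
apply: tsum_Delta_linear; split=> [b|a].
  apply: tsum_linearP => c d; apply: (linear_comp (pl c)); exact: ml.
apply: tsum_Delta_linear; split=> [d|c]; last exact: (linear_comp (pl c) (linear_comp (mr a) sl)).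
exact: pr.
Qed.

Lemma ydb_is_yd : is_yd (YDStr act rho).
Proof.
have dl := @Delta_linear k H; have [pl pr] := @pure_bilinear k H H.
have [ql qr] := @pure_bilinear k (tensor H H) H.
have [ul ur] := @pure_bilinear k H (tensor H H).
have idl := @linear_id' k H.
split=> /=.
- exact: (mp_act_bilinear M).
- exact: (mp_1act M).
- exact: (mp_actM M).
- exact: coact_linear.
- move=> x.
  transitivity (\tsum_(g, x0 <- rho x) \D_(g1, g2 <- g) (g1 \ox (g2 \ox x0))).
    rewrite /tassoc /tmap tsum_sum_bilinear; last exact: tassoc_bilinear.
    by apply: eq_tsum => g x0; rewrite tsum_pure //; exact: tassoc_bilinear.
  transitivity (\tsum_(g, x0 <- rho x) \tsum_(g', y0 <- rho x0) (g \ox (g' \ox y0))).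
    by sw.
  by apply: eq_tsum => g x0; rewrite -(linear_tsum _ _ (ur g)) -tsum_eta.
- by move=> x; sw.
- move=> h x; exact: (congr1 (fun f => f h x) coact_actE).
Qed.

Local Notation D := (YDStr act rho).

Lemma yd_tensor_act_pure h x y :
  yd_act (yd_tensor D D) h (x \ox y) = \D_(h1, h2 <- h) ((h1 |> x) \ox (h2 |> y)).
Proof.
have [al ar] := mp_act_bilinear M.
by apply: eq_tsum => h1 h2; rewrite tmap_pure //=; exact: ar.
Qed.

Lemma yd_tensor_act_linear h : linear (yd_act (yd_tensor D D) h).
Proof.
have [al ar] := mp_act_bilinear M.
by apply: tsum_linearP => h1 h2; apply: tmap_linear; exact: ar.
Qed.

Let coact2_bilinear : bilinear (fun x y : H =>
  \tsum_(g, x0 <- rho x) \tsum_(l, y0 <- rho y) ((g * l) \ox (x0 \ox y0))).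
Proof.
have [pl pr] := @pure_bilinear k H H; have [ml mr] := mul_bilinear H.
have [ul ur] := @pure_bilinear k H (tensor H H).
have rl := coact_linear.
split=> [y|x].
  apply: (linear_comp (f := fun t => \tsum_(g, x0 <- t) \tsum_(l, y0 <- rho y) ((g * l) \ox (x0 \ox y0)))) rl.
  apply: tsum_linear; split=> [x0|g]; apply: tsum_linearP => l y0.
    exact: (linear_comp (ul _) (ml _)).
  exact: (linear_comp (ur _) (pl _)).
apply: tsum_linearP => g x0.
apply: (linear_comp (f := fun t => \tsum_(l, y0 <- t) ((g * l) \ox (x0 \ox y0)))) rl.
apply: tsum_linear; split=> [y0|l].
  exact: (linear_comp (ul _) (mr _)).
exact: (linear_comp (ur _) (pr _)).
Qed.

Lemma yd_tensor_coact_pure x y : yd_coact (yd_tensor D D) (x \ox y) =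
  \tsum_(g, x0 <- rho x) \tsum_(l, y0 <- rho y) ((g * l) \ox (x0 \ox y0)).
Proof. exact: (tsum_pure _ _ coact2_bilinear). Qed.

Lemma yd_tensor_coact_linear : linear (yd_coact (yd_tensor D D)).
Proof. exact: (tsum_linear coact2_bilinear). Qed.

Definition coact_times x y := rho (times x y).
Definition coact_times_each x y :=
  \tsum_(g, x0 <- rho x) \tsum_(l, y0 <- rho y) ((g * l) \ox times x0 y0).

(** As x * y = x1 (S x2 |> y), colinearity of the new product reduces to [coact_actE]. *)
Lemma coact_timesE : coact_times = coact_times_each.
Proof.
apply: funext => x; apply: funext => y; symmetry; rewrite /coact_times_each.
transitivity (\D_(x1, x2 <- x) \tsum_(g, x0 <- rho x1) \tsum_(l, y0 <- rho (scal x2 |> y))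
   ((g * l) \ox times x0 y0)); first by sw.
rewrite -antRE.
transitivity (\D_(x1, x2, x3 <- x) \tsum_(g, x0 <- rho x1)
  \tsum_(l, y0 <- coact_act x2 (S x3 |> y)) ((g * l) \ox times x0 y0)); first by rewrite /coact_act; sw.
rewrite coact_actE.
transitivity (\D_(x1, x2, x3, x4, x5, x6 <- x)
  \tsum_(g, y0 <- rho (S x6 |> y)) ((x1 * antL x3 * g * S x5) \ox times x2 (x4 |> y0))).
  by rewrite /coact_act_each; sw.
rewrite antLE.
transitivity (\D_(x1, x2, x3, x4 <- x)
  \tsum_(g, y0 <- rho (S x4 |> y)) ((x1 * g * S x3) \ox times_lact times act x2 y0)); first by rewrite /times_lact; sw.
by rewrite times_lactE [RHS]tsum_eta /coact_times; swu.
Qed.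

Lemma times_mor : yd_mor (yd_tensor D D) D (fun t => \tsum_(x, y <- t) times x y).
Proof.
have ml := tsum_linear times_bilinear; have [al ar] := mp_act_bilinear M.
have rl := coact_linear.
split=> //= [h t|t].
  apply: (tensor_ext (F := fun t => tsum (yd_act (yd_tensor D D) h t) times)
    (G := fun t => h |> tsum t times)) => [||x y].
  - exact: (linear_comp ml (yd_tensor_act_linear h)).
  - exact: (linear_comp (ar h) ml).
  rewrite yd_tensor_act_pure tsum_pure; last exact: times_bilinear.
  transitivity (lact_times_each act times h x y); last by rewrite -lact_timesE.
  rewrite tsum_sum_bilinear; last exact: times_bilinear.
  by apply: eq_tsum => *; rewrite tsum_pure //; exact: times_bilinear.
have tl := tmap_linear (@linear_id' _ H) ml.
apply: (tensor_ext (F := fun t => rho (tsum t times))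
    (G := fun t => tmap id (fun t => tsum t times) (yd_coact (yd_tensor D D) t))) => [||x y].
- exact: (linear_comp rl ml).
- exact: (linear_comp tl yd_tensor_coact_linear).
rewrite yd_tensor_coact_pure tsum_pure; last exact: times_bilinear.
transitivity (coact_times_each x y); first by rewrite -coact_timesE.
rewrite (linear_tsum _ _ tl); apply: eq_tsum => g x0.
rewrite (linear_tsum _ _ tl); apply: eq_tsum => l y0.
by rewrite tmap_pure // tsum_pure //; exact: times_bilinear.
Qed.

Lemma unit_mor : yd_mor (yd_unit H) D (fun a : k^o => a *: (1 : H)).
Proof.
have [al ar] := mp_act_bilinear M.
have ul : linear (fun a : k^o => a *: (1 : H)).
  by move=> a u v; rewrite scalerDl scalerA.
split=> //= [h a|a].
  rewrite (linearZ' (ar h)) (mp_act1 M) !scalerA.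
  by congr (_ *: _); exact: mulrC.
rewrite tmap_pure // (linearZ' coact_linear).
have [pl pr] := @pure_bilinear k H H.
rewrite (linearZ' (pr 1)); congr (_ *: _).
by rewrite [LHS]tsum_eta; sw.
Qed.

Lemma delta_mor : yd_mor D (yd_tensor D D) (@Delta k H).
Proof.
have dl := @Delta_linear k H.
split=> // [h x|x].
  rewrite [Delta x]tsum_eta (linear_tsum _ _ (yd_tensor_act_linear h)) /=.
  transitivity (\D_(x1, x2 <- x) \D_(h1, h2 <- h) ((h1 |> x1) \ox (h2 |> x2))).
    by rewrite [LHS]tsum_eta; sw.
  by apply: eq_tsum => x1 x2; rewrite -yd_tensor_act_pure.
rewrite [Delta x in LHS]tsum_eta (linear_tsum _ _ yd_tensor_coact_linear).
transitivity (\D_(x1, x2 <- x) \tsum_(g, x0 <- rho x1) \tsum_(l, y0 <- rho x2)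
   ((g * l) \ox (x0 \ox y0))).
  by apply: eq_tsum => x1 x2; rewrite yd_tensor_coact_pure.
transitivity (\tsum_(g, x0 <- rho x) \D_(a, b <- x0) (g \ox (a \ox b))).
  transitivity (\D_(x1, x2, x3, x4, x5 <- x)
     ((x1 * antL x3 * S x5) \ox (x2 \ox x4))); first by sw.
  by rewrite antLE; sw.
have [ul ur] := @pure_bilinear k H (tensor H H).
rewrite /tmap; apply: eq_tsum => g x0.
by rewrite -(linear_tsum _ _ (ur g)) -tsum_eta.
Qed.

Lemma coact_eps (U : lmodType k) (v : U) x :
  \tsum_(g, x0 <- rho x) (g \ox (eps x0 *: v)) = 1 \ox (eps x *: v).
Proof.
have [ql qr] := @pure_bilinear k H U.
transitivity ((\tsum_(g, x0 <- rho x) (eps x0 *: g)) \ox v).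
  rewrite (linear_tsum (F := fun z => z \ox v) _ _ (ql _)).
  by apply: eq_tsum => g x0; rewrite (linearZ' (ql _)) (linearZ' (qr g)).
rewrite (linearZ' (qr 1)) -(linearZ' (ql v)); congr (_ \ox _).
transitivity (antR x); last by rewrite antRE.
by sw.
Qed.

Lemma eps_mor : yd_mor D (yd_unit H) (@eps k H : H -> k^o).
Proof.
have el : linear (@eps k H : H -> k^o) by exact: eps_scalar.
split=> //= [h x|x]; first by rewrite (mp_act_eps M).
have e (a : k) : a = a *: (1 : k^o) by exact: esym (mulr1 a).
transitivity (\tsum_(g, x0 <- rho x) (g \ox (eps x0 *: (1 : k^o)))); last first.
  by apply: eq_tsum => g x0; rewrite -e.
by rewrite [X in _ \ox X]e coact_eps.
Qed.

Lemma yd_braid_pure x y :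
  yd_braid D D (x \ox y) = \tsum_(g, x0 <- rho x) ((g |> y) \ox x0).
Proof.
have [al ar] := mp_act_bilinear M; have [pl pr] := @pure_bilinear k H H.
rewrite /yd_braid tsum_pure //=; split=> [z|z].
  apply: (linear_comp (f := fun t => \tsum_(g, x0 <- t) ((g |> z) \ox x0))) coact_linear.
  apply: tsum_linear; split=> [x0|g]; last exact: pr.
  exact: (linear_comp (pl _) (al _)).
apply: tsum_linearP => g x0; exact: (linear_comp (pl _) (ar _)).
Qed.

Lemma delta_times x y : Delta (times x y) =
    \D_(x1, x2 <- x) \D_(y1, y2 <- y)
    \tsum_(y1', x2' <- yd_braid D D (x2 \ox y1)) (times x1 y1' \ox times x2' y2).
Proof.
transitivity (\D_(x1, x2 <- x) \D_(y1, y2 <- y) \tsum_(g, x0 <- rho x2)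
   (times x1 (g |> y1) \ox times x0 y2)); last first.
  apply: eq_tsum => x1 x2; apply: eq_tsum => y1 y2; rewrite yd_braid_pure.
  have tb : bilinear (fun a b => times x1 a \ox times b y2).
    have [tl tr] := times_bilinear; have [pl pr] := @pure_bilinear k H H.
    by split=> [b|a]; [exact: (linear_comp (pl _) (tr _)) | exact: (linear_comp (pr _) (tl _))].
  by rewrite [RHS]tsum_sum_bilinear //; apply: eq_tsum => g x0; rewrite tsum_pure.
symmetry; transitivity (\D_(x1, x2, x3 <- x) \tsum_(g, x0 <- rho x2)
   \D_(y1, y2 <- scal x3 |> y) (times x1 (g |> y1) \ox times x0 y2)); first by sw.
rewrite -antRE.
transitivity (\D_(x1, x2, x3, x4, x5, x6 <- x) \D_(y1, y2 <- S x6 |> y)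
   (times x1 ((x2 * antL x4) |> y1) \ox times x3 (x5 |> y2))); first by sw.
rewrite antLE.
transitivity (\D_(x1, x2, x3 <- x) \D_(y1, y2 <- S x3 |> y)
  (times_lact times act x1 y1 \ox times_lact times act x2 y2)); first by rewrite /times_lact; sw.
by rewrite times_lactE [RHS]tsum_eta; swu.
Qed.

Lemma eps_times x y : eps (times x y) = eps x * eps y.
Proof.
have el : linear (@eps k H : H -> k^o) by exact: eps_scalar.
rewrite /times_of (linear_tsum (F := @eps k H : H -> k^o) _ _ el).
rewrite -[RHS](counit_r (f := fun b => eps b * eps y : k^o)); last first.
  by move=> a u v; rewrite eps_scalar /= mulrDl -mulrA.
apply: eq_tsum => a b; rewrite epsM (mp_act_eps M) eps_S /GRing.scale /=.
by rewrite mulrCA.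
Qed.

(** Both sides are convolution inverse, for the new product, to h (x) x |-> h |> x. *)
Lemma T_act h x : T (h |> x) = h |> T x.
Proof.
symmetry; transitivity (\D_(h1, h2 <- h) \D_(x1, x2 <- x) times (T_times times T (h1 |> x1)) (h2 |> T x2)).
  rewrite T_timesE /scal; transitivity (\D_(h1, h2 <- h) \D_(x1, x2 <- x)
     (eps h1 *: (eps x1 *: times 1 (h2 |> T x2)))); last by sw.
  under [RHS]eq_tsum => a b do under eq_tsum => c d do rewrite times1l.
  by sw.
transitivity (\D_(h1, h2, h3 <- h) \D_(x1, x2, x3 <- x)
   timesA_left (T (h1 |> x1)) (h2 |> x2) (h3 |> T x3)); first by rewrite /T_times /timesA_left; sw.
rewrite timesAE.
transitivity (\D_(h1, h2 <- h) \D_(x1, x2, x3 <- x)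
   times (T (h1 |> x1)) (lact_times_each act times h2 x2 (T x3))); first by rewrite /timesA_right /lact_times_each; sw.
rewrite -lact_timesE.
transitivity (\D_(h1, h2 <- h) \D_(x1, x2 <- x) times (T (h1 |> x1)) (h2 |> times_T times T x2)).
  by rewrite /lact_times /times_T; sw.
rewrite times_TE.
transitivity (\D_(h1, h2 <- h) \D_(x1, x2 <- x) (eps x2 *: times (T (h1 |> x1)) (act_one h2))).
  by rewrite /act_one; sw.
rewrite act_oneE; transitivity (times (T (h |> x)) 1); first by sw.
exact: times1r.
Qed.

Lemma T_mor : yd_mor D D T.
Proof.
split=> /= [|h x|x]; [exact: T_linear | exact: T_act |].
transitivity (\tsum_(g, x0 <- rho x) (g \ox T x0)); last by [].
transitivity (\D_(x1, x2 <- x) coact_act x1 (S x2)).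
  by rewrite /coact_act [LHS]tsum_eta; swu.
rewrite coact_actE.
transitivity (\D_(x1, x2, x3, x4, x5 <- x)
  ((x1 * S x5 * S (antR x3)) \ox (x2 |> S x4))); first by rewrite /coact_act_each; sw.
by rewrite antRE; swu.
Qed.

Theorem mp_ydb : is_ydb times T.
Proof.
split.
- exact: times_bilinear.
- by move=> x y z; exact: esym (congr1 (fun f => f x y z) timesAE).
- exact: T_linear.
- rewrite ydb_lactE; split.
  + exact: ydb_is_yd.
  + exact: times_bilinear.
  + exact: times_mor.
  + exact: unit_mor.
  + by move=> x y z; exact: esym (congr1 (fun f => f x y z) timesAE).
  + exact: times1l.
  + exact: times1r.
  + exact: hopf_coalg (hopfP H).
  + exact: delta_mor.
  + exact: eps_mor.
  + exact: delta_times.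
  + exact: Delta1.
  + exact: eps_times.
  + exact: eps1.
  + exact: T_mor.
  + by move=> x; exact: (congr1 (fun f => f x) T_timesE).
  + by move=> x; exact: (congr1 (fun f => f x) times_TE).
- by rewrite ydb_lactE ydb_ractE; exact: (mp_flip M).
move=> h n l; symmetry.
transitivity (\D_(h1, h2, h3 <- h) timesA_left (h1 * n) (T h2) (h3 * l)); first by [].
rewrite timesAE; transitivity (\D_(h1, h2 <- h) times (mulH h1 n) (ydb_lact times T h2 l)).
  by rewrite /timesA_right /ydb_lact; sw.
rewrite ydb_lactE -times_lactE.
transitivity (\D_(h1, h2, h3 <- h) timesA_left h1 (h2 |> n) (h3 |> l)).
  by rewrite /times_lact /timesA_left; sw.
rewrite timesAE; transitivity (\D_(h1, h2 <- h) times h1 (lact_times_each act times h2 n l)).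
  by rewrite /timesA_right /lact_times_each; sw.
rewrite -lact_timesE; transitivity (times_lact times act h (times n l)); first by [].
by rewrite times_lactE.
Qed.

End ToYDBrace.

(** * From Yetter-Drinfeld braces to matched pairs *)

Section FromYDBrace.
Variables (k : fieldType) (H : hopfAlg k) (m : H -> H -> H) (T : H -> H).
Hypothesis Y : is_ydb m T.

Local Notation S := (hopf_S H).
Local Notation act := (ydb_lact m T).
Local Notation ract := (ydb_ract m T).
Local Notation "x |> y" := (act x y) (at level 39, left associativity).
Local Notation "x <| y" := (ract x y) (at level 39, left associativity).
Local Notation flipL := (pair12 act ract).
Local Notation flipR := (pair21 act ract).
Local Notation comR := (pair_mul act ract).

Let YH := ydb_hopf Y.
Let YD := ydh_yd YH.

Lemma ydb_act_bilinear : bilinear act. Proof. exact: (yd_act_bilinear YD). Qed.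

Lemma ydb_times1l y : m 1 y = y. Proof. exact: (ydh_m1l YH). Qed.
Lemma ydb_times1r y : m y 1 = y. Proof. exact: (ydh_m1r YH). Qed.

Lemma ydb_Delta_act x y : Delta (x |> y) =
  \D_(x1, x2 <- x) \D_(y1, y2 <- y) ((x1 |> y1) \ox (x2 |> y2)).
Proof. exact: (yd_mor_act (ydh_delta_mor YH) x y). Qed.

Lemma ydb_eps_act x y : eps (x |> y) = eps x * eps y.
Proof. exact: (yd_mor_act (ydh_eps_mor YH) x y). Qed.

Definition ydb_act_op := @Binary k H act ydb_act_bilinear (Some (false, false))
  (conj ydb_Delta_act ydb_eps_act).
Definition ydb_m_op := @Binary k H m (ydb_m_bilinear Y) None I.
Definition ydb_T_op := @Unary k H T (ydb_T_linear Y) None I.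
Definition ydb_ops := [:: ydb_act_op; ydb_m_op].
Definition ydb_rules bs : seq (rule (hopf_sig [:: ydb_T_op] (ydb_ops ++ bs))) :=
 let sg := hopf_sig [:: ydb_T_op] (ydb_ops ++ bs) in
 [:: @Rule k H sg (B2 1 (Cs 0) (Lf 0)) (Lf 0) (fun v => yd_act1 YD _);
     @Rule k H sg (B2 1 (B2 0 (Lf 0) (Lf 1)) (Lf 2)) (B2 1 (Lf 0) (B2 1 (Lf 1) (Lf 2)))
       (fun v => yd_actM YD _ _ _);
     @Rule k H sg (B2 2 (Cs 0) (Lf 0)) (Lf 0) (fun v => ydb_times1l _);
     @Rule k H sg (B2 2 (Lf 0) (Cs 0)) (Lf 0) (fun v => ydb_times1r _);
     @Rule k H sg (B2 2 (B2 2 (Lf 0) (Lf 1)) (Lf 2)) (B2 2 (Lf 0) (B2 2 (Lf 1) (Lf 2)))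
       (fun v => esym (ydb_mA Y _ _ _))].
Definition ydb_th : theory H :=
  Theory (hopf_rules [:: ydb_T_op] (ydb_ops ++ [::]) ++ ydb_rules [::]).

(* [sw] unfolds the right action; [sw2] and [sw3] treat it as an operation, first as a mere
   bilinear map, then with its coproduct *)
Ltac sw := unfold_sides; cbv delta [ydb_ract];
  sw_with k ydb_th H [:: 1 : H] [:: S; T] [:: @GRing.mul H; act; m].

Lemma ydb_times_TE : times_T m T = @scal k H.
Proof. by apply: funext => x; exact: (ydh_Tr YH). Qed.

Lemma ydb_times_lactE : times_lact m act = mulH (H := H).
Proof.
apply: funext => x; apply: funext => y.
transitivity (\D_(x1, x2 <- x) m x1 (\D_(a, b <- x2) m (T a) (b * y))); first by [].
transitivity (\D_(x1, x2 <- x) m (times_T m T x1) (x2 * y)); first by rewrite /times_T; sw.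
by rewrite ydb_times_TE; sw.
Qed.

Lemma ydb_lact_timesE : lact_times act m = lact_times_each act m.
Proof.
apply: funext => x; apply: funext => y; apply: funext => w.
have mb := ydb_m_bilinear Y; have [al ar] := ydb_act_bilinear.
have /= e := yd_mor_act (ydh_m_mor YH) x (y \ox w).
rewrite /lact_times -(tsum_pure y w mb) -[LHS]e tsum_sum_bilinear //.
by apply: eq_tsum => x1 x2; rewrite tmap_pure // tsum_pure.
Qed.

Lemma ydb_act1 x : x |> 1 = eps x *: 1.
Proof.
have /= e := yd_mor_act (ydh_u_mor YH) x (1 : k^o).
rewrite -[X in _ |> X]scale1r -[LHS]e; congr (_ *: _); exact: mulr1.
Qed.

Lemma ydb_ract_bilinear : bilinear ract.
Proof.
have [al ar] := ydb_act_bilinear; have [ml mr] := mul_bilinear H.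
have sl := @S_linear k H.
split=> [y|x].
  apply: tsum_Delta_linear; split=> [x2|x1]; apply: tsum_linearP => y1 y2.
    apply: (linear_comp (ml _)); apply: (linear_comp (ml _)).
    exact: (linear_comp sl (al _)).
  by apply: (linear_comp (ml _)); exact: mr.
apply: tsum_linearP => x1 x2; apply: tsum_Delta_linear; split=> [y2|y1]; last exact: mr.
apply: (linear_comp (ml _)); apply: (linear_comp (ml _)).
exact: (linear_comp sl (ar _)).
Qed.

Lemma ydb_flipE : flipL = flipR.
Proof. by apply: funext => x; apply: funext => y; exact: (ydb_flip Y). Qed.

Definition ydb_ract_op0 := @Binary k H ract ydb_ract_bilinear None I.
Definition ydb_th2 : theory H :=
  Theory (hopf_rules [:: ydb_T_op] (ydb_ops ++ [:: ydb_ract_op0]) ++ ydb_rules [:: ydb_ract_op0]).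
Ltac sw2 := unfold_sides;
  sw_with k ydb_th2 H [:: 1 : H] [:: S; T] [:: @GRing.mul H; act; m; ract].

Lemma ydb_pair_mulE : comR = mulH (H := H).
Proof.
apply: funext => x; apply: funext => y.
transitivity (\D_(x1, x2 <- x) \D_(y1, y2 <- y) (antR (x1 |> y1) * (x2 * y2))); first by sw.
by rewrite antRE; sw.
Qed.

Lemma ydb_Delta_ract x y : Delta (x <| y) =
  \D_(x1, x2 <- x) \D_(y1, y2 <- y) ((x1 <| y1) \ox (x2 <| y2)).
Proof.
transitivity (\D_(x1, x2 <- x) \D_(y1, y2 <- y) \tsum_(p, q <- flipL x1 y1)
  (q \ox (S p * (x2 * y2)))); first by rewrite [LHS]tsum_eta; sw.
rewrite ydb_flipE.
transitivity (\D_(x1, x2, x3 <- x) \D_(y1, y2, y3 <- y)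
  ((x1 <| y1) \ox (S (x2 |> y2) * (x3 * y3)))); first by sw2.
transitivity (\D_(x1, x2 <- x) \D_(y1, y2 <- y) ((x1 <| y1) \ox
   (\D_(a, b <- x2) \D_(c, d <- y2) (S (a |> c) * b * d)))); last by [].
have [pl pr] := @pure_bilinear k H H.
transitivity (\D_(x1, x2 <- x) \D_(y1, y2 <- y) 
   (\D_(a, b <- x2) \D_(c, d <- y2) ((x1 <| y1) \ox (S (a |> c) * b * d)))); first by sw2.
apply: eq_tsum => x1 x2; apply: eq_tsum => y1 y2.
rewrite (linear_tsum _ _ (pr _)); apply: eq_tsum => a b.
by rewrite (linear_tsum _ _ (pr _)).
Qed.

Lemma ydb_eps_ract x y : eps (x <| y) = eps x * eps y.
Proof. by apply: scale1_inj; rewrite -scalerA; sw. Qed.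

Definition ydb_ract_op := @Binary k H ract ydb_ract_bilinear (Some (false, false))
  (conj ydb_Delta_ract ydb_eps_ract).
Definition ydb_th3 : theory H :=
  Theory (hopf_rules [:: ydb_T_op] (ydb_ops ++ [:: ydb_ract_op]) ++ ydb_rules [:: ydb_ract_op]).
Ltac sw3 := unfold_sides;
  sw_with k ydb_th3 H [:: 1 : H] [:: S; T] [:: @GRing.mul H; act; m; ract].

(** The action distributes over the brace product, which is a morphism of modules, and y z is
    the brace product of y1 and y2 |> z. *)
Lemma ydb_act_of_mulE : act_of_mul act = act_each act ract.
Proof.
apply: funext => x; apply: funext => y; apply: funext => z.
transitivity (x |> mulH y z); first by [].
rewrite -ydb_times_lactE; transitivity (\D_(y1, y2 <- y) lact_times act m x y1 (y2 |> z)).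
  by rewrite /times_lact /lact_times; sw3.
rewrite ydb_lact_timesE; transitivity (\D_(x1, x2 <- x) \D_(y1, y2 <- y) m (x1 |> y1) (mulH x2 y2 |> z)).
  by rewrite /lact_times_each; sw3.
rewrite -ydb_pair_mulE.
transitivity (\D_(x1, x2 <- x) \D_(y1, y2 <- y) times_lact m act (x1 |> y1) ((x2 <| y2) |> z)).
  by rewrite /times_lact; sw3.
by rewrite ydb_times_lactE.
Qed.

(** The right action is determined by (x1 |> y1) (x2 <| y2) = x y; hence its properties follow
    from those of |> after multiplying by the antipode of the left component. *)
Lemma ydb_ractM x y z : x <| (y * z) = (x <| y) <| z.
Proof.
symmetry; transitivity (\D_(x1, x2 <- x) \D_(y1, y2 <- y) \D_(z1, z2 <- z)
  (antL (x1 |> (y1 * z1)) * ((x2 <| y2) <| z2))); first by rewrite antLE; sw3.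
transitivity (\D_(x1, x2, x3 <- x) \D_(y1, y2, y3 <- y)
  \D_(z1, z2, z3 <- z)
  (S (x1 |> (y1 * z1)) * act_of_mul act x2 y2 z2 * ((x3 <| y3) <| z3))).
  by rewrite /act_of_mul; sw3.
rewrite ydb_act_of_mulE.
transitivity (\D_(x1, x2, x3 <- x) \D_(y1, y2, y3 <- y)
  \D_(z1, z2 <- z) (S (x1 |> (y1 * z1)) * (x2 |> y2) * comR (x3 <| y3) z2)).
  by rewrite /act_each; sw3.
rewrite ydb_pair_mulE.
transitivity (\D_(x1, x2 <- x) \D_(y1, y2 <- y)
  \D_(z1, z2 <- z) (S (x1 |> (y1 * z1)) * comR x2 y2 * z2)); first by sw3.
by rewrite ydb_pair_mulE; sw.
Qed.

Lemma ydb_mul_ract x y z : (x * y) <| z =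
  \D_(y1, y2 <- y) \D_(z1, z2 <- z) ((x <| (y1 |> z1)) * (y2 <| z2)).
Proof.
symmetry; transitivity (\D_(x1, x2 <- x) \D_(y1, y2, y3 <- y) \D_(z1, z2, z3 <- z) (antL (x1 |> (y1 |> z1)) * (x2 <| (y2 |> z2)) * (y3 <| z3))).
  by rewrite antLE; sw3.
transitivity (\D_(x1, x2 <- x) \D_(y1, y2, y3 <- y) \D_(z1, z2, z3 <- z) (S (x1 |> (y1 |> z1)) * comR x2 (y2 |> z2) * (y3 <| z3))).
  by sw3.
rewrite ydb_pair_mulE.
transitivity (\D_(x1, x2 <- x) \D_(y1, y2 <- y) \D_(z1, z2 <- z)
  (S (x1 |> (y1 |> z1)) * x2 * comR y2 z2)); first by sw3.
by rewrite ydb_pair_mulE; sw.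
Qed.

Theorem ydb_mp : is_mp act ract.
Proof.
split.
- exact: ydb_act_bilinear.
- exact: ydb_ract_bilinear.
- exact: ydb_Delta_act.
- exact: ydb_eps_act.
- exact: ydb_Delta_ract.
- exact: ydb_eps_ract.
- exact: (yd_act1 YD).
- exact: (yd_actM YD).
- exact: ydb_act1.
- move=> x; transitivity (\D_(x1, x2 <- x) (S (x1 |> 1) * x2)); first by sw.
  under eq_tsum => a b do rewrite ydb_act1.
  by sw.
- exact: ydb_ractM.
- move=> y; transitivity (antL y); first by sw.
  by rewrite antLE.
- by move=> x y z; exact: (congr1 (fun f => f x y z) ydb_act_of_mulE).
- exact: ydb_mul_ract.
- exact: (ydb_flip Y).
- by move=> x y; exact: esym (congr1 (fun f => f x y) ydb_pair_mulE).
Qed.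

Lemma ydb_roundtrip : times_of act = m /\ T_of act = T.
Proof.
split; apply: funext => x.
  apply: funext => y; transitivity (\D_(x1, x2 <- x) mulH x1 (S x2 |> y)); first by [].
  rewrite -ydb_times_lactE; transitivity (\D_(x1, x2 <- x) m x1 (antR x2 |> y)).
    by rewrite /times_lact; sw.
  by rewrite antRE; sw.
transitivity (\D_(x1, x2 <- x) \D_(a, b <- x1) m (T a) (b * S x2)); first by [].
transitivity (\D_(x1, x2 <- x) m (T x1) (antR x2)); first by sw.
by rewrite antRE; sw.
Qed.
End FromYDBrace.

(** * Matched pairs and braiding operators *)

Section LegsOfMap.
Variables (k : fieldType) (H : hopfAlg k) (s : tensor H H -> tensor H H).
Hypothesis sl : linear s.

Lemma leg12_linear : linear (leg12 s).
Proof. exact: (tmap_linear sl (@linear_id' _ _)). Qed.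

Lemma leg23_linear : linear (leg23 s).
Proof.
apply: (linear_comp (@tassoc'_linear _ _ _ _)).
exact: (linear_comp (tmap_linear (@linear_id' _ _) sl) (@tassoc_linear _ _ _ _)).
Qed.

Lemma leg12_pure x y z : leg12 s ((x \ox y) \ox z) =
  \tsum_(p, q <- s (x \ox y)) ((p \ox q) \ox z).
Proof.
have [ql qr] := @pure_bilinear k (tensor H H) H.
by rewrite /leg12 tmap_pure // {1}[s _]tsum_eta (linear_tsum (F := fun t => t \ox z) _ _ (ql _)).
Qed.

Lemma leg23_pure x y z : leg23 s ((x \ox y) \ox z) =
  \tsum_(p, q <- s (y \ox z)) ((x \ox p) \ox q).
Proof. by rewrite /leg23 tassoc_pure tmap_pure // tassoc'_pure. Qed.

Lemma mu_linear : linear (@mu k H).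
Proof. exact: (tsum_linear (mul_bilinear H)). Qed.

Lemma mu_pure (x y : H) : mu (x \ox y) = x * y.
Proof. exact: (tsum_pure _ _ (mul_bilinear H)). Qed.

Let l12 := leg12_linear.
Let l23 := leg23_linear.

Lemma legs_12_23 x y z : leg12 s (leg23 s ((x \ox y) \ox z)) =
  \tsum_(q, r <- s (y \ox z)) \tsum_(p, q' <- s (x \ox q)) ((p \ox q') \ox r).
Proof.
rewrite leg23_pure (linear_tsum _ _ l12).
by apply: eq_tsum => q r; rewrite leg12_pure.
Qed.

Lemma legs_23_12 x y z : leg23 s (leg12 s ((x \ox y) \ox z)) =
  \tsum_(p, q <- s (x \ox y)) \tsum_(q', r <- s (q \ox z)) ((p \ox q') \ox r).
Proof.
rewrite leg12_pure (linear_tsum _ _ l23).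
by apply: eq_tsum => q r; rewrite leg23_pure.
Qed.

Lemma YB_lhs x y z : leg12 s (leg23 s (leg12 s ((x \ox y) \ox z))) =
  \tsum_(p, q <- s (x \ox y)) \tsum_(q', r <- s (q \ox z))
  \tsum_(p', q2 <- s (p \ox q')) ((p' \ox q2) \ox r).
Proof.
rewrite legs_23_12 (linear_tsum _ _ l12); apply: eq_tsum => p q.
by rewrite (linear_tsum _ _ l12); apply: eq_tsum => q' r; rewrite leg12_pure.
Qed.

Lemma YB_rhs x y z : leg23 s (leg12 s (leg23 s ((x \ox y) \ox z))) =
  \tsum_(q, r <- s (y \ox z)) \tsum_(p, q' <- s (x \ox q))
  \tsum_(q2, r' <- s (q' \ox r)) ((p \ox q2) \ox r').
Proof.
rewrite legs_12_23 (linear_tsum _ _ l23); apply: eq_tsum => p q.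
by rewrite (linear_tsum _ _ l23); apply: eq_tsum => q' r; rewrite leg23_pure.
Qed.

Lemma mul_lhs x y z : s (tmap (@mu k H) id ((x \ox y) \ox z)) = s ((x * y) \ox z).
Proof. by rewrite tmap_pure //; [rewrite mu_pure | exact: mu_linear]. Qed.

Lemma mul_rhs x y z : tmap id (@mu k H) (tassoc (leg12 s (leg23 s ((x \ox y) \ox z)))) =
  \tsum_(q, r <- s (y \ox z)) \tsum_(p, q' <- s (x \ox q)) (p \ox (q' * r)).
Proof.
have ml := mu_linear; have tl := tmap_linear (@linear_id' _ H) ml.
have al := @tassoc_linear k H H H.
rewrite legs_12_23 (linear_tsum _ _ al) (linear_tsum _ _ tl); apply: eq_tsum => q r.
rewrite (linear_tsum _ _ al) (linear_tsum _ _ tl); apply: eq_tsum => p q'.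
by rewrite tassoc_pure tmap_pure // mu_pure.
Qed.

Lemma mur_lhs x y z : s (tmap id (@mu k H) (tassoc ((x \ox y) \ox z))) = s (x \ox (y * z)).
Proof. by rewrite tassoc_pure tmap_pure //; [rewrite mu_pure | exact: mu_linear]. Qed.

Lemma mur_rhs x y z : tmap (@mu k H) id (leg23 s (leg12 s ((x \ox y) \ox z))) =
  \tsum_(p, q <- s (x \ox y)) \tsum_(q', r <- s (q \ox z)) ((p * q') \ox r).
Proof.
have ml := mu_linear; have tl := tmap_linear ml (@linear_id' _ H).
rewrite legs_23_12 (linear_tsum _ _ tl); apply: eq_tsum => q r.
rewrite (linear_tsum _ _ tl); apply: eq_tsum => p q'.
by rewrite tmap_pure // mu_pure.
Qed.
End LegsOfMap.

Definition braid_of (k : fieldType) (H : hopfAlg k) (act ract : H -> H -> H)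
  (t : tensor H H) : tensor H H := \tsum_(x, y <- t) pair12 act ract x y.
Definition lact_of_braid (k : fieldType) (H : hopfAlg k) (s : tensor H H -> tensor H H)
  (x y : H) : H := cofst (hopf_c H) (s (x \ox y)).
Definition ract_of_braid (k : fieldType) (H : hopfAlg k) (s : tensor H H -> tensor H H)
  (x y : H) : H := cosnd (hopf_c H) (s (x \ox y)).

Section ToBraiding.
Variables (k : fieldType) (H : hopfAlg k) (act ract : H -> H -> H).
Hypothesis M : is_mp act ract.

Local Notation S := (hopf_S H).
Local Notation "x |> y" := (act x y) (at level 39, left associativity).
Local Notation "x <| y" := (ract x y) (at level 39, left associativity).
Local Notation flipL := (pair12 act ract).
Local Notation flipR := (pair21 act ract).
Local Notation flipE := (flipE M).
Local Notation comR := (pair_mul act ract).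
Local Notation comE := (comE M).
Local Notation s := (braid_of act ract).

Ltac sw := unfold_sides;
  sw_with k (mp_th M) H [:: 1 : H] [:: S] [:: @GRing.mul H; act; ract].

Lemma pair12_bilinear : bilinear flipL.
Proof.
have [al ar] := mp_act_bilinear M; have [rl rr] := mp_ract_bilinear M.
have [pl pr] := @pure_bilinear k H H.
split=> [y|x].
  apply: tsum_Delta_linear; split=> [x2|x1]; apply: tsum_linearP => y1 y2.
    exact: (linear_comp (pl _) (al _)).
  exact: (linear_comp (pr _) (rl _)).
apply: tsum_linearP => x1 x2; apply: tsum_Delta_linear; split=> [y2|y1].
  exact: (linear_comp (pl _) (ar _)).
exact: (linear_comp (pr _) (rr _)).
Qed.

Lemma braid_linear : linear s. Proof. exact: (tsum_linear pair12_bilinear). Qed.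
Lemma braid_pure x y : s (x \ox y) = flipL x y.
Proof. exact: (tsum_pure _ _ pair12_bilinear). Qed.

Lemma braid_fst x y : lact_of_braid s x y = x |> y.
Proof.
rewrite /lact_of_braid braid_pure.
transitivity (\tsum_(a, b <- flipL x y) (eps b *: a)); first by [].
by sw.
Qed.

Lemma braid_snd x y : ract_of_braid s x y = x <| y.
Proof.
rewrite /ract_of_braid braid_pure.
transitivity (\tsum_(a, b <- flipL x y) (eps a *: b)); first by [].
by sw.
Qed.

Lemma braid_coalg : coalg_mor (tens_coalg (hopf_c H) (hopf_c H))
                             (tens_coalg (hopf_c H) (hopf_c H)) s.
Proof.
apply: tens_coalg_morP; try exact: Delta_linear; try exact: eps_scalar.
- exact: pair12_bilinear.
- move=> x y; rewrite /pair12.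
  transitivity (\D_(x1, x2, x3 <- x) \D_(y1, y2, y3 <- y)
    \tsum_(p, q <- flipL x2 y2) (((x1 |> y1) \ox q) \ox (p \ox (x3 <| y3)))); first by sw.
  by rewrite flipE; sw.
- by move=> x y; apply: tsum_eps; rewrite -scalerA; sw.
Qed.

(** The outer components agree because (x1 |> y1) |> ((x2 <| y2) |> z) = (x y) |> z by braided
    commutativity, and similarly for <|; the middle ones agree by [YB_middle]. *)
Lemma braid_YB x y z :
  \tsum_(p, q <- flipL x y) \tsum_(q', r <- flipL q z)
  \tsum_(p', q2 <- flipL p q') ((p' \ox q2) \ox r) =
  \tsum_(q, r <- flipL y z) \tsum_(p, q' <- flipL x q)
  \tsum_(q2, r' <- flipL q' r) ((p \ox q2) \ox r').
Proof.
rewrite /pair12.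
transitivity (\D_(x1, x2, x3 <- x) \D_(y1, y2, y3 <- y)
  \D_(z1, z2, z3 <- z)
  (((mulH x1 y1 |> z1) \ox YB_left act ract x2 y2 z2) \ox ((x3 <| y3) <| z3))).
  rewrite -comE; transitivity (\D_(x1, x2, x3 <- x) \D_(y1, y2, y3 <- y)
    \tsum_(p, q <- flipL x2 y2) \D_(z1, z2, z3 <- z) \D_(d, e <- x3) \D_(f, g <- y3)
    ((((x1 |> y1) |> (q |> z1)) \ox (p <| ((d <| f) |> z2))) \ox ((e <| g) <| z3))); first by sw.
  by rewrite flipE; sw.
transitivity (\D_(x1, x2, x3 <- x) \D_(y1, y2, y3 <- y)
  \D_(z1, z2, z3 <- z)
  (((x1 |> (y1 |> z1)) \ox YB_right act ract x2 y2 z2) \ox (x3 <| mulH y3 z3))).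
  by rewrite (YB_E M); sw.
rewrite -comE.
transitivity (\D_(x1, x2, x3 <- x) \D_(y1, y2, d <- y)
  \D_(z1, z2, e <- z) \D_(y3, y4 <- d) \D_(z3, z4 <- e)
  \tsum_(p, q <- flipL y3 z3)
  (((x1 |> (y1 |> z1)) \ox ((x2 <| (y2 |> z2)) |> q)) \ox ((x3 <| p) <| (y4 <| z4)))); last by sw.
by rewrite flipE; sw.
Qed.

Theorem mp_braiding : is_braiding s.
Proof.
have sl := braid_linear; have l12 := leg12_linear sl; have l23 := leg23_linear sl.
have ml := @mu_linear k H; have al := @tassoc_linear k H H H.
have tl := tmap_linear (@linear_id' _ H) ml; have tl' := tmap_linear ml (@linear_id' _ H).
split.
- exact: braid_coalg.
- apply: tensor3_ext => [||x y z].
  + exact: (linear_comp l12 (linear_comp l23 l12)).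
  + exact: (linear_comp l23 (linear_comp l12 l23)).
  rewrite YB_lhs // YB_rhs // !braid_pure.
  under eq_tsum => p q do (rewrite braid_pure; under eq_tsum => a b do rewrite braid_pure).
  under [RHS]eq_tsum => p q do (rewrite braid_pure; under eq_tsum => a b do rewrite braid_pure).
  exact: braid_YB.
- apply: tensor3_ext => [||x y z].
  + exact: (linear_comp sl tl').
  + exact: (linear_comp tl (linear_comp al (linear_comp l12 l23))).
  rewrite mul_lhs mul_rhs // !braid_pure.
  under [RHS]eq_tsum => p q do rewrite braid_pure.
  transitivity (\D_(x1, x2 <- x) \D_(y1, y2 <- y) \D_(z1, z2 <- z)
    ((x1 |> (y1 |> z1)) \ox ((x2 * y2) <| z2))); first by sw.
  under eq_tsum => ? ? do under eq_tsum => ? ? do under eq_tsum => ? ? do rewrite (mp_mul_ract M).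
  transitivity (\D_(x1, x2 <- x) \D_(y1, y2 <- y) \D_(z1, z2 <- z)
    \D_(a, b <- y2) \D_(c, d <- z2)
    ((x1 |> (y1 |> z1)) \ox ((x2 <| (a |> c)) * (b <| d)))); last by sw.
  have [pl pr] := @pure_bilinear k H H.
  apply: eq_tsum => ? ?; apply: eq_tsum => ? ?; apply: eq_tsum => ? ?.
  by rewrite (linear_tsum _ _ (pr _)); apply: eq_tsum => ? ?; rewrite (linear_tsum _ _ (pr _)).
- apply: tensor3_ext => [||x y z].
  + exact: (linear_comp sl (linear_comp tl al)).
  + exact: (linear_comp tl' (linear_comp l23 l12)).
  rewrite mur_lhs mur_rhs // !braid_pure.
  under [RHS]eq_tsum => p q do rewrite braid_pure.
  transitivity (\D_(x1, x2 <- x) \D_(y1, y2 <- y) \D_(z1, z2 <- z)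
    (act_of_mul act x1 y1 z1 \ox ((x2 <| y2) <| z2))); first by sw.
  by rewrite -(act_of_mulE M); sw.
- move=> x; rewrite braid_pure /pair12.
  transitivity (\D_(a, b <- x) (a \ox (1 <| b))); first by sw.
  under eq_tsum => a b do rewrite (mp_1ract M).
  have [pl pr] := @pure_bilinear k H H.
  transitivity (\D_(a, b <- x) (eps b *: (a \ox (1 : H)))); last by sw.
  by apply: eq_tsum => a b; rewrite (linearZ' (pr _)).
- move=> x; rewrite braid_pure /pair12.
  transitivity (\D_(a, b <- x) ((a |> 1) \ox b)); first by sw.
  under eq_tsum => a b do rewrite (mp_act1 M).
  have [pl pr] := @pure_bilinear k H H.
  transitivity (\D_(a, b <- x) (eps a *: ((1 : H) \ox b))); last by sw.
  by apply: eq_tsum => a b; rewrite (linearZ' (pl _)).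
- apply: tensor_ext => [||x y]; [exact: ml | exact: (linear_comp ml sl) |].
  rewrite mu_pure braid_pure.
  transitivity (\tsum_(p, q <- flipL x y) (p * q)); last by [].
  by rewrite (mp_comm M); sw.
Qed.
End ToBraiding.

Section FromBraiding.
Variables (k : fieldType) (H : hopfAlg k) (s : tensor H H -> tensor H H).
Hypothesis B : is_braiding s.

Local Notation S := (hopf_S H).
Local Notation act := (lact_of_braid s).
Local Notation ract := (ract_of_braid s).
Local Notation "x |> y" := (act x y) (at level 39, left associativity).
Local Notation "x <| y" := (ract x y) (at level 39, left associativity).
Local Notation flipL := (pair12 act ract).

Let sH := hopf_coalg (hopfP H).
Let sm := braiding_coalg B.
Let sl : linear s := coalg_mor_linear sm.
Let l1 : linear (fun t => cofst (hopf_c H) (s t) : H).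
Proof. exact: (linear_comp (cofst_linear sH) sl). Qed.
Let l2 : linear (fun t => cosnd (hopf_c H) (s t) : H).
Proof. exact: (linear_comp (cosnd_linear sH) sl). Qed.

Lemma braid_act_bilinear : bilinear act.
Proof.
have [pl pr] := @pure_bilinear k H H.
by split=> [y|x]; [exact: (linear_comp l1 (pl y)) | exact: (linear_comp l1 (pr x))].
Qed.

Lemma braid_ract_bilinear : bilinear ract.
Proof.
have [pl pr] := @pure_bilinear k H H.
by split=> [y|x]; [exact: (linear_comp l2 (pl y)) | exact: (linear_comp l2 (pr x))].
Qed.

Lemma braid_source_tsum (W W' : lmodType k) (P Q : tensor H H -> W) x y
    (f : W -> W -> W') : bilinear f -> linear P -> linear Q ->
  \tsum_(u, v <- cdelta (tens_coalg (hopf_c H) (hopf_c H)) (x \ox y)) f (P u) (Q v) =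
  \D_(x1, x2 <- x) \D_(y1, y2 <- y) f (P (x1 \ox y1)) (Q (x2 \ox y2)).
Proof.
move=> [fl fr] Pl Ql; have fb : bilinear (fun u v => f (P u) (Q v)).
  split=> [v|u]; first exact: (linear_comp (fl _) Pl).
  exact: (linear_comp (fr _) Ql).
rewrite tens_delta_pure //; try exact: Delta_linear.
rewrite tsum_sum_bilinear //; apply: eq_tsum => x1 x2.
rewrite tsum_sum_bilinear //; apply: eq_tsum => y1 y2.
by rewrite tsum_pure.
Qed.

(** A coalgebra map into H (x) H is the convolution of its two components, so s has the form
    of a braiding of two actions. *)
Lemma braid_pair12 x y : s (x \ox y) = flipL x y.
Proof.
have := components_eq sH sH sm (x \ox y).
by rewrite (braid_source_tsum x y (@pure_bilinear k H H) l1 l2).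
Qed.

Lemma braid_flip x y :
  \D_(x1, x2 <- x) \D_(y1, y2 <- y) ((x1 |> y1) \ox (x2 <| y2)) =
  \D_(x1, x2 <- x) \D_(y1, y2 <- y) ((x2 |> y2) \ox (x1 <| y1)).
Proof.
have pb := @pure_bilinear k H H.
have pb' : bilinear (fun a b : H => b \ox a).
  by split=> [b|a]; [exact: pb.2 | exact: pb.1].
exact: etrans (esym (braid_source_tsum x y pb l1 l2))
  (etrans (components_flip sH sH sm (x \ox y)) (braid_source_tsum x y pb' l2 l1)).
Qed.

Lemma braid_Delta_act x y : Delta (x |> y) =
  \D_(x1, x2 <- x) \D_(y1, y2 <- y) ((x1 |> y1) \ox (x2 |> y2)).
Proof.
exact: etrans (component1_delta sH sH sm (x \ox y)) (braid_source_tsum x y (@pure_bilinear k H H) l1 l1).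
Qed.

Lemma braid_Delta_ract x y : Delta (x <| y) =
  \D_(x1, x2 <- x) \D_(y1, y2 <- y) ((x1 <| y1) \ox (x2 <| y2)).
Proof.
exact: etrans (component2_delta sH sH sm (x \ox y)) (braid_source_tsum x y (@pure_bilinear k H H) l2 l2).
Qed.

Lemma braid_eps_act x y : eps (x |> y) = eps x * eps y.
Proof.
apply: etrans (component1_eps sH sm (x \ox y)) _.
by apply: tens_eps_pure; exact: eps_scalar.
Qed.

Lemma braid_eps_ract x y : eps (x <| y) = eps x * eps y.
Proof.
apply: etrans (component2_eps sH sm (x \ox y)) _.
by apply: tens_eps_pure; exact: eps_scalar.
Qed.

Definition braid_act_op := @Binary k H act braid_act_bilinear (Some (false, false))
  (conj braid_Delta_act braid_eps_act).
Definition braid_ract_op := @Binary k H ract braid_ract_bilinear (Some (false, false))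
  (conj braid_Delta_ract braid_eps_ract).
Definition braid_th : theory H := Theory (hopf_rules [::] [:: braid_act_op; braid_ract_op]).
Ltac sw := unfold_sides; sw_with k braid_th H [:: 1 : H] [:: S] [:: @GRing.mul H; act; ract].

Let first_eq (t u : tensor H H) : t = u ->
  \tsum_(a, b <- t) (eps b *: a) = \tsum_(a, b <- u) (eps b *: a).
Proof. by move->. Qed.
Let second_eq (t u : tensor H H) : t = u ->
  \tsum_(a, b <- t) (eps a *: b) = \tsum_(a, b <- u) (eps a *: b).
Proof. by move->. Qed.

Lemma braid_mul x y z : flipL (x * y) z =
  \tsum_(q, r <- flipL y z) \tsum_(p, q' <- flipL x q) (p \ox (q' * r)).
Proof.
have := braiding_mul B ((x \ox y) \ox z); rewrite mul_lhs mul_rhs // !braid_pair12 => ->.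
by apply: eq_tsum => q r; rewrite braid_pair12.
Qed.

Lemma braid_mur x y z : flipL x (y * z) =
  \tsum_(p, q <- flipL x y) \tsum_(q', r <- flipL q z) ((p * q') \ox r).
Proof.
have := braiding_mur B ((x \ox y) \ox z); rewrite mur_lhs mur_rhs // !braid_pair12 => ->.
by apply: eq_tsum => q r; rewrite braid_pair12.
Qed.

Lemma braid_1l x : flipL 1 x = x \ox 1.
Proof. by rewrite -braid_pair12 (braiding_1l B). Qed.
Lemma braid_1r x : flipL x 1 = 1 \ox x.
Proof. by rewrite -braid_pair12 (braiding_1r B). Qed.

(** Each axiom of a matched pair is one component of an axiom of a braiding operator. *)
Theorem braiding_mp : is_mp act ract.
Proof.
split.
- exact: braid_act_bilinear.
- exact: braid_ract_bilinear.
- exact: braid_Delta_act.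
- exact: braid_eps_act.
- exact: braid_Delta_ract.
- exact: braid_eps_ract.
- move=> y; transitivity (\tsum_(a, b <- flipL 1 y) (eps b *: a)); first by sw.
  by rewrite (first_eq (braid_1l y)); sw.
- move=> x y z; transitivity (\tsum_(a, b <- flipL (x * y) z) (eps b *: a)); first by sw.
  by rewrite (first_eq (braid_mul x y z)); sw.
- move=> x; transitivity (\tsum_(a, b <- flipL x 1) (eps b *: a)); first by sw.
  by rewrite (first_eq (braid_1r x)); sw.
- move=> x; transitivity (\tsum_(a, b <- flipL x 1) (eps a *: b)); first by sw.
  by rewrite (second_eq (braid_1r x)); sw.
- move=> x y z; transitivity (\tsum_(a, b <- flipL x (y * z)) (eps a *: b)); first by sw.
  by rewrite (second_eq (braid_mur x y z)); sw.
- move=> y; transitivity (\tsum_(a, b <- flipL 1 y) (eps a *: b)); first by sw.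
  by rewrite (second_eq (braid_1l y)); sw.
- move=> x y z; transitivity (\tsum_(a, b <- flipL x (y * z)) (eps b *: a)); first by sw.
  by rewrite (first_eq (braid_mur x y z)); sw.
- move=> x y z; transitivity (\tsum_(a, b <- flipL (x * y) z) (eps a *: b)); first by sw.
  by rewrite (second_eq (braid_mul x y z)); sw.
- exact: braid_flip.
- move=> x y; have := braiding_comm B (x \ox y); rewrite mu_pure braid_pair12 => ->.
  transitivity (\tsum_(p, q <- flipL x y) (p * q)); first by [].
  by sw.
Qed.

Lemma braiding_roundtrip : braid_of act ract = s.
Proof.
apply: funext; apply: tensor_ext => [||x y].
- exact: (braid_linear braiding_mp).
- exact: sl.
by rewrite (braid_pure braiding_mp) braid_pair12.
Qed.
End FromBraiding.

(** * Transport of morphisms *)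

Section MorphismTransport.
Variables (k : fieldType) (H K : hopfAlg k) (f : H -> K).
Hypothesis fh : hopf_mor f.

Let fl : linear f := hopf_mor_linear fh.

Lemma hopf_mor_tsum (W : lmodType k) (g : K -> K -> W) x : bilinear g ->
  tsum (Delta (f x)) g = \D_(a, b <- x) g (f a) (f b).
Proof.
move=> gb; rewrite [Delta _](coalg_mor_delta (hopf_mor_coalg fh)).
by rewrite /tmap tsum_sum_bilinear //; apply: eq_tsum => a b; rewrite tsum_pure.
Qed.

Lemma hopf_mor_eps x : eps (f x) = eps x.
Proof. exact: (coalg_mor_eps (hopf_mor_coalg fh)). Qed.

Lemma tmap_cofst t : cofst (hopf_c K) (tmap f f t) = f (cofst (hopf_c H) t).
Proof.
have cK := hopf_coalg (hopfP K).
rewrite /tmap /cofst (linear_tsum (F := fun t => tsum t _) _ _ (cofst_linear cK)).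
rewrite (linear_tsum _ _ fl); apply: eq_tsum => a b.
by rewrite -/(cofst _ _) (cofst_pure cK) (linearZ' fl) -/(eps _) hopf_mor_eps.
Qed.

Lemma tmap_cosnd t : cosnd (hopf_c K) (tmap f f t) = f (cosnd (hopf_c H) t).
Proof.
have cK := hopf_coalg (hopfP K).
rewrite /tmap /cosnd (linear_tsum (F := fun t => tsum t _) _ _ (cosnd_linear cK)).
rewrite (linear_tsum _ _ fl); apply: eq_tsum => a b.
by rewrite -/(cosnd _ _) (cosnd_pure cK) (linearZ' fl) -/(eps _) hopf_mor_eps.
Qed.

Section Pairs.
Variables (act ract : H -> H -> H) (act' ract' : K -> K -> K).
Hypotheses (M : is_mp act ract) (M' : is_mp act' ract').
Hypothesis fa : forall x y, f (act x y) = act' (f x) (f y).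
Hypothesis fr : forall x y, f (ract x y) = ract' (f x) (f y).

Lemma tmap_braid_of t : tmap f f (braid_of act ract t) = braid_of act' ract' (tmap f f t).
Proof.
have [sl sl'] := (braid_linear M, braid_linear M'); have tl := tmap_linear fl fl.
apply: (tensor_ext (linear_comp tl sl) (linear_comp sl' tl)) => x y.
rewrite tmap_pure // !braid_pure // /pair12.
have [al' ar'] := mp_act_bilinear M'; have [rl' rr'] := mp_ract_bilinear M'.
have [pl pr] := @pure_bilinear k K K.
rewrite hopf_mor_tsum; last first.
  split=> [b|a]; apply: tsum_linearP => c d.
    exact: (linear_comp (pl _) (al' _)).
  exact: (linear_comp (pr _) (rl' _)).
rewrite (linear_tsum _ _ tl); apply: eq_tsum => a b.
rewrite hopf_mor_tsum; last first.
  split=> [d|c]; first exact: (linear_comp (pl _) (ar' _)).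
  exact: (linear_comp (pr _) (rr' _)).
rewrite (linear_tsum _ _ tl); apply: eq_tsum => c d.
by rewrite tmap_pure // fa fr.
Qed.

Lemma hopf_mor_dot_of x y : f (dot_of ract x y) = dot_of ract' (f x) (f y).
Proof. by rewrite /dot_of fr (hopf_morS fh). Qed.

Lemma hopf_mor_col_of x y : f (col_of act ract x y) = col_of act' ract' (f x) (f y).
Proof.
have [al' ar'] := mp_act_bilinear M'.
rewrite /col_of hopf_mor_tsum; last first.
  split=> [b|a]; last exact: ar'.
  apply: (linear_comp (f := fun z => act' z b)); first exact: al'.
  exact: (dot_bilinear M').2.
rewrite (linear_tsum _ _ fl); apply: eq_tsum => a b.
by rewrite fa fr (hopf_morS fh).
Qed.

Lemma hopf_mor_times_of x y : f (times_of act x y) = times_of act' (f x) (f y).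
Proof.
have [al' ar'] := mp_act_bilinear M'; have [ml mr] := mul_bilinear K.
rewrite /times_of hopf_mor_tsum; last first.
  split=> [b|a]; first exact: ml.
  exact: (linear_comp (mr _) (linear_comp (al' _) (@S_linear k K))).
rewrite (linear_tsum _ _ fl); apply: eq_tsum => a b.
by rewrite (hopf_morM fh) fa (hopf_morS fh).
Qed.

Lemma hopf_mor_T_of x : f (T_of act x) = T_of act' (f x).
Proof.
have [al' ar'] := mp_act_bilinear M'.
rewrite /T_of hopf_mor_tsum; last first.
  split=> [b|a]; [exact: al' | exact: (linear_comp (ar' _) (@S_linear k K))].
by rewrite (linear_tsum _ _ fl); apply: eq_tsum => a b; rewrite fa (hopf_morS fh).
Qed.
End Pairs.

Section Braid.
Variables (s : tensor H H -> tensor H H) (s' : tensor K K -> tensor K K).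
Hypothesis fs : forall t, tmap f f (s t) = s' (tmap f f t).

Lemma hopf_mor_lact_of_braid x y :
  f (lact_of_braid s x y) = lact_of_braid s' (f x) (f y).
Proof. by rewrite /lact_of_braid -tmap_cofst fs tmap_pure. Qed.

Lemma hopf_mor_ract_of_braid x y :
  f (ract_of_braid s x y) = ract_of_braid s' (f x) (f y).
Proof. by rewrite /ract_of_braid -tmap_cosnd fs tmap_pure. Qed.
End Braid.

Section SkewBrace.
Variables (dot col : H -> H -> H) (dot' col' : K -> K -> K).
Hypotheses (B : is_hsb dot col) (B' : is_hsb dot' col').
Hypothesis fd : forall x y, f (dot x y) = dot' (f x) (f y).
Hypothesis fc : forall x y, f (col x y) = col' (f x) (f y).

Lemma tmap_shear t : tmap f f (shear dot t) = shear dot' (tmap f f t).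
Proof.
have tl := tmap_linear fl fl.
have db := shear_bilinear (hsb_dot_bilinear B).
have db' := shear_bilinear (hsb_dot_bilinear B').
apply: (tensor_ext (linear_comp tl (tsum_linear db)) (linear_comp (tsum_linear db') tl)) => x y.
rewrite tmap_pure // !tsum_pure //.
have [dl' dr'] := hsb_dot_bilinear B'.
rewrite hopf_mor_tsum; last exact: (pure_comp_bilinear (dr' _) (@linear_id' _ _)).
rewrite (linear_tsum _ _ tl); apply: eq_tsum => a b.
by rewrite tmap_pure // fd.
Qed.

(** A morphism commutes with the shears, hence with their inverses. *)
Lemma hopf_mor_ract_of x y : f (ract_of dot x y) = ract_of dot' (f x) (f y).
Proof.
have [_ RK] : _ /\ cancel (inverse_of (shear dot)) (shear dot) := inverse_ofK (hsb_inv B).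
have [RK' RKi'] : cancel (shear dot') (inverse_of (shear dot')) /\ _ := inverse_ofK (hsb_inv B').
rewrite /ract_of -tmap_cofst; congr (cofst _ _).
rewrite -[RHS]/(inverse_of (shear dot') _) -(tmap_pure _ _ fl fl).
by rewrite -[in RHS](RK (x \ox y)) tmap_shear RK'.
Qed.

Lemma hopf_mor_act_of x y : f (act_of dot col x y) = act_of dot' col' (f x) (f y).
Proof.
have [cl' cr'] := hsb_col_bilinear B'; have [_ rr'] := ract_bilinear B'.
rewrite /act_of hopf_mor_tsum; last first.
  split=> [b|a]; [exact: (linear_comp (cr' _) (rr' _)) | exact: cl'].
rewrite (linear_tsum _ _ fl); apply: eq_tsum => a b.
by rewrite fc hopf_mor_ract_of.
Qed.
End SkewBrace.

Section YDBrace.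
Variables (m : H -> H -> H) (T : H -> H) (m' : K -> K -> K) (T' : K -> K).
Hypothesis B' : is_ydb m' T'.
Hypothesis fm : forall x y, f (m x y) = m' (f x) (f y).
Hypothesis fT : forall x, T' (f x) = f (T x).

Lemma hopf_mor_lact x y : f (ydb_lact m T x y) = ydb_lact m' T' (f x) (f y).
Proof.
have [ml' mr'] := ydb_m_bilinear B'; have [ml mr] := mul_bilinear K.
rewrite /ydb_lact hopf_mor_tsum; last first.
  split=> [b|a]; first exact: (linear_comp (ml' _) (ydb_T_linear B')).
  exact: (linear_comp (mr' _) (ml _)).
rewrite (linear_tsum _ _ fl); apply: eq_tsum => a b.
by rewrite fm fT (hopf_morM fh).
Qed.

Lemma hopf_mor_ract x y : f (ydb_ract m T x y) = ydb_ract m' T' (f x) (f y).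
Proof.
have [al' ar'] := ydb_act_bilinear B'; have [ml mr] := mul_bilinear K.
have Sl := @S_linear k K.
rewrite /ydb_ract hopf_mor_tsum; last first.
  split=> [b|a]; apply: tsum_linearP => c d.
    apply: (linear_comp (f := fun z => z * d)); first exact: ml.
    apply: (linear_comp (f := fun z => z * b)); first exact: ml.
    exact: (linear_comp Sl (al' _)).
  apply: (linear_comp (f := fun z => z * d)); first exact: ml.
  exact: mr.
rewrite (linear_tsum _ _ fl); apply: eq_tsum => a b.
rewrite hopf_mor_tsum; last first.
  split=> [d|c]; last exact: mr.
  apply: (linear_comp (f := fun z => z * d)); first exact: ml.
  apply: (linear_comp (f := fun z => z * f b)); first exact: ml.
  exact: (linear_comp Sl (ar' _)).
rewrite (linear_tsum _ _ fl); apply: eq_tsum => c d.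
by rewrite !(hopf_morM fh) (hopf_morS fh) hopf_mor_lact.
Qed.
End YDBrace.

End MorphismTransport.

(** * Isomorphisms of concrete categories *)

Section IsomorphicCategories.

Lemma functor_eq (C D : category) (o : obj C -> obj D)
    (h : forall X Y, Defs.hom X Y -> Defs.hom (o X) (o Y)) i c i' c' :
  @Functor C D o h i c = @Functor C D o h i' c'.
Proof. by rewrite (Prop_irrelevance i i') (Prop_irrelevance c c'). Qed.

Lemma compFA (C D E B : category) (L : functor E B) (G : functor D E) (F : functor C D) :
  compF L (compF G F) = compF (compF L G) F.
Proof. exact: functor_eq. Qed.

Lemma comp1F (C D : category) (F : functor C D) : compF (idF D) F = F.
Proof. by case: F => *; exact: functor_eq. Qed.

Lemma isomorphic_sym (C D : category) : isomorphic_cat C D -> isomorphic_cat D C.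
Proof. by case=> F [G [GF FG]]; exists G, F. Qed.

Lemma isomorphic_trans (C D E : category) :
  isomorphic_cat C D -> isomorphic_cat D E -> isomorphic_cat C E.
Proof.
case=> F [G [GF FG]] [F' [G' [GF' FG']]]; exists (compF F' F), (compF G G').
split; first by rewrite -compFA (compFA G' F') GF' comp1F.
by rewrite -compFA (compFA F G) FG comp1F.
Qed.

Lemma existT_inj (A : Type) (P : A -> Type) a (x y : P a) :
  existT P a x = existT P a y -> x = y.
Proof.
move=> e; have := projT2_eq e; rewrite /=.
by rewrite (Prop_irrelevance (projT1_eq e) erefl).
Qed.

(** Functions packed with their types, to compare morphisms of functors that agree on
    underlying sets but only provably on objects. *)
Definition arrow (A B : Type) (f : A -> B) : {p : Type * Type & p.1 -> p.2} :=
  existT _ (A, B) f.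

Variables (O : Type) (car : O -> Type).
Variable mor : forall X Y : O, (car X -> car Y) -> Prop.
Hypothesis mor_id : forall X, mor (fun x : car X => x).
Hypothesis mor_comp : forall X Y Z (g : car Y -> car Z) (f : car X -> car Y),
  mor g -> mor f -> mor (fun x => g (f x)).
Let C := concrete_cat mor_id mor_comp.

(** A functor fixing all objects and acting on morphisms by the same underlying function is
    the identity. *)
Lemma concrete_functor_id (F : functor C C) :
  (forall X, fobj F X = X) ->
  (forall X Y (f : @Defs.hom C X Y), arrow (sval (fmap F f)) = arrow (sval f)) -> F = idF C.
Proof.
case: F => o h i c /= eo; have {eo}eo : o = fun X => X by exact: funext.
subst o => e; have eh : h = fun X Y f => f.
  apply: functional_extensionality_dep => X; apply: functional_extensionality_dep => Y.
  apply: funext => f; apply: chom_eq; exact: existT_inj (e X Y f).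
by subst h; exact: functor_eq.
Qed.
End IsomorphicCategories.

(** * The three isomorphisms *)

Record matchedPair (k : fieldType) := MatchedPair {
  mp_hopf :> hopfAlg k;
  mp_act : mp_hopf -> mp_hopf -> mp_hopf;
  mp_ract : mp_hopf -> mp_hopf -> mp_hopf;
  mp_ax : is_mp mp_act mp_ract }.

Definition matchedPair_mor (k : fieldType) (B C : matchedPair k) (f : B -> C) : Prop :=
  [/\ hopf_mor f,
      forall x y, f (mp_act x y) = mp_act (f x) (f y) &
      forall x y, f (mp_ract x y) = mp_ract (f x) (f y)].

Section Functors.
Variable k : fieldType.

Lemma matchedPair_mor_id (B : matchedPair k) : @matchedPair_mor k B B (fun x => x).
Proof. by split=> //; exact: hopf_mor_id. Qed.

Lemma matchedPair_mor_comp (A B C : matchedPair k) (g : B -> C) (f : A -> B) :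
  matchedPair_mor g -> matchedPair_mor f -> matchedPair_mor (fun x => g (f x)).
Proof.
case=> gh ga gr [fh fa fr]; split=> [|x y|x y]; first exact: hopf_mor_comp.
  by rewrite fa ga.
by rewrite fr gr.
Qed.

Definition mpCat : category := concrete_cat matchedPair_mor_id matchedPair_mor_comp.

Definition mp_of_braidOp (B : braidOp k) : matchedPair k := MatchedPair (braiding_mp (bo_ax B)).
Definition braidOp_of_mp (B : matchedPair k) : braidOp k := BraidOp (mp_braiding (mp_ax B)).
Definition mp_of_hsb (B : hsb k) : matchedPair k := MatchedPair (hsb_mp (hsb_ax B)).
Definition hsb_of_mp (B : matchedPair k) : hsb k := HSB (mp_hsb (mp_ax B)).
Definition mp_of_ydb (B : ydb k) : matchedPair k := MatchedPair (ydb_mp (ydb_ax B)).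
Definition ydb_of_mp (B : matchedPair k) : ydb k := YDB (mp_ydb (mp_ax B)).

Lemma MatchedPair_eq (H : hopfAlg k) (a r a' r' : H -> H -> H)
    (M : is_mp a r) (M' : is_mp a' r') : a = a' -> r = r' -> MatchedPair M = MatchedPair M'.
Proof. by move=> e e'; subst a' r'; rewrite (Prop_irrelevance M M'). Qed.

Lemma BraidOp_eq (H : hopfAlg k) (s s' : tensor H H -> tensor H H)
    (M : is_braiding s) (M' : is_braiding s') : s = s' -> BraidOp M = BraidOp M'.
Proof. by move=> e; subst s'; rewrite (Prop_irrelevance M M'). Qed.

Lemma HSB_eq (H : hopfAlg k) (a r a' r' : H -> H -> H)
    (M : is_hsb a r) (M' : is_hsb a' r') : a = a' -> r = r' -> HSB M = HSB M'.
Proof. by move=> e e'; subst a' r'; rewrite (Prop_irrelevance M M'). Qed.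

Lemma YDB_eq (H : hopfAlg k) (m m' : H -> H -> H) (T T' : H -> H)
    (M : is_ydb m T) (M' : is_ydb m' T') : m = m' -> T = T' -> YDB M = YDB M'.
Proof. by move=> e e'; subst m' T'; rewrite (Prop_irrelevance M M'). Qed.

Lemma braidOp_mpK B : mp_of_braidOp (braidOp_of_mp B) = B.
Proof.
case: B => H a r M; apply: MatchedPair_eq; do 2 apply: funext => ?.
  exact: (braid_fst M).
exact: (braid_snd M).
Qed.

Lemma mp_braidOpK B : braidOp_of_mp (mp_of_braidOp B) = B.
Proof. by case: B => H s M; apply: BraidOp_eq; exact: braiding_roundtrip. Qed.

Lemma hsb_mpK B : mp_of_hsb (hsb_of_mp B) = B.
Proof.
case: B => H a r M; apply: MatchedPair_eq.
  exact: (mp_roundtrip_act M).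
exact: (mp_roundtrip_ract M).
Qed.

Lemma mp_hsbK B : hsb_of_mp (mp_of_hsb B) = B.
Proof. by case: B => H d c M; have [ed ec] := hsb_roundtrip M; apply: HSB_eq. Qed.

Lemma ydb_mpK B : mp_of_ydb (ydb_of_mp B) = B.
Proof.
case: B => H a r M; apply: MatchedPair_eq.
  exact: (ydb_lactE M).
exact: (ydb_ractE M).
Qed.

Lemma mp_ydbK B : ydb_of_mp (mp_of_ydb B) = B.
Proof. by case: B => H m T M; have [em eT] := ydb_roundtrip M; apply: YDB_eq. Qed.

Lemma mp_of_braidOp_mor (A B : braidOp k) (f : A -> B) : braidOp_mor f ->
  @matchedPair_mor k (mp_of_braidOp A) (mp_of_braidOp B) f.
Proof.
case=> fh fs; split=> // x y.
  exact: hopf_mor_lact_of_braid.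
exact: hopf_mor_ract_of_braid.
Qed.

Lemma braidOp_of_mp_mor (A B : matchedPair k) (f : A -> B) : matchedPair_mor f ->
  @braidOp_mor k (braidOp_of_mp A) (braidOp_of_mp B) f.
Proof. by case=> fh fa fr; split=> // t; exact: (tmap_braid_of fh (mp_ax A) (mp_ax B)). Qed.

Lemma mp_of_hsb_mor (A B : hsb k) (f : A -> B) : hsb_mor f ->
  @matchedPair_mor k (mp_of_hsb A) (mp_of_hsb B) f.
Proof.
case=> fh fd fc; split=> // x y.
  exact: (hopf_mor_act_of fh (hsb_ax A) (hsb_ax B)).
exact: (hopf_mor_ract_of fh (hsb_ax A) (hsb_ax B)).
Qed.

Lemma hsb_of_mp_mor (A B : matchedPair k) (f : A -> B) : matchedPair_mor f ->
  @hsb_mor k (hsb_of_mp A) (hsb_of_mp B) f.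
Proof.
case=> fh fa fr; split=> // x y.
  exact: (hopf_mor_dot_of fh).
exact: (hopf_mor_col_of fh (mp_ax B)).
Qed.

Lemma mp_of_ydb_mor (A B : ydb k) (f : A -> B) : ydb_mor f ->
  @matchedPair_mor k (mp_of_ydb A) (mp_of_ydb B) f.
Proof.
case=> fh fm fT; split=> // x y.
  exact: (hopf_mor_lact fh (ydb_ax B)).
exact: (hopf_mor_ract fh (ydb_ax B)).
Qed.

Lemma ydb_of_mp_mor (A B : matchedPair k) (f : A -> B) : matchedPair_mor f ->
  @ydb_mor k (ydb_of_mp A) (ydb_of_mp B) f.
Proof.
case=> fh fa fr; split=> // [x y|x].
  exact: (hopf_mor_times_of fh (mp_ax B)).
by rewrite (hopf_mor_T_of fh (mp_ax B)).
Qed.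

Ltac lift_functor C D o p :=
  refine (@Functor C D o (fun X Y f => exist _ (sval f) (p X Y _ (svalP f))) _ _);
  by move=> *; apply: chom_eq.

Definition mp_of_braidOpF : functor (braidOpCat k) mpCat.
Proof. lift_functor (braidOpCat k) mpCat mp_of_braidOp mp_of_braidOp_mor. Defined.
Definition braidOp_of_mpF : functor mpCat (braidOpCat k).
Proof. lift_functor mpCat (braidOpCat k) braidOp_of_mp braidOp_of_mp_mor. Defined.
Definition mp_of_hsbF : functor (hsbCat k) mpCat.
Proof. lift_functor (hsbCat k) mpCat mp_of_hsb mp_of_hsb_mor. Defined.
Definition hsb_of_mpF : functor mpCat (hsbCat k).
Proof. lift_functor mpCat (hsbCat k) hsb_of_mp hsb_of_mp_mor. Defined.
Definition mp_of_ydbF : functor (ydbCat k) mpCat.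
Proof. lift_functor (ydbCat k) mpCat mp_of_ydb mp_of_ydb_mor. Defined.
Definition ydb_of_mpF : functor mpCat (ydbCat k).
Proof. lift_functor mpCat (ydbCat k) ydb_of_mp ydb_of_mp_mor. Defined.

Theorem braidOp_mp_isomorphic : isomorphic_cat (braidOpCat k) mpCat.
Proof.
exists mp_of_braidOpF, braidOp_of_mpF; split; apply: concrete_functor_id => //.
  exact: mp_braidOpK.
exact: braidOp_mpK.
Qed.

Theorem hsb_mp_isomorphic : isomorphic_cat (hsbCat k) mpCat.
Proof.
exists mp_of_hsbF, hsb_of_mpF; split; apply: concrete_functor_id => //.
  exact: mp_hsbK.
exact: hsb_mpK.
Qed.

Theorem ydb_mp_isomorphic : isomorphic_cat (ydbCat k) mpCat.
Proof.
exists mp_of_ydbF, ydb_of_mpF; split; apply: concrete_functor_id => //.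
  exact: mp_ydbK.
exact: ydb_mpK.
Qed.
End Functors.

Theorem theorem6p34 (k : fieldType) :
  [/\ isomorphic_cat (braidOpCat k) (hsbCat k),
      isomorphic_cat (hsbCat k) (ydbCat k) &
      isomorphic_cat (braidOpCat k) (ydbCat k)].
Proof.
have [hB hH hY] := And3 (braidOp_mp_isomorphic k) (hsb_mp_isomorphic k) (ydb_mp_isomorphic k).
split; first exact: (isomorphic_trans hB (isomorphic_sym hH)).
- exact: (isomorphic_trans hH (isomorphic_sym hY)).
- exact: (isomorphic_trans hB (isomorphic_sym hY)).
Qed.
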